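(* Let $T=(V,E,F)$ be an infinite simplicial topological triangulation of the hyperbolic plane $\mathbb H^2$, and let $\epsilon>0$. Suppose $\phi,\psi:|T|\to\mathbb H^2$ are Delaunay hyperbolic geodesic mappings of $T$ such that (a) $\phi$ and $\psi$ are homeomorphisms from $|T|$ onto $\mathbb H^2$; (b) the induced edge lengths $l(\phi)$ and $l(\psi)$ are discretely conformal; (c) every inner angle of the hyperbolic triangles $\phi(\triangle ijk)$ and $\psi(\triangle ijk)$ is at least $\epsilon$, for every $\triangle ijk\in F$; (d) $\sup_{ij\in E} l_{ij}(\phi)<\epsilon^3/8192$ and $\sup_{ij\in E} l_{ij}(\psi)<\epsilon^3/8192$. Then $l(\phi)=l(\psi)$.
   Context: The hyperbolic plane is modeled as the Poincaré disk $\mathbb H^2=(D,g)$, $D=\{z\in\mathbb C:|z|<1\}$, $g=\frac{4|dz|^2}{(1-|z|^2)^2}$; $d(z_1,z_2)$ denotes hyperbolic distance. $T=(V,E,F)$ has vertex set $V$, edge set $E$, face set $F$; for a subcomplex $T_0=(V_0,E_0,F_0)$, $|T_0|$ is its underlying space. A map $\phi:|T_0|\to\mathbb H^2$ is a hyperbolic geodesic mapping if it maps each edge of $T_0$ to a hyperbolic geodesic arc and each triangle of $T_0$ to a hyperbolic geodesic triangle. It induces edge lengths $l(\phi)\in\mathbb R^{E_0}$, $l_{ij}(\phi)=d(\phi(i),\phi(j))$. Two edge length vectors $l,l'\in\mathbb R^{E_0}$ are (hyperbolic) discretely conformal if there is $u\in\mathbb R^{V_0}$ with $\sinh\frac{l'_{ij}}{2}=e^{\frac12(u_i+u_j)}\sinh\frac{l_{ij}}{2}$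 for every edge $ij\in E_0$; one writes $l'=u*_h l$. A hyperbolic geodesic mapping $\phi$ is Delaunay if for every pair of adjacent triangles $\triangle ijk,\triangle ijk'$ of $T_0$, the point $\phi(k')$ does not lie in the open circumdisk of the triangle $\phi(\triangle ijk)$. *)

(* Defs.v *)
From HB Require Import structures.
From mathcomp Require Import all_boot all_order all_algebra.
From mathcomp Require Import all_classical all_reals all_analysis.
Set Implicit Arguments. Unset Strict Implicit. Unset Printing Implicit Defensive.
Import Order.TTheory GRing.Theory Num.Theory.
Import numFieldNormedType.Exports.
Local Open Scope classical_set_scope.
Local Open Scope ring_scope.

Section Hyperbolic.
Variable R : realType.

Definition sqn (z : R * R) : R := z.1 ^+ 2 + z.2 ^+ 2.
Definition diskD : set (R * R) := [set z | sqn z < 1].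

Definition coshR (x : R) : R := (expR x + expR (- x)) / 2.
Definition sinhR (x : R) : R := (expR x - expR (- x)) / 2.
Definition acoshR (x : R) : R := ln (x + Num.sqrt (x ^+ 2 - 1)).

(* hyperbolic distance of g = 4|dz|^2/(1-|z|^2)^2 :
   d(z,w) = arcosh(1 + 2|z-w|^2 / ((1-|z|^2)(1-|w|^2))) *)
Definition hdist (z w : R * R) : R :=
  acoshR (1 + 2 * sqn (z.1 - w.1, z.2 - w.2) / ((1 - sqn z) * (1 - sqn w))).

Definition hseg (a b : R * R) : set (R * R) :=
  [set x | diskD x /\ hdist a x + hdist x b = hdist a b].

Definition htri (a b c : R * R) : set (R * R) :=
  [set x | exists y, hseg b c y /\ hseg a y x].

(* inner angle at a of the hyperbolic triangle abc (hyperbolic law of cosines) *)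
Definition hangle (a b c : R * R) : R :=
  acos ((coshR (hdist a b) * coshR (hdist a c) - coshR (hdist b c))
        / (sinhR (hdist a b) * sinhR (hdist a c))).

(* real equation of a generalized (Euclidean) circle/line in R^2 = C:
   P|z|^2 - 2 Re(conj q z) + s *)
Definition gcirc (P q1 q2 s : R) (z : R * R) : R :=
  P * sqn z - 2 * (q1 * z.1 + q2 * z.2) + s.

(* z lies in the open circumdisk of the hyperbolic triangle abc: the component
   of D minus the generalized circle through a, b, c which contains the
   (points of the) triangle. *)
Definition in_open_circumdisk (a b c z : R * R) : Prop :=
  exists P q1 q2 s : R,
    [|| P != 0, q1 != 0, q2 != 0 | s != 0] /\
    gcirc P q1 q2 s a = 0 /\ gcirc P q1 q2 s b = 0 /\ gcirc P q1 q2 s c = 0 /\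
    (exists m, htri a b c m /\ gcirc P q1 q2 s m < 0) /\
    diskD z /\ gcirc P q1 q2 s z < 0.

Variable V : eqType.

(* T = (V,E,F): F is the (symmetric) face relation on ordered triples. *)
Definition is_complex (F : V -> V -> V -> Prop) : Prop :=
  [/\ (forall i j k, F i j k -> [/\ i != j, j != k & i != k]),
      (forall i j k, F i j k -> F j i k),
      (forall i j k, F i j k -> F j k i) &
      (forall v, exists j k, F v j k)].

Definition edge (F : V -> V -> V -> Prop) (i j : V) : Prop := exists k, F i j k.

(* points of |T| are barycentric-coordinate functions V -> R *)
Definition vtx (i : V) : V -> R := fun v => if v == i then 1 else 0.
Definition edge_pt (i j : V) (t : R) : V -> R :=
  fun v => if v == i then t else if v == j then 1 - t else 0.
Definition face_pt (i j k : V) (st : R * R) : V -> R :=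
  fun v => if v == i then st.1 else if v == j then st.2
           else if v == k then 1 - st.1 - st.2 else 0.
Definition simplex2 : set (R * R) :=
  [set st | 0 <= st.1 /\ 0 <= st.2 /\ st.1 + st.2 <= 1].
Definition unit_itv : set R := [set t | 0 <= t <= 1].

Definition realization (F : V -> V -> V -> Prop) : set (V -> R) :=
  [set x | exists i j k, F i j k /\ exists st, simplex2 st /\ x = face_pt i j k st].

Definition weak_open (F : V -> V -> V -> Prop) (A : set (V -> R)) : Prop :=
  A `<=` realization F /\
  forall i j k, F i j k -> exists U : set (R * R),
      open U /\ [set st | simplex2 st /\ A (face_pt i j k st)] = U `&` simplex2.

Definition homeo_onto_H2 (F : V -> V -> V -> Prop) (phi : (V -> R) -> R * R) : Prop :=
  [/\ phi @` realization F = diskD,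
      (forall x y, realization F x -> realization F y -> phi x = phi y -> x = y),
      (forall i j k, F i j k -> {within simplex2, continuous (phi \o face_pt i j k)}) &
      (forall A, weak_open F A -> open (phi @` A))].

Definition infinite_triangulation_H2 (F : V -> V -> V -> Prop) : Prop :=
  [/\ is_complex F, ~ finite_set [set: V] & exists h, homeo_onto_H2 F h].

Definition geodesic_map (F : V -> V -> V -> Prop) (phi : (V -> R) -> R * R) : Prop :=
  (forall i j, edge F i j ->
     (fun t => phi (edge_pt i j t)) @` unit_itv = hseg (phi (vtx i)) (phi (vtx j))) /\
  (forall i j k, F i j k ->
     (phi \o face_pt i j k) @` simplex2 = htri (phi (vtx i)) (phi (vtx j)) (phi (vtx k))).

Definition elen (phi : (V -> R) -> R * R) (i j : V) : R :=
  hdist (phi (vtx i)) (phi (vtx j)).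

Definition delaunay (F : V -> V -> V -> Prop) (phi : (V -> R) -> R * R) : Prop :=
  forall i j k k', F i j k -> F i j k' -> k != k' ->
    ~ in_open_circumdisk (phi (vtx i)) (phi (vtx j)) (phi (vtx k)) (phi (vtx k')).

Definition disc_conformal (F : V -> V -> V -> Prop) (l l' : V -> V -> R) : Prop :=
  exists u : V -> R, forall i j, edge F i j ->
    sinhR (l' i j / 2) = expR ((u i + u j) / 2) * sinhR (l i j / 2).

(* every inner angle of every triangle phi(ijk) is >= eps (F is symmetric,
   so this covers the angles at all three vertices) *)
Definition angles_ge (F : V -> V -> V -> Prop) (phi : (V -> R) -> R * R) (eps : R) : Prop :=
  forall i j k, F i j k -> eps <= hangle (phi (vtx i)) (phi (vtx j)) (phi (vtx k)).

Definition sup_len_lt (F : V -> V -> V -> Prop) (phi : (V -> R) -> R * R) (c : R) : Prop :=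
  exists M, M < c /\ forall i j, edge F i j -> elen phi i j <= M.

End Hyperbolic.

(* Main.v *)
(** Let [S = sinh^2 (d / 2)] be the squared half-sinh of a distance, so that discrete
    conformality reads [S'_ij = E_i E_j S_ij] with [E = exp u].  By symmetry it suffices
    to show [E <= 1].  As in Ahlfors' proof of the Schwarz lemma, replace [phi] by
    [r * phi] with [r > 1] close to 1, on the finitely many vertices that stay in the
    disk; the conformal factor of [psi] relative to [r * phi] at [i] becomes
    [U_i = E_i (1 - r^2 |phi_i|^2) / (r (1 - |phi_i|^2))].  Where [U_i > 1], the sine law
    and the bounds on angles and edge lengths make the edges at [i] so short, compared with
    [1 - r^2 |phi_i|^2], that the whole star of [i] stays well inside the disk.  So if some
    [E_i > 1], the function [U] attains a maximum larger than 1 at an interior vertex [i].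

    Inverting the star of [i] in [phi_i] turns the neighbours [j] into the vertices of a
    polygon, which is convex because the triangulation is Delaunay; the angles of the
    hyperbolic triangles at [i] are those under which its edges are seen from a hub, the
    image of the reflection of [phi_i] in the unit circle, and the squared distance from
    the hub to the vertex [j] is [1 + 1 / S_ij] up to scale.  The polygons of [r * phi] and
    [psi] have, up to scale, the same edge lengths, and at the maximum of [U] all vertices of
    the second are further from its hub.  In terms of the squared distances to the hub, the
    convexity of the polygon is a linear condition and the nondegeneracy of its triangles a
    concave one, so one can interpolate linearly; the total angle decreases strictly on the
    way, although it is [2 pi] at both ends. *)
Require Import Defs.
From HB Require Import structures.
From mathcomp Require Import all_boot all_order all_algebra.
From mathcomp Require Import all_classical all_reals all_analysis.
From mathcomp Require Import ring lra.
Set Implicit Arguments. Unset Strict Implicit. Unset Printing Implicit Defensive.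
Import Order.TTheory GRing.Theory Num.Theory.
Import numFieldNormedType.Exports.
Local Open Scope classical_set_scope.
Local Open Scope ring_scope.

(** * Angles of triangles with given squared side lengths *)

(** The dilation forces a maximum to exist: on the infinite vertex set [E] need not attain its
    supremum, whereas [U] is positive only at the finitely many vertices in the open disk of radius
    [1 / r]. The price is that the angles computed from [r * phi] are not those of the hyperbolic
    triangles of [phi]. But dilations preserve circles, so the inverted polygon and its convexity
    stay the same and only the hub moves, on the line through 0 and [phi i]; the angle sum is
    unchanged as long as the hub crosses no line carrying an edge of the polygon. This is where
    short edges are needed. The cube in the length bound comes from the sine law: comparing adjacent
    sides costs a factor of order [eps^-2] in [S] for each map, hence [eps^-4] for [E_i / E_j], and
    a factor [eps^2] must survive. Nothing is known about the relative orientation of [phi] and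
    [psi], so each end of the interpolation gets one inequality only: disjoint cones give an angle
    sum at most [2 pi] for [phi], covering cones at least [2 pi] for [psi]. The strict decrease from
    [phi] to [psi] contradicts this. *)

Definition side_angle (R : realType) (A x y : R) : R :=
  acos ((x + y - A) / (2 * Num.sqrt (x * y))).

(* Sixteen times the squared area of the triangle (Heron's formula). *)
Definition gram (R : realType) (A x y : R) : R :=
  4 * x * y - (x + y - A) ^+ 2.

Lemma gramC (R : realType) (A x y : R) : gram A x y = gram A y x.
Proof. by rewrite /gram; ring. Qed.

Lemma side_cos_bound (R : realType) (A x y : R) :
  0 < x -> 0 < y -> 0 < gram A x y ->
  -1 < (x + y - A) / (2 * Num.sqrt (x * y)) < 1.
Proof.
move=> x0 y0 g0.
have q0 : 0 < Num.sqrt (x * y) by rewrite sqrtr_gt0 mulr_gt0.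
have q2 : Num.sqrt (x * y) ^+ 2 = x * y by rewrite sqr_sqrtr // ltW // mulr_gt0.
rewrite -ltr_norml normrM normfV ltr_pdivrMr ?normr_gt0 ?mulf_neq0 ?lt0r_neq0 //.
rewrite mul1r -(@ltr_pXn2r _ 2) ?nnegrE // !real_normK ?num_real // exprMn q2.
by move: g0; rewrite /gram subr_gt0; lra.
Qed.

(** The root of [gram] is four times the area, twice the product of two sides and the sine of their
    angle. So [(A + x - y) / Num.sqrt (gram A x y)] is the cotangent of the base angle at the end of
    the leg [x], and the apex angle moves by minus the logarithmic speeds of the legs, weighted by
    the base cotangents. *)
Lemma is_derive_side_angle (R : realType) (A t dx dy : R) (x y : R -> R) :
  0 < x t -> 0 < y t -> 0 < gram A (x t) (y t) ->
  is_derive t 1 x dx -> is_derive t 1 y dy ->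
  is_derive t 1 (fun t => side_angle A (x t) (y t))
    (- ((A + x t - y t) / (2 * x t) * dx + (A + y t - x t) / (2 * y t) * dy)
       / Num.sqrt (gram A (x t) (y t))).
Proof.
move=> x0 y0 g0 Dx Dy.
have xy0 : 0 < x t * y t by rewrite mulr_gt0.
set q := Num.sqrt (x t * y t).
have q0 : 0 < q by rewrite sqrtr_gt0.
have q2 : q ^+ 2 = x t * y t by rewrite sqr_sqrtr // ltW.
have Dxy : is_derive t 1 (fun t => x t * y t) (x t * dy + y t * dx).
  by have := is_deriveM Dx Dy.
have Dq : is_derive t 1 (Num.sqrt \o (fun t => x t * y t))
            ((2 * q)^-1 * (x t * dy + y t * dx)).
  by apply: is_derive1_comp => //; exact: is_derive1_sqrt.
have DV : is_derive t 1 (fun t => (Num.sqrt (x t * y t))^-1)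
            (- (q ^- 2) * ((2 * q)^-1 * (x t * dy + y t * dx))).
  by exact: (@is_deriveV R (fun s => Num.sqrt (x s * y s)) t _ 1 (lt0r_neq0 q0) Dq).
have DP : is_derive t 1 (fun t => x t + y t - A) (dx + dy).
  have := is_deriveB (is_deriveD Dx Dy) (is_derive_cst A t 1).
  by rewrite subr0.
set P := x t + y t - A.
have DG : is_derive t 1 (fun t => (x t + y t - A) / (2 * Num.sqrt (x t * y t)))
   (2^-1 * (P * (- (q ^- 2) * ((2 * q)^-1 * (x t * dy + y t * dx))) + q^-1 * (dx + dy))).
  have := is_deriveZ 2^-1 (is_deriveM DP DV).
  congr (is_derive _ _ _ _).
  by apply/funext => s /=; rewrite invfM mulrCA.
have b := side_cos_bound x0 y0 g0.
have := @is_derive1_comp R (@acos R)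
  (fun t => (x t + y t - A) / (2 * Num.sqrt (x t * y t))) t _ _ (is_derive1_acos b) DG.
congr (is_derive _ _ _ _).
set N := gram A (x t) (y t) in g0 *.
have N0 : 0 < Num.sqrt N by rewrite sqrtr_gt0.
have -> : 1 - (P / (2 * q)) ^+ 2 = N / (2 * q) ^+ 2.
  have -> : N = (2 * q) ^+ 2 - P ^+ 2 by rewrite /N /gram exprMn q2 -/P; ring.
  by field; rewrite lt0r_neq0.
rewrite sqrtrM ?ltW // sqrtrV ?exprn_ge0 ?mulr_ge0 ?ltW // sqrtr_sqr.
rewrite ger0_norm ?mulr_ge0 ?ltW //.
rewrite q2 /P.
field.
by rewrite !lt0r_neq0.
Qed.

Lemma is_derive_big_sum (R : realType) (I : eqType) (s : seq I) (f : I -> R -> R)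
    (df : I -> R) (t : R) :
  (forall i, i \in s -> is_derive t 1 (f i) (df i)) ->
  is_derive t 1 (fun t => \sum_(i <- s) f i t) (\sum_(i <- s) df i).
Proof.
elim: s => [|i s IH] Df.
  rewrite big_nil (_ : (fun t => _) = cst 0); first exact: is_derive_cst.
  by apply/funext => u; rewrite big_nil.
rewrite big_cons (_ : (fun t => _) = f i + (fun t => \sum_(j <- s) f j t)).
  apply: is_deriveD; first by apply: Df; rewrite mem_head.
  by apply: IH => j js; apply: Df; rewrite inE js orbT.
by apply/funext => u; rewrite big_cons.
Qed.

Lemma MVT01 (R : realType) (f df : R -> R) (a b : R) : a < b ->
  (forall t, a <= t <= b -> is_derive t 1 f (df t)) ->
  exists2 t, a <= t <= b & f b - f a = df t * (b - a).
Proof.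
move=> ab Df; have [||c] := @MVT R f df a b ab.
- by move=> t; rewrite in_itv /= => /andP[? ?]; apply: Df; rewrite !ltW.
- apply: derivable_within_continuous => t; rewrite in_itv /= => /Df[].
  by [].
- by rewrite in_itv /= => /andP[? ?] E; exists c => //; rewrite !ltW.
Qed.

(** Expanded, [gram A x y] is [2 A (x + y) - A^2 - (x - y)^2], which is concave in [(x, y)] for
    fixed [A]. *)
Lemma gram_segment (R : realType) (A x0 y0 x1 y1 t : R) : 0 <= t <= 1 ->
  0 < gram A x0 y0 -> 0 < gram A x1 y1 ->
  0 < gram A (x0 + t * (x1 - x0)) (y0 + t * (y1 - y0)).
Proof.
move=> /andP[t0 t1] g0 g1.
have -> : gram A (x0 + t * (x1 - x0)) (y0 + t * (y1 - y0)) =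
    (1 - t) * gram A x0 y0 + t * gram A x1 y1
    + t * (1 - t) * (x1 - x0 - (y1 - y0)) ^+ 2 by rewrite /gram; ring.
apply: ltr_wpDr; first by rewrite mulr_ge0 ?sqr_ge0 // mulr_ge0 // subr_ge0.
have [->|tn0] := eqVneq t 0; first by rewrite subr0 mul1r mul0r addr0.
apply: ltr_wpDl; first by rewrite mulr_ge0 ?(ltW g0) // subr_ge0.
by rewrite mulr_gt0 // lt0r tn0.
Qed.

(** The function [X / sqrt (c - X^2)] is odd and increasing. The two base angles at a polygon vertex
    share their leg, hence the constant [c]. *)
Lemma cot_sum_ge0 (R : realType) (c X Y : R) : X ^+ 2 < c -> Y ^+ 2 < c ->
  0 <= X + Y -> 0 <= X / Num.sqrt (c - X ^+ 2) + Y / Num.sqrt (c - Y ^+ 2).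
Proof.
wlog XY : X Y / Y <= X => [H|] Xc Yc s.
  have [YX|/ltW XY] := leP Y X; first exact: H.
  by rewrite addrC; apply: H => //; rewrite addrC.
have X0 : 0 <= X by lra.
have qX : 0 < Num.sqrt (c - X ^+ 2) by rewrite sqrtr_gt0 subr_gt0.
have qY : 0 < Num.sqrt (c - Y ^+ 2) by rewrite sqrtr_gt0 subr_gt0.
have [Y0|Y0] := leP 0 Y; first by rewrite addr_ge0 ?divr_ge0 // ltW.
apply: (@le_trans _ _ ((X + Y) / Num.sqrt (c - Y ^+ 2))).
  by rewrite divr_ge0 // ltW.
rewrite mulrDl lerD2r ler_wpM2l // lef_pV2 // ler_wsqrtr //.
by rewrite lerD2l lerN2 -[leLHS]sqrrN ler_sqr ?nnegrE //; lra.
Qed.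

Lemma cot_sum_gt0 (R : realType) (c X Y : R) : X ^+ 2 < c -> Y ^+ 2 < c ->
  0 < X + Y -> 0 < X / Num.sqrt (c - X ^+ 2) + Y / Num.sqrt (c - Y ^+ 2).
Proof.
wlog XY : X Y / Y <= X => [H|] Xc Yc s.
  have [YX|/ltW XY] := leP Y X; first exact: H.
  by rewrite addrC; apply: H => //; rewrite addrC.
have X0 : 0 < X by lra.
have qX : 0 < Num.sqrt (c - X ^+ 2) by rewrite sqrtr_gt0 subr_gt0.
have qY : 0 < Num.sqrt (c - Y ^+ 2) by rewrite sqrtr_gt0 subr_gt0.
have [Y0|Y0] := leP 0 Y.
  by rewrite ltr_pwDl ?divr_gt0 // divr_ge0 // ltW.
apply: (@lt_le_trans _ _ ((X + Y) / Num.sqrt (c - Y ^+ 2))).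
  by rewrite divr_gt0.
rewrite mulrDl lerD2r ler_wpM2l ?(ltW X0) // lef_pV2 // ler_wsqrtr //.
by rewrite lerD2l lerN2 -[leLHS]sqrrN ler_sqr ?nnegrE //; lra.
Qed.

(* [X / sqrt (4 x - X^2)] is the cotangent of the base angle at the vertex of the
   squared leg [x], where [X = 2 sqrt x cos]. *)
Lemma base_cot (R : realType) (a x y : R) : 0 < a ->
  (a ^+ 2 + x - y) / Num.sqrt (gram (a ^+ 2) x y) =
  ((a ^+ 2 + x - y) / a)
    / Num.sqrt (4 * x - ((a ^+ 2 + x - y) / a) ^+ 2).
Proof.
move=> a0; set X := (a ^+ 2 + x - y) / a.
have XE : a ^+ 2 + x - y = X * a by rewrite divfK // lt0r_neq0.
have -> : gram (a ^+ 2) x y = a ^+ 2 * (4 * x - X ^+ 2).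
  by rewrite mulrBr -exprMn [a * X]mulrC -XE /gram; ring.
rewrite sqrtrM ?sqr_ge0 // sqrtr_sqr gtr0_norm // XE.
have [->|q0] := eqVneq (Num.sqrt (4 * x - X ^+ 2)) 0.
  by rewrite mulr0 !invr0 !mulr0.
by field; rewrite q0 lt0r_neq0.
Qed.

Lemma base_cos_bound (R : realType) (a x y : R) : 0 < a ->
  0 < gram (a ^+ 2) x y -> ((a ^+ 2 + x - y) / a) ^+ 2 < 4 * x.
Proof.
move=> a0 g; rewrite expr_div_n ltr_pdivrMr ?exprn_gt0 //.
by move: g; rewrite /gram; lra.
Qed.

Lemma eq_big_perm (R : realType) (T : eqType) (s : seq T) (f : T -> T)
    (g : T -> R) :
  perm_eq (map f s) s -> \sum_(j <- s) g j = \sum_(j <- s) g (f j).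
Proof. by move=> p; rewrite -(perm_big _ p) big_map. Qed.

(* A closed polygon with side lengths [a j] is seen from a hub at squared distances
   [x j].  Both the nondegeneracy of the triangles and the convexity of the polygon
   at each of its vertices are convex conditions on [x], so the linear path between
   the two configurations stays admissible; along it the derivative of the angle sum
   is minus a combination of the sums of the two base cotangents at each vertex. *)
Lemma hub_angle_sum_decreasing (R : realType) (T : eqType) (lk : seq T)
    (nx : T -> T) (a x0 x1 : T -> R) :
  let convex x := {in lk, forall j,
    0 <= (a j ^+ 2 + x (nx j) - x j) / a j
       + (a (nx j) ^+ 2 + x (nx j) - x (nx (nx j))) / a (nx j)} in
  perm_eq (map nx lk) lk -> (exists j, j \in lk) ->
  {in lk, forall j, 0 < a j} ->
  {in lk, forall j, 0 < x0 j} ->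
  {in lk, forall j, x0 j < x1 j} ->
  {in lk, forall j, 0 < gram (a j ^+ 2) (x0 j) (x0 (nx j))} ->
  {in lk, forall j, 0 < gram (a j ^+ 2) (x1 j) (x1 (nx j))} ->
  convex x0 -> convex x1 ->
  \sum_(j <- lk) side_angle (a j ^+ 2) (x1 j) (x1 (nx j)) <
  \sum_(j <- lk) side_angle (a j ^+ 2) (x0 j) (x0 (nx j)).
Proof.
move=> convex pn [j0 j0lk] a0 x0p x01 g0 g1 c0 c1.
have nxlk j : j \in lk -> nx j \in lk.
  by move=> jlk; rewrite -(perm_mem pn) map_f.
pose x t j := x0 j + t * (x1 j - x0 j).
pose f t := \sum_(j <- lk) side_angle (a j ^+ 2) (x t j) (x t (nx j)).
have xp (t : R) j : 0 <= t <= 1 -> j \in lk -> 0 < x t j.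
  move=> /andP[t0 t1] jlk; apply: ltr_wpDr; last exact: x0p.
  by rewrite mulr_ge0 // subr_ge0 ltW // x01.
have gt (t : R) j : 0 <= t <= 1 -> j \in lk -> 0 < gram (a j ^+ 2) (x t j) (x t (nx j)).
  by move=> t01 jlk; apply: gram_segment => //; [exact: g0|exact: g1].
have ct (t : R) : 0 <= t <= 1 -> convex (x t).
  move=> /andP[t0 t1] j jlk; have := c0 j jlk; have := c1 j jlk.
  set L0 := (X in _ -> 0 <= X -> _); set L1 := (X in 0 <= X -> _) => p1 p0.
  rewrite [leRHS](_ : _ = (1 - t) * L0 + t * L1); last first.
    by rewrite /L0 /L1 /x; ring.
  by rewrite addr_ge0 // mulr_ge0 // subr_ge0.
pose h t j := (x1 j - x0 j) / (2 * x t j).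
pose cotr t j := (a j ^+ 2 + x t j - x t (nx j))
  / Num.sqrt (gram (a j ^+ 2) (x t j) (x t (nx j))).
pose cotl t j := (a j ^+ 2 + x t (nx j) - x t j)
  / Num.sqrt (gram (a j ^+ 2) (x t j) (x t (nx j))).
have Df (t : R) : 0 <= t <= 1 ->
    is_derive t 1 f (- \sum_(j <- lk) h t (nx j) * (cotl t j + cotr t (nx j))).
  move=> t01.
  have Dx j : is_derive t 1 (x^~ j) (x1 j - x0 j).
    have := is_deriveD (is_derive_cst (x0 j) t 1)
      (is_deriveM (is_derive_id t 1) (is_derive_cst (x1 j - x0 j) t 1)).
    rewrite add0r scaler0 add0r [(x1 j - x0 j) *: _]mulr1.
    by [].
  have -> : - \sum_(j <- lk) h t (nx j) * (cotl t j + cotr t (nx j)) =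
     \sum_(j <- lk) - (((a j ^+ 2 + x t j - x t (nx j)) / (2 * x t j) * (x1 j - x0 j)
        + (a j ^+ 2 + x t (nx j) - x t j) / (2 * x t (nx j)) * (x1 (nx j) - x0 (nx j)))
        / Num.sqrt (gram (a j ^+ 2) (x t j) (x t (nx j)))).
    rewrite sumrN; congr (- _).
    under eq_bigr do rewrite mulrDr; rewrite big_split /=.
    rewrite -(eq_big_perm (fun j => h t j * cotr t j) pn) -big_split /=.
    by apply: eq_bigr => j _; rewrite /h /cotr /cotl; ring.
  apply: is_derive_big_sum => j jlk; rewrite -mulNr.
  by apply: is_derive_side_angle; rewrite ?xp ?nxlk ?gt.
have [t t01] := MVT01 ltr01 Df.
rewrite subr0 mulr1 => E.
have cE j : j \in lk -> 0 <= cotl t j + cotr t (nx j).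
  move=> jlk; rewrite /cotl /cotr gramC !base_cot ?a0 ?nxlk //.
  apply: cot_sum_ge0; last exact: ct.
    by apply: base_cos_bound; rewrite ?a0 // gramC gt.
  by apply: base_cos_bound; rewrite ?a0 ?gt ?nxlk.
have hp j : j \in lk -> 0 < h t (nx j).
  by move=> jlk; rewrite divr_gt0 ?mulr_gt0 ?xp ?nxlk // subr_gt0 x01 ?nxlk.
suff : 0 < \sum_(j <- lk) h t (nx j) * (cotl t j + cotr t (nx j)).
  rewrite -oppr_lt0 -E subr_lt0 /f.
  under eq_bigr => j _ do rewrite /x !mul1r !(addrC (x0 _)) !subrK.
  by under [ltRHS]eq_bigr => j _ do rewrite /x !mul0r !addr0.
(* Strictness: summed around the polygon, the legs cancel from the convexity terms and twice the
   perimeter remains, so the polygon is not flat at every vertex. *)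
have [j jlk jp] : exists2 j, j \in lk & 0 <
    (a j ^+ 2 + x t (nx j) - x t j) / a j
       + (a (nx j) ^+ 2 + x t (nx j) - x t (nx (nx j))) / a (nx j).
  apply/not_exists2P => H.
  have : \sum_(j <- lk) ((a j ^+ 2 + x t (nx j) - x t j) / a j
       + (a (nx j) ^+ 2 + x t (nx j) - x t (nx (nx j))) / a (nx j)) <= 0.
    rewrite big_seq; apply: sumr_le0 => j jlk.
    by case: (H j) => // /negP; rewrite -leNgt.
  rewrite big_split /=.
  rewrite -(eq_big_perm (fun j => (a j ^+ 2 + x t j - x t (nx j)) / a j) pn).
  rewrite -big_split /= leNgt => /negP; apply.
  rewrite big_seq (eq_bigr (fun j => 2 * a j)); last first.
    by move=> j jlk; field; rewrite lt0r_neq0 // a0.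
  rewrite -big_seq (big_rem j0) //=; apply: ltr_pwDl.
    by rewrite mulr_gt0 // a0.
  rewrite big_seq; apply: sumr_ge0 => j /mem_rem jlk.
  by rewrite mulr_ge0 // ltW // a0.
rewrite (big_rem j) //=; apply: ltr_pwDl.
  rewrite mulr_gt0 ?hp // /cotl /cotr gramC !base_cot ?a0 ?nxlk //.
  apply: cot_sum_gt0 => //.
    by apply: base_cos_bound; rewrite ?a0 // gramC gt.
  by apply: base_cos_bound; rewrite ?a0 ?gt ?nxlk.
rewrite big_seq; apply: sumr_ge0 => i /mem_rem ilk.
by rewrite mulr_ge0 ?cE // ltW // hp.
Qed.

(** * Moving the hub of a star polygon *)

Definition cr (R : realType) (v w : R * R) : R := v.1 * w.2 - v.2 * w.1.
Definition dt (R : realType) (v w : R * R) : R := v.1 * w.1 + v.2 * w.2.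
Definition vsub (R : realType) (v w : R * R) : R * R := (v.1 - w.1, v.2 - w.2).
Definition scal (R : realType) (c : R) (v : R * R) : R * R := (c * v.1, c * v.2).

Lemma sqn_ge0 (R : realType) (v : R * R) : 0 <= sqn v.
Proof. by rewrite addr_ge0 // sqr_ge0. Qed.

Lemma sqn_vsubC (R : realType) (a b : R * R) : sqn (vsub a b) = sqn (vsub b a).
Proof. by rewrite /sqn /vsub /=; ring. Qed.

Lemma lagrange2 (R : realType) (v w : R * R) :
  dt v w ^+ 2 + cr v w ^+ 2 = sqn v * sqn w.
Proof. by rewrite /dt /cr /sqn; ring. Qed.

Lemma cr_neq0_sqn (R : realType) (v w : R * R) : cr v w != 0 ->
  0 < sqn v /\ 0 < sqn w.
Proof.
move=> c; have p : 0 < sqn v * sqn w.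
  by rewrite -lagrange2; apply: ltr_wpDl; rewrite ?sqr_ge0 // lt0r sqrf_eq0 c sqr_ge0.
by split; rewrite lt0r sqn_ge0 andbT; apply: contraTneq p => ->;
  rewrite ?mul0r ?mulr0 ltxx.
Qed.

Lemma gram_hub (R : realType) (v w : R * R) :
  gram (sqn (vsub v w)) (sqn v) (sqn w) = (2 * cr v w) ^+ 2.
Proof. by rewrite /gram /sqn /vsub /cr /=; ring. Qed.

Definition hub_angle (R : realType) (o p q : R * R) : R :=
  side_angle (sqn (vsub p q)) (sqn (vsub p o)) (sqn (vsub q o)).

(** Each end contributes the angular speed of its own direction as seen from the moving hub, so the
    derivative is a difference of one function evaluated at [p] and at [q]. *)
Lemma is_derive_hub_angle (R : realType) (z p q : R * R) (c : R) :
  let v := vsub p (scal c z) in let w := vsub q (scal c z) in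
  0 < cr v w ->
  is_derive c 1 (fun c => hub_angle (scal c z) p q)
    (cr v z / sqn v - cr w z / sqn w).
Proof.
move=> v w k0.
have [sv sw] : 0 < sqn v /\ 0 < sqn w by apply: cr_neq0_sqn; rewrite gt_eqF.
have D (r : R * R) : is_derive c 1 (fun c => sqn (vsub r (scal c z)))
    (- 2 * dt (vsub r (scal c z)) z).
  have -> : (fun c => sqn (vsub r (scal c z))) =
      cst (sqn r) + (- 2 * dt r z) *: id + (sqn z) *: (id ^+ 2).
    apply/funext => t; rewrite /sqn /dt /vsub /scal /=.
    rewrite !fctE /=. rewrite -![_ *: _]/(_ * _). ring.
  have := is_deriveD (is_deriveD (is_derive_cst (sqn r) c 1)
    (is_deriveZ (- 2 * dt r z) (is_derive_id c 1)))
    (is_deriveZ (sqn z) (is_deriveX 2 (is_derive_id c 1))).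
  congr (is_derive _ _ _ _).
  by rewrite -![_ *: _]/(_ * _) /sqn /dt /vsub /scal /=; ring.
have vw : vsub v w = vsub p q by rewrite /v /w /vsub /=; congr pair; ring.
have g0 : 0 < gram (sqn (vsub p q)) (sqn v) (sqn w).
  by rewrite -vw gram_hub exprn_gt0 // mulr_gt0.
have := @is_derive_side_angle R _ c _ _ (fun c => sqn (vsub p (scal c z)))
  (fun c => sqn (vsub q (scal c z))) sv sw g0 (D p) (D q).
congr (is_derive _ _ _ _).
rewrite -/v -/w -vw gram_hub sqrtr_sqr ger0_norm ?mulr_ge0 ?(ltW k0) //.
have nv := lt0r_neq0 sv; have nw := lt0r_neq0 sw; have nk := lt0r_neq0 k0.
move: nv nw nk; rewrite /sqn /cr /dt /vsub /= => nv nw nk.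
by field; rewrite nv nw nk.
Qed.

(** These angular speeds cancel around the cycle; positive cross products keep the hub off the lines
    of the edges, where the angles would not be differentiable. *)
Lemma hub_angle_sum_const (R : realType) (T : eqType) (lk : seq T)
    (nx : T -> T) (z : R * R) (p : T -> R * R) (c0 c1 : R) :
  perm_eq (map nx lk) lk -> c0 <= c1 ->
  (forall c, c0 <= c <= c1 -> {in lk, forall j,
    0 < cr (vsub (p j) (scal c z)) (vsub (p (nx j)) (scal c z))}) ->
  \sum_(j <- lk) hub_angle (scal c0 z) (p j) (p (nx j)) =
  \sum_(j <- lk) hub_angle (scal c1 z) (p j) (p (nx j)).
Proof.
move=> pn; rewrite le_eqVlt => /predU1P[-> //|c01] cp.
pose g c j := cr (vsub (p j) (scal c z)) z / sqn (vsub (p j) (scal c z)).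
have [c _] : exists2 c, c0 <= c <= c1 &
    (\sum_(j <- lk) hub_angle (scal c1 z) (p j) (p (nx j)))
    - (\sum_(j <- lk) hub_angle (scal c0 z) (p j) (p (nx j)))
    = (\sum_(j <- lk) (g c j - g c (nx j))) * (c1 - c0).
  apply: (@MVT01 _ (fun c => \sum_(j <- lk) hub_angle (scal c z) (p j) (p (nx j)))
     (fun c => \sum_(j <- lk) (g c j - g c (nx j)))) => // c cc.
  by apply: is_derive_big_sum => j jlk; apply: is_derive_hub_angle; exact: cp.
rewrite sumrB -(eq_big_perm _ pn) subrr mul0r => /eqP.
by rewrite subr_eq0 => /eqP.
Qed.

(* Convexity of a polygon at a vertex, seen from a hub on its inner side: the two
   base angles at the vertex add up to at most pi. *)
Lemma hub_convex (R : realType) (v w w' : R * R) (a a' : R) :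
  0 < cr v w -> 0 < cr w' v -> 0 <= cr (vsub w v) (vsub w' v) ->
  0 < a -> a ^+ 2 = sqn (vsub w v) -> 0 < a' -> a' ^+ 2 = sqn (vsub w' v) ->
  0 <= (a ^+ 2 + sqn v - sqn w) / a + (a' ^+ 2 + sqn v - sqn w') / a'.
Proof.
set e := vsub w v; set e' := vsub w' v => c1 c2 cc a0 aa a'0 aa'.
have ve : 0 < cr v e by move: c1; rewrite /e /cr /vsub /=; lra.
have ve' : 0 < cr e' v by move: c2; rewrite /e' /cr /vsub /=; lra.
have -> : a ^+ 2 + sqn v - sqn w = - 2 * dt v e.
  by rewrite aa /e /dt /sqn /vsub /=; ring.
have -> : a' ^+ 2 + sqn v - sqn w' = - 2 * dt v e'.
  by rewrite aa' /e' /dt /sqn /vsub /=; ring.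
have ed : dt e e' + a * a' >= 0.
  have aa'0 : 0 < a * a' by rewrite mulr_gt0.
  rewrite leNgt; apply/negP => d0.
  have : (a * a' - dt e e') * (dt e e' + a * a') < 0.
    by rewrite pmulr_rlt0 //; lra.
  rewrite (_ : _ * _ = (a * a') ^+ 2 - dt e e' ^+ 2); last by ring.
  by rewrite exprMn aa aa' -lagrange2 addrC addKr ltNge sqr_ge0.
suff H : dt v e * a' + dt v e' * a <= 0.
  rewrite [leRHS](_ : _ = - 2 * (dt v e * a' + dt v e' * a) / (a * a')); last first.
    by field; rewrite !lt0r_neq0.
  by rewrite divr_ge0 ?(ltW (mulr_gt0 a0 a'0)) // mulr_le0 // oppr_le0.
(* v * cr e e' = - e * cr e' v - e' * cr v e *)
have I1 : dt v e * cr e e' = - (sqn e * cr e' v + dt e e' * cr v e).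
  by rewrite /dt /cr /sqn; ring.
have I2 : dt v e' * cr e e' = - (dt e e' * cr e' v + sqn e' * cr v e).
  by rewrite /dt /cr /sqn; ring.
have [c0|c0] := eqVneq (cr e e') 0; last first.
  have cp : 0 < cr e e' by rewrite lt0r c0.
  rewrite -(pmulr_lle0 _ cp) mulrDl ![_ * _ * cr e e']mulrAC I1 I2 -aa -aa'.
  rewrite [leLHS](_ : _ = - (dt e e' + a * a') * (cr e' v * a + cr v e * a')).
    by rewrite mulr_le0_ge0 ?oppr_le0 // addr_ge0 // mulr_ge0 // ltW.
  by ring.
(* The polygon is flat at this vertex: [e] and [e'] are opposite directions, the base angles are
   supplementary and the sum vanishes. *)
have /eqP : (dt v e * a' + dt v e' * a) * cr v e = 0.
  have J : dt v e * cr e' v + dt v e' * cr v e = - sqn v * cr e e'.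
    by rewrite /dt /cr /sqn; ring.
  have aA : a * cr e' v = a' * cr v e.
    apply/eqP; rewrite -(@eqrXn2 _ 2) ?mulr_ge0 ?(ltW ve) ?(ltW ve') ?(ltW a0) ?(ltW a'0) //.
    rewrite !exprMn aa aa' !expr2 -subr_eq0; apply/eqP.
    rewrite c0 mulr0 in I1; rewrite c0 mulr0 in I2.
    have -> : sqn e * (cr e' v * cr e' v) - sqn e' * (cr v e * cr v e) =
      (sqn e * cr e' v + dt e e' * cr v e) * cr e' v
      - (dt e e' * cr e' v + sqn e' * cr v e) * cr v e by ring.
    by rewrite -[X in X * _ - _]opprK -I1 -[X in _ - X * _]opprK -I2; ring.
  rewrite mulrDl -mulrA -aA.
  rewrite (_ : _ + _ = a * (dt v e * cr e' v + dt v e' * cr v e)); last by ring.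
  by rewrite J c0 !mulr0.
by rewrite mulf_eq0 [cr v e == 0]gt_eqF // orbF => /eqP->.
Qed.

(** * Angle sums around a point *)

Definition vangle (R : realType) (v w : R * R) : R :=
  acos (dt v w / Num.sqrt (sqn v * sqn w)).

Definition dir (R : realType) (t : R) : R * R := (cos t, sin t).

Lemma hub_angleE (R : realType) (o p q : R * R) :
  hub_angle o p q = vangle (vsub p o) (vsub q o).
Proof.
rewrite /hub_angle /side_angle /vangle; congr acos.
rewrite (_ : _ + _ - _ = 2 * dt (vsub p o) (vsub q o)).
  by rewrite -mulf_div mulfV ?mul1r.
by rewrite /sqn /dt /vsub /=; ring.
Qed.

Lemma sin_signs (R : realType) (x : R) : - (2 * pi) < x < 2 * pi ->
  [\/ x <= - pi /\ 0 <= sin x, - pi < x < 0 /\ sin x < 0,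
     0 <= x <= pi /\ 0 <= sin x | pi < x /\ sin x < 0].
Proof.
move=> /andP[x0 x1].
have [xn|xn] := leP x (- pi).
  constructor 1; split => //; rewrite -(sinD2pi x) sin_ge0_pi //.
  by rewrite -mulr_natl; apply/andP; split; lra.
have [xn0|xn0] := ltP x 0.
  constructor 2; split; first by apply/andP.
  rewrite -[x]opprK sinN oppr_lt0 sin_gt0_pi // //.
  by apply/andP; split; lra.
have [xp|xp] := leP x pi; first by constructor 3; split; [apply/andP|rewrite sin_ge0_pi // xn0].
constructor 4; split => //.
rewrite -[x](subrK pi) sinDpi oppr_lt0 sin_gt0_pi //.
by apply/andP; split; lra.
Qed.

Lemma sin_gt0_wrap (R : realType) (x : R) : - (2 * pi) < x < - pi -> 0 < sin x.
Proof.
move=> /andP[x0 x1]; rewrite -(sinD2pi x) sin_gt0_pi //.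
by rewrite -mulr_natl; apply/andP; split; lra.
Qed.

Lemma polar (R : realType) (v : R * R) : 0 < sqn v ->
  exists2 a, 0 <= a < 2 * pi & v = scal (Num.sqrt (sqn v)) (dir a).
Proof.
move=> v0; set n := Num.sqrt _.
have n0 : 0 < n by rewrite sqrtr_gt0.
have nn : n ^+ 2 = sqn v by rewrite sqr_sqrtr // ltW.
have xb : -1 <= v.1 / n <= 1.
  rewrite -ler_norml normrM normfV (gtr0_norm n0) ler_pdivrMr // mul1r.
  rewrite -(@ler_pXn2r _ 2) ?nnegrE // ?(ltW n0) // real_normK ?num_real // nn.
  by rewrite /sqn lerDl sqr_ge0.
have cE : n * cos (acos (v.1 / n)) = v.1.
  by rewrite acosK ?in_itv //= mulrC divfK // lt0r_neq0.
have sE : n * sin (acos (v.1 / n)) = `|v.2|.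
  rewrite sin_acos // -[X in X * _](gtr0_norm n0) -sqrtr_sqr -sqrtrM ?sqr_ge0 //.
  rewrite -[RHS]sqrtr_sqr; congr Num.sqrt.
  rewrite mulrBr mulr1 -exprMn [n * _]mulrC divfK ?lt0r_neq0 // nn /sqn.
  by rewrite addrC addKr.
have a0 := acos_ge0 xb; have a1 := acos_lepi xb.
have pi0 := @pi_gt0 R.
have [v2|v2] := leP 0 v.2.
  exists (acos (v.1 / n)).
    by apply/andP; split => //; lra.
  by rewrite /scal /dir /= cE sE ger0_norm //; case: (v).
exists (2 * pi - acos (v.1 / n)).
  apply/andP; split; first by lra.
  rewrite ltrBlDr ltrDl lt0r a0 andbT; apply/eqP => E.
  by move: sE; rewrite E sin0 mulr0 => /esym/normr0P/eqP v20; rewrite v20 ltxx in v2.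
have -> : dir (2 * pi - acos (v.1 / n)) =
    (cos (acos (v.1 / n)), - sin (acos (v.1 / n))).
  by rewrite /dir addrC mulr_natl cosD2pi sinD2pi cosN sinN.
by rewrite /scal /= mulrN cE sE ltr0_norm // opprK; case: (v).
Qed.

(** Angles are added as Lebesgue measures of sets of directions in [[0, 2 pi)]: the closed sector
    [I] serves covering arguments, the open sector [J] disjointness arguments. A sector across the
    direction 0 becomes two intervals. *)
Lemma arc_sets (R : realType) (v w : R * R) : 0 < cr v w ->
  exists I J : set R,
  [/\ measurable I /\ measurable J,
      lebesgue_measure I = (vangle v w)%:E,
      lebesgue_measure J = (vangle v w)%:E,
      (forall t, 0 <= t < 2 * pi -> 0 <= cr v (dir t) -> 0 <= cr (dir t) w -> I t) &
      (forall t, J t ->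
         [/\ 0 <= t < 2 * pi, 0 < cr v (dir t) & 0 < cr (dir t) w])].
Proof.
move=> k0; have [sv sw] : 0 < sqn v /\ 0 < sqn w by apply: cr_neq0_sqn; rewrite gt_eqF.
have [a /andP[a0 a2] va] := polar sv; have [b /andP[b0 b2] wb] := polar sw.
move: va wb; set n := Num.sqrt (sqn v); set m := Num.sqrt (sqn w) => va wb.
have n0 : 0 < n by rewrite sqrtr_gt0.
have m0 : 0 < m by rewrite sqrtr_gt0.
have cv t : cr v (dir t) = n * sin (t - a).
  by rewrite va /cr /scal /dir /= sinB; ring.
have cw t : cr (dir t) w = m * sin (b - t).
  by rewrite wb /cr /scal /dir /= sinB; ring.
have cvw : cr v w = n * m * sin (b - a).
  by rewrite va wb /cr /scal /dir /= sinB; ring.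
have sba : 0 < sin (b - a) by move: k0; rewrite cvw pmulr_rgt0 // mulr_gt0.
have vE : vangle v w = acos (cos (b - a)).
  rewrite /vangle sqrtrM ?(ltW sv) // -/n -/m; congr acos.
  rewrite va wb /dt /scal /dir /= cosB; field.
  by rewrite !lt0r_neq0.
have pi0 := @pi_gt0 R.
have cvge t : 0 <= cr v (dir t) -> 0 <= sin (t - a) by rewrite cv pmulr_rge0.
have cwge t : 0 <= cr (dir t) w -> 0 <= sin (b - t) by rewrite cw pmulr_rge0.
have bar : - (2 * pi) < b - a < 2 * pi by apply/andP; split; lra.
have ss := sin_signs.
have case12 : a < b < a + pi \/ b < a - pi.
  case: (ss _ _ bar) => [[h _]|[_ h]|[h _]|[_ h]]; last 1 first.
  - by have := lt_trans h sba; rewrite ltxx.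
  - right; rewrite lt_neqAle; apply/andP; split; last by lra.
    apply/eqP => E; move: sba; rewrite E (_ : a - pi - a = - pi); last by ring.
    by rewrite sinN sinpi oppr0 ltxx.
  - by have := lt_trans h sba; rewrite ltxx.
  left; move: h => /andP[h0 h1]; apply/andP; split.
    rewrite lt_neqAle; apply/andP; split; last by lra.
    by apply/eqP => E; move: sba; rewrite E subrr sin0 ltxx.
  rewrite lt_neqAle; apply/andP; split; last by lra.
  apply/eqP => E; move: sba; rewrite E (_ : a + pi - a = pi); last by ring.
  by rewrite sinpi ltxx.
case: case12 => [/andP[ab ba]|ba].
  have th : vangle v w = b - a.
    by rewrite vE cosK // in_itv /=; apply/andP; split; lra.
  exists `[a, b]%classic, `]a, b[%classic; split.
  - by split; exact: measurable_itv.
  - by rewrite lebesgue_measure_itv /= lte_fin ab th EFinB.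
  - by rewrite lebesgue_measure_itv /= lte_fin ab th EFinB.
  - move=> t /andP[t0 t1] /cvge h1 /cwge h2; rewrite /= in_itv /=.
    apply/andP; split; rewrite leNgt; apply/negP => h.
      case: (ss _ (t - a)); rewrite ?[sin _ < 0]ltNge ?h1.
      + by apply/andP; split; lra.
      + move=> [h3 _]; case: (ss _ (b - t)); rewrite ?[sin _ < 0]ltNge ?h2.
        * by apply/andP; split; lra.
        * by case; lra.
        * by case.
        * by case => /andP[]; lra.
        * by case.
      + by case.
      + by case => /andP[]; lra.
      + by case.
    case: (ss _ (b - t)); rewrite ?[sin _ < 0]ltNge ?h2.
    + by apply/andP; split; lra.
    + move=> [h3 _]; case: (ss _ (t - a)); rewrite ?[sin _ < 0]ltNge ?h1.
      * by apply/andP; split; lra.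
      * by case; lra.
      * by case.
      * by case => /andP[]; lra.
      * by case.
    + by case.
    + by case => /andP[]; lra.
    + by case.
  - move=> t; rewrite /= in_itv /= => /andP[ta tb]; rewrite cv cw; split.
    + by apply/andP; split; lra.
    + by rewrite mulr_gt0 // sin_gt0_pi //; apply/andP; split; lra.
    + by rewrite mulr_gt0 // sin_gt0_pi //; apply/andP; split; lra.
have th : vangle v w = b + (2 * pi - a).
  rewrite vE -(cosD2pi (b - a)) cosK; first by rewrite -mulr_natl; ring.
  by rewrite in_itv /= -mulr_natl; apply/andP; split; lra.
exists (`[0, b] `|` `[a, 2 * pi])%classic, (`[0, b[ `|` `]a, 2 * pi[)%classic; split.
- by split; apply: measurableU; exact: measurable_itv.
- have -> : (lebesgue_measure ([set` `[0, b]%R] `|` [set` `[a, 2 * pi]%R] : set R) =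
      lebesgue_measure ([set` `[0, b]%R] : set R) + lebesgue_measure ([set` `[a, 2 * pi]%R] : set R))%E.
    apply: measureU; [exact: measurable_itv|exact: measurable_itv|].
    apply/seteqP; split => // t [] /=; rewrite !in_itv /= => /andP[? ?] /andP[? ?].
    by exfalso; lra.
  rewrite !lebesgue_measure_itv /= !lte_fin a2 th.
  have [b00|] := ltP 0 b; first by rewrite sube0.
  by move=> b00; rewrite add0e (_ : b = 0) ?add0r //; apply/eqP; rewrite eq_le b0 b00.
- have -> : (lebesgue_measure ([set` `[0, b[%R] `|` [set` `]a, 2 * pi[%R] : set R) =
      lebesgue_measure ([set` `[0, b[%R] : set R) + lebesgue_measure ([set` `]a, 2 * pi[%R] : set R))%E.
    apply: measureU; [exact: measurable_itv|exact: measurable_itv|].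
    apply/seteqP; split => // t [] /=; rewrite !in_itv /= => /andP[? ?] /andP[? ?].
    by exfalso; lra.
  rewrite !lebesgue_measure_itv /= !lte_fin a2 th.
  have [b00|] := ltP 0 b; first by rewrite sube0.
  by move=> b00; rewrite add0e (_ : b = 0) ?add0r //; apply/eqP; rewrite eq_le b0 b00.
- move=> t /andP[t0 t1] /cvge h1 /cwge h2; rewrite /= !in_itv /= t0 (ltW t1) andbT /=.
  have [tb|tb] := leP t b; first by left.
  right; rewrite leNgt; apply/negP => ta.
  case: (ss _ (t - a)); rewrite ?[sin _ < 0]ltNge ?h1.
  + by apply/andP; split; lra.
  + move=> [h3 _]; case: (ss _ (b - t)); rewrite ?[sin _ < 0]ltNge ?h2.
    * by apply/andP; split; lra.
    * by case; lra.
    * by case.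
    * by case => /andP[]; lra.
    * by case.
  + by case.
  + by case => /andP[]; lra.
  + by case.
- move=> t; rewrite /= !in_itv /= cv cw => -[] /andP[ta tb]; split.
  + by apply/andP; split; lra.
  + by rewrite mulr_gt0 // sin_gt0_wrap //; apply/andP; split; lra.
  + by rewrite mulr_gt0 // sin_gt0_pi //; apply/andP; split; lra.
  + by apply/andP; split; lra.
  + by rewrite mulr_gt0 // sin_gt0_pi //; apply/andP; split; lra.
  + by rewrite mulr_gt0 // sin_gt0_wrap //; apply/andP; split; lra.
Qed.

Lemma hub_angle_sum_ge (R : realType) (T : eqType) (lk : seq T)
    (v w : T -> R * R) :
  {in lk, forall j, 0 < cr (v j) (w j)} ->
  (forall d : R * R, exists2 j, j \in lk & 0 <= cr (v j) d /\ 0 <= cr d (w j)) ->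
  2 * pi <= \sum_(j <- lk) vangle (v j) (w j).
Proof.
move=> k0 cov.
pose P (I : set R) j := [/\ measurable I, lebesgue_measure I = (vangle (v j) (w j))%:E &
  (forall t, 0 <= t < 2 * pi -> 0 <= cr (v j) (dir t) -> 0 <= cr (dir t) (w j) -> I t)].
have /choice[I IP] : forall j, exists I, j \in lk -> P I j.
  move=> j; have [jlk|_] := boolP (j \in lk); last by exists set0.
  have [I [J [[mI _] muI _ h _]]] := arc_sets (k0 j jlk).
  by exists I.
have H (s : seq T) : {subset s <= lk} ->
    measurable [set t | exists2 j, j \in s & I j t] /\
    (lebesgue_measure [set t | exists2 j, j \in s & I j t] <=
     (\sum_(j <- s) vangle (v j) (w j))%:E)%E.
  elim: s => [|i s IH] sub.
    rewrite big_nil (_ : [set t | _] = set0); last by apply/seteqP; split => // t [].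
    by rewrite measure0.
  have [|m1 m2] := IH; first by move=> j js; apply: sub; rewrite inE js orbT.
  have [mi mui _] := IP i (sub i (mem_head _ _)).
  rewrite big_cons (_ : [set t | _] = I i `|` [set t | exists2 j, j \in s & I j t]).
    split; first exact: measurableU.
    rewrite EFinD -mui; apply: (le_trans (@measureU2 _ _ _ lebesgue_measure _ _ mi m1)).
    by rewrite leeD2l.
  apply/seteqP; split => t /=.
    move=> [j]; rewrite inE => /orP[/eqP->|js] It; first by left.
    by right; exists j.
  case=> [It|[j js It]]; first by exists i => //; rewrite mem_head.
  by exists j => //; rewrite inE js orbT.
have [m1 m2] := H lk (fun _ h => h).
rewrite -lee_fin; apply: le_trans m2.
have -> : (2 * pi)%:E = lebesgue_measure ([set` `[0, 2 * pi[%R] : set R).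
  by rewrite lebesgue_measure_itv /= lte_fin mulr_gt0 ?pi_gt0 // sube0.
apply: le_measure; [by rewrite inE; exact: measurable_itv|by rewrite inE|].
move=> t; rewrite /= in_itv /= => t02.
have [j jlk [h1 h2]] := cov (dir t); exists j => //.
by have [_ _ Ij] := IP j jlk; exact: Ij.
Qed.

Lemma hub_angle_sum_le (R : realType) (T : eqType) (lk : seq T)
    (v w : T -> R * R) : uniq lk ->
  {in lk, forall j, 0 < cr (v j) (w j)} ->
  {in lk &, forall i j (d : R * R), 0 < cr (v i) d -> 0 < cr d (w i) ->
     0 < cr (v j) d -> 0 < cr d (w j) -> i = j} ->
  \sum_(j <- lk) vangle (v j) (w j) <= 2 * pi.
Proof.
move=> ulk k0 dis.
pose P (J : set R) j := [/\ measurable J, lebesgue_measure J = (vangle (v j) (w j))%:E &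
  (forall t, J t -> [/\ 0 <= t < 2 * pi, 0 < cr (v j) (dir t) & 0 < cr (dir t) (w j)])].
have /choice[J JP] : forall j, exists J, j \in lk -> P J j.
  move=> j; have [jlk|_] := boolP (j \in lk); last by exists set0.
  have [I [J [[_ mJ] _ muJ _ h]]] := arc_sets (k0 j jlk).
  by exists J.
have H (s : seq T) : uniq s -> {subset s <= lk} ->
    measurable [set t | exists2 j, j \in s & J j t] /\
    (lebesgue_measure [set t | exists2 j, j \in s & J j t] =
     (\sum_(j <- s) vangle (v j) (w j))%:E)%E.
  elim: s => [|i s IH] us sub.
    rewrite big_nil (_ : [set t | _] = set0); last by apply/seteqP; split => // t [].
    by rewrite measure0.
  move: us => /= /andP[nis us].
  have [//||m1 m2] := IH; first by move=> j js; apply: sub; rewrite inE js orbT.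
  have ilk : i \in lk by apply: sub; rewrite mem_head.
  have [mi mui Ji] := JP i ilk.
  rewrite big_cons (_ : [set t | _] = J i `|` [set t | exists2 j, j \in s & J j t]).
    split; first exact: measurableU.
    rewrite EFinD -mui -m2; apply: measureU => //.
    apply/seteqP; split => // t [It /= [j js Jt]].
    have jlk : j \in lk by apply: sub; rewrite inE js orbT.
    have [_ _ Jj] := JP j jlk.
    have [_ h1 h2] := Ji t It; have [_ h3 h4] := Jj t Jt.
    by move: nis; rewrite (dis i j ilk jlk (dir t)) // js.
  apply/seteqP; split => t /=.
    move=> [j]; rewrite inE => /orP[/eqP->|js] It; first by left.
    by right; exists j.
  case=> [It|[j js It]]; first by exists i => //; rewrite mem_head.
  by exists j => //; rewrite inE js orbT.
have [m1 m2] := H lk ulk (fun _ h => h).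
rewrite -lee_fin -m2.
have -> : (2 * pi)%:E = lebesgue_measure ([set` `[0, 2 * pi[%R] : set R).
  by rewrite lebesgue_measure_itv /= lte_fin mulr_gt0 ?pi_gt0 // sube0.
apply: le_measure; [by rewrite inE|by rewrite inE; exact: measurable_itv|].
move=> t [j jlk Jt]; rewrite /= in_itv /=.
by have [_ _ Jj] := JP j jlk; have [] := Jj t Jt.
Qed.

(** * Hyperbolic distance and the Klein model *)

Lemma coshsinh2 (R : realType) (x : R) : coshR x ^+ 2 - sinhR x ^+ 2 = 1.
Proof.
have e : expR x * expR (- x) = 1 by rewrite -expRD subrr expR0.
by rewrite -[RHS]e /coshR /sinhR; field.
Qed.

Lemma coshD (R : realType) (x y : R) :
  coshR (x + y) = coshR x * coshR y + sinhR x * sinhR y.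
Proof. by rewrite /coshR /sinhR opprD !expRD; field. Qed.

Lemma sinh_half2 (R : realType) (x : R) : sinhR (x / 2) ^+ 2 = (coshR x - 1) / 2.
Proof.
rewrite {2}[x]splitr; move: (x / 2) => y.
have e : expR y * expR (- y) = 1 by rewrite -expRD subrr expR0.
rewrite /coshR /sinhR opprD !expRD.
transitivity (((expR y * expR y + expR (- y) * expR (- y)) / 2 - expR y * expR (- y)) / 2).
  by field.
by rewrite e.
Qed.

Lemma sinh_ge0 (R : realType) (x : R) : 0 <= x -> 0 <= sinhR x.
Proof.
move=> x0; rewrite /sinhR divr_ge0 // subr_ge0 ler_expR.
by rewrite (le_trans _ x0) // oppr_le0.
Qed.

Lemma acoshK (R : realType) (x : R) : 0 <= x -> acoshR (coshR x) = x.
Proof.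
move=> x0; rewrite /acoshR.
rewrite (_ : coshR x ^+ 2 - 1 = sinhR x ^+ 2); last first.
  by rewrite -(coshsinh2 x); ring.
rewrite sqrtr_sqr ger0_norm ?sinh_ge0 //.
have -> : coshR x + sinhR x = expR x by rewrite /coshR /sinhR; field.
by rewrite expRK.
Qed.

Lemma acosh_bounds (R : realType) (x : R) : 1 <= x ->
  0 <= acoshR x /\ coshR (acoshR x) = x.
Proof.
move=> x1; rewrite /acoshR; set q := Num.sqrt _.
have q0 : 0 <= q by rewrite sqrtr_ge0.
have q2 : q ^+ 2 = x ^+ 2 - 1.
  by rewrite sqr_sqrtr // subr_ge0 exprn_ege1.
have y0 : 0 < x + q by lra.
split; first by rewrite ln_ge0 //; lra.
rewrite /coshR expRN lnK ?posrE //.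
have -> : (x + q)^-1 = x - q.
  apply: (mulfI (lt0r_neq0 y0)); rewrite mulfV ?lt0r_neq0 //.
  by rewrite mulrC -subr_sqr q2; ring.
by field.
Qed.

(** This is [sinh^2] of half the hyperbolic distance, which unlike the distance is rational in the
    coordinates. *)
Definition dS (R : realType) (a b : R * R) : R :=
  sqn (vsub a b) / ((1 - sqn a) * (1 - sqn b)).

Lemma dS_ge0 (R : realType) (a b : R * R) : diskD a -> diskD b -> 0 <= dS a b.
Proof.
rewrite /diskD /= -![_ < 1]subr_gt0 => a1 b1.
by rewrite divr_ge0 ?sqn_ge0 // mulr_ge0 // ltW.
Qed.

Lemma sqn_eq0 (R : realType) (v : R * R) : (sqn v == 0) = (v == (0, 0)).
Proof.
rewrite /sqn paddr_eq0 ?sqr_ge0 // !sqrf_eq0.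
by case: v => x y.
Qed.

Lemma vsub_eq0 (R : realType) (a b : R * R) : (vsub a b == (0, 0)) = (a == b).
Proof. by case: a b => [x y] [z t]; rewrite /vsub /= !xpair_eqE !subr_eq0. Qed.

Lemma dS_eq0 (R : realType) (a b : R * R) : diskD a -> diskD b ->
  (dS a b == 0) = (a == b).
Proof.
rewrite /diskD /= -![_ < 1]subr_gt0 => a1 b1.
by rewrite mulf_eq0 invr_eq0 mulf_eq0 ![_ - _ == 0]gt_eqF // !orbF sqn_eq0 vsub_eq0.
Qed.

Lemma dSC (R : realType) (a b : R * R) : dS a b = dS b a.
Proof. by rewrite /dS sqn_vsubC [(1 - sqn a) * _]mulrC. Qed.

Lemma hdistE (R : realType) (a b : R * R) : hdist a b = acoshR (1 + 2 * dS a b).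
Proof. by rewrite /hdist mulrA. Qed.

Lemma hdist_ge0 (R : realType) (a b : R * R) : diskD a -> diskD b -> 0 <= hdist a b.
Proof.
move=> a1 b1; rewrite hdistE; apply: (acosh_bounds _).1.
by rewrite lerDl mulr_ge0 // dS_ge0.
Qed.

Lemma cosh_hdist (R : realType) (a b : R * R) : diskD a -> diskD b ->
  coshR (hdist a b) = 1 + 2 * dS a b.
Proof.
move=> a1 b1; rewrite hdistE (acosh_bounds _).2 //.
by rewrite lerDl mulr_ge0 // dS_ge0.
Qed.

Lemma sinh_hdist (R : realType) (a b : R * R) : diskD a -> diskD b ->
  sinhR (hdist a b) = 2 * Num.sqrt (dS a b * (1 + dS a b)).
Proof.
move=> a1 b1; have s0 := dS_ge0 a1 b1.
have h1 := sinh_ge0 (hdist_ge0 a1 b1).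
have h2 : 0 <= 2 * Num.sqrt (dS a b * (1 + dS a b)) by rewrite mulr_ge0 ?sqrtr_ge0.
have h3 : 0 <= dS a b * (1 + dS a b) by rewrite mulr_ge0 // addr_ge0.
apply/eqP; rewrite -(@eqrXn2 _ 2) // [X in _ == X]exprMn sqr_sqrtr //.
have := coshsinh2 (hdist a b); rewrite cosh_hdist // => e.
have -> : sinhR (hdist a b) ^+ 2 = (1 + 2 * dS a b) ^+ 2 - 1 by move: e; lra.
by apply/eqP; ring.
Qed.

Lemma sinh_half_hdist (R : realType) (a b : R * R) : diskD a -> diskD b ->
  sinhR (hdist a b / 2) ^+ 2 = dS a b.
Proof. by move=> a1 b1; rewrite sinh_half2 cosh_hdist //; field. Qed.

(* The hyperboloid lift: [hyp0] is the time coordinate. *)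
Definition hyp0 (R : realType) (a : R * R) : R := (1 + sqn a) / (1 - sqn a).
Definition hyp1 (R : realType) (a : R * R) : R := 2 * a.1 / (1 - sqn a).
Definition hyp2 (R : realType) (a : R * R) : R := 2 * a.2 / (1 - sqn a).
Definition klein (R : realType) (a : R * R) : R * R :=
  (2 * a.1 / (1 + sqn a), 2 * a.2 / (1 + sqn a)).
Definition mink (R : realType) (a b : R * R) : R :=
  hyp0 a * hyp0 b - hyp1 a * hyp1 b - hyp2 a * hyp2 b.

Lemma disk_neq0 (R : realType) (a : R * R) : diskD a -> 1 - sqn a != 0.
Proof. by rewrite /diskD /= -subr_gt0 => /lt0r_neq0. Qed.

Lemma sqn1_gt0 (R : realType) (a : R * R) : 0 < 1 + sqn a.
Proof. by rewrite ltr_pwDl // sqn_ge0. Qed.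

Lemma mink_dS (R : realType) (a b : R * R) : diskD a -> diskD b ->
  mink a b = 1 + 2 * dS a b.
Proof.
move=> /disk_neq0 + /disk_neq0.
rewrite /mink /dS /hyp0 /hyp1 /hyp2 /sqn /vsub /= => a1 b1.
by field; rewrite a1 b1.
Qed.

Lemma mink_self (R : realType) (a : R * R) : diskD a -> mink a a = 1.
Proof.
move=> a1; rewrite mink_dS // (_ : dS a a = 0) ?mulr0 ?addr0 //.
by apply/eqP; rewrite dS_eq0.
Qed.

Lemma hyp0_gt0 (R : realType) (a : R * R) : diskD a -> 0 < hyp0 a.
Proof. by rewrite /diskD /= -subr_gt0 => a1; rewrite divr_gt0 // sqn1_gt0. Qed.

Lemma klein1 (R : realType) (a : R * R) : diskD a ->
  hyp1 a = hyp0 a * (klein a).1.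
Proof.
move=> /disk_neq0; have := lt0r_neq0 (sqn1_gt0 a).
by rewrite /hyp1 /hyp0 /klein /= => h1 h2; field; rewrite h1 h2.
Qed.

Lemma klein2 (R : realType) (a : R * R) : diskD a ->
  hyp2 a = hyp0 a * (klein a).2.
Proof.
move=> /disk_neq0; have := lt0r_neq0 (sqn1_gt0 a).
by rewrite /hyp2 /hyp0 /klein /= => h1 h2; field; rewrite h1 h2.
Qed.

Lemma klein_inj (R : realType) (a b : R * R) : diskD a -> diskD b ->
  klein a = klein b -> a = b.
Proof.
move=> a1 b1 e; have a0 := hyp0_gt0 a1; have b0 := hyp0_gt0 b1.
have ma := mink_self a1; have mb := mink_self b1.
move: ma mb; rewrite /mink !klein1 // !klein2 // e.
set k := klein b => ma mb.
have ab : hyp0 a = hyp0 b.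
  apply/eqP; rewrite -(@eqrXn2 _ 2) ?ltW //.
  have Ea : hyp0 a ^+ 2 * (1 - k.1 ^+ 2 - k.2 ^+ 2) = 1 by rewrite -[RHS]ma; ring.
  have Eb : hyp0 b ^+ 2 * (1 - k.1 ^+ 2 - k.2 ^+ 2) = 1 by rewrite -[RHS]mb; ring.
  have kn : 1 - k.1 ^+ 2 - k.2 ^+ 2 != 0.
    by apply/eqP => k0; move: Ea; rewrite k0 mulr0 => /eqP; rewrite eq_sym oner_eq0.
  by apply/eqP; apply: (mulIf kn); rewrite Ea Eb.
apply/eqP; rewrite -dS_eq0 //.
have : mink a b = 1.
  by rewrite /mink !klein1 // !klein2 // e ab -[RHS]mb.
by rewrite mink_dS // => E; apply/eqP; lra.
Qed.

Lemma klein_disk (R : realType) (a : R * R) : diskD a -> sqn (klein a) < 1.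
Proof.
move=> a1; have a0 := hyp0_gt0 a1; have ma := mink_self a1.
rewrite -subr_gt0 -(@pmulr_rgt0 _ (hyp0 a ^+ 2)) ?exprn_gt0 //.
rewrite (_ : _ * _ = 1) //.
by rewrite -[RHS]ma /mink !klein1 // !klein2 // /sqn; ring.
Qed.

Definition unklein (R : realType) (k : R * R) : R * R :=
  scal (1 + Num.sqrt (1 - sqn k))^-1 k.

Lemma unkleinP (R : realType) (k : R * R) : sqn k < 1 ->
  diskD (unklein k) /\ klein (unklein k) = k.
Proof.
rewrite -subr_gt0 => k1; rewrite /unklein; set q := Num.sqrt _.
have q0 : 0 < q by rewrite sqrtr_gt0.
have q2 : q ^+ 2 = 1 - sqn k by rewrite sqr_sqrtr // ltW.
have p0 : 0 < 1 + q by lra.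
have sE : sqn (scal (1 + q)^-1 k) = (1 - q) / (1 + q).
  rewrite (_ : sqn (scal _ k) = (1 + q) ^- 2 * sqn k); last first.
    by rewrite /sqn /scal /= !exprMn !exprVn; ring.
  rewrite (_ : sqn k = (1 - q) * (1 + q)).
    by field; rewrite lt0r_neq0.
  by rewrite -subr_sqr q2; ring.
split; first by rewrite /diskD /= sE ltr_pdivrMr //; lra.
rewrite /klein sE /scal /= (_ : 1 + (1 - q) / (1 + q) = 2 / (1 + q)); last first.
  by field; rewrite lt0r_neq0.
by case: (k) => x y /=; congr pair; field; rewrite lt0r_neq0.
Qed.

(** * Geodesic segments as chords of the Klein disk *)

Definition segpt (R : realType) (t : R) (a b : R * R) : R * R :=
  (a.1 + t * (b.1 - a.1), a.2 + t * (b.2 - a.2)).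

Lemma hdist_additive (R : realType) (a b x : R * R) :
  diskD a -> diskD b -> diskD x ->
  hdist a x + hdist x b = hdist a b <->
  mink a x * mink x b + Num.sqrt ((mink a x ^+ 2 - 1) * (mink x b ^+ 2 - 1))
    = mink a b.
Proof.
move=> a1 b1 x1.
have sE u v : diskD u -> diskD v -> sinhR (hdist u v) = Num.sqrt (mink u v ^+ 2 - 1).
  move=> u1 v1; rewrite mink_dS // -cosh_hdist // -(coshsinh2 (hdist u v)).
  rewrite opprB addrC subrK sqrtr_sqr ger0_norm // sinh_ge0 // hdist_ge0 //.
have mge u v : diskD u -> diskD v -> 0 <= mink u v ^+ 2 - 1.
  by move=> u1 v1; rewrite mink_dS // subr_ge0 exprn_ege1 // lerDl mulr_ge0 // dS_ge0.
have cE : coshR (hdist a x + hdist x b) =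
    mink a x * mink x b + Num.sqrt ((mink a x ^+ 2 - 1) * (mink x b ^+ 2 - 1)).
  by rewrite coshD !sE // -sqrtrM ?mge // !cosh_hdist // !mink_dS.
split => [E|E].
  by rewrite -cE E cosh_hdist // mink_dS.
rewrite -[LHS]acoshK ?addr_ge0 ?hdist_ge0 // -[RHS]acoshK ?hdist_ge0 //.
by rewrite cE E cosh_hdist // mink_dS.
Qed.

Lemma klein_segpt_hyp (R : realType) (a b x : R * R) (t : R) :
  diskD a -> diskD b -> diskD x -> klein x = segpt t (klein a) (klein b) ->
  let al := (1 - t) * (hyp0 x / hyp0 a) in let be := t * (hyp0 x / hyp0 b) in
  [/\ hyp0 x = al * hyp0 a + be * hyp0 b, hyp1 x = al * hyp1 a + be * hyp1 b &
      hyp2 x = al * hyp2 a + be * hyp2 b].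
Proof.
move=> a1 b1 x1 e al be.
have a0 := lt0r_neq0 (hyp0_gt0 a1); have b0 := lt0r_neq0 (hyp0_gt0 b1).
split.
- by rewrite /al /be; field; rewrite a0 b0.
- rewrite !klein1 // e /al /be; move: (klein a) (klein b) => ka kb.
  by rewrite /segpt /=; field; rewrite a0 b0.
- rewrite !klein2 // e /al /be; move: (klein a) (klein b) => ka kb.
  by rewrite /segpt /=; field; rewrite a0 b0.
Qed.

Lemma klein_segpt_mink (R : realType) (a b x : R * R) (t : R) :
  diskD a -> diskD b -> diskD x -> klein x = segpt t (klein a) (klein b) ->
  let al := (1 - t) * (hyp0 x / hyp0 a) in let be := t * (hyp0 x / hyp0 b) in
  [/\ mink a x = al + be * mink a b, mink x b = al * mink a b + be &
      al ^+ 2 + be ^+ 2 + 2 * al * be * mink a b = 1].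
Proof.
move=> a1 b1 x1 e al be; have [] := klein_segpt_hyp a1 b1 x1 e; rewrite -/al -/be => e0 e1 e2.
have ma := mink_self a1; have mb := mink_self b1; have mx := mink_self x1.
move: al be e0 e1 e2 => al be e0 e1 e2.
have E1 : mink a x = al * mink a a + be * mink a b.
  by rewrite /mink e0 e1 e2; ring.
have E2 : mink x b = al * mink a b + be * mink b b.
  by rewrite /mink e0 e1 e2; ring.
split; first by rewrite E1 ma mulr1.
  by rewrite E2 mb mulr1.
transitivity (al ^+ 2 * mink a a + be ^+ 2 * mink b b + 2 * al * be * mink a b).
  by rewrite ma mb !mulr1.
by rewrite -[RHS]mx /mink e0 e1 e2; ring.
Qed.

(** The left side is the Gram determinant of three vectors for the Minkowski form. That form has
    signature (1, 2), hence determinant 1, so the result is the plain square of the determinant of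
    the vectors. *)
Lemma gram_det (R : comPzRingType) (a0 a1 a2 b0 b1 b2 x0 x1 x2 : R) :
  let m u0 u1 u2 v0 v1 v2 := u0 * v0 - u1 * v1 - u2 * v2 : R in
  let aa := m a0 a1 a2 a0 a1 a2 in let bb := m b0 b1 b2 b0 b1 b2 in
  let xx := m x0 x1 x2 x0 x1 x2 in let ab := m a0 a1 a2 b0 b1 b2 in
  let ax := m a0 a1 a2 x0 x1 x2 in let xb := m x0 x1 x2 b0 b1 b2 in
  aa * xx * bb + 2 * ax * xb * ab - aa * xb ^+ 2 - bb * ax ^+ 2 - xx * ab ^+ 2 =
  (a0 * (x1 * b2 - x2 * b1) - a1 * (x0 * b2 - x2 * b0)
   + a2 * (x0 * b1 - x1 * b0)) ^+ 2.
Proof. by move=> /=; ring. Qed.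

Lemma hdist_eq0 (R : realType) (a b : R * R) : diskD a -> diskD b ->
  (hdist a b == 0) = (a == b).
Proof.
move=> a1 b1; apply/eqP/eqP => [h|->].
  have := cosh_hdist a1 b1; rewrite h /coshR oppr0 expR0 => e.
  by apply/eqP; rewrite -dS_eq0 //; apply/eqP; lra.
have e0 : dS b b = 0 by apply/eqP; rewrite dS_eq0.
by rewrite hdistE e0 mulr0 addr0 /acoshR expr1n subrr sqrtr0 addr0 ln1.
Qed.

(** Equality in the triangle inequality makes the Gram determinant of the three lifts vanish, so the
    lifts are linearly dependent and the Klein points collinear. Conversely, on a chord the radicand
    in [hdist_additive] is a perfect square. *)
Lemma hsegP (R : realType) (a b x : R * R) : diskD a -> diskD b ->
  hseg a b x <-> diskD x /\
    exists2 t, 0 <= t <= 1 & klein x = segpt t (klein a) (klein b).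
Proof.
move=> a1 b1; split=> [[x1 h]|[x1 [t /andP[t0 t1] e]]]; split=> //; last first.
  apply/hdist_additive => //.
  have [E1 E2 E3] := klein_segpt_mink a1 b1 x1 e.
  move: E1 E2 E3.
  have : 0 <= (1 - t) * (hyp0 x / hyp0 a).
    by rewrite mulr_ge0 ?subr_ge0 // divr_ge0 // ltW // hyp0_gt0.
  have : 0 <= t * (hyp0 x / hyp0 b).
    by rewrite mulr_ge0 // divr_ge0 // ltW // hyp0_gt0.
  have C1 : 1 <= mink a b by rewrite mink_dS // lerDl mulr_ge0 // dS_ge0.
  move: (t * _) ((1 - t) * _) => be al be0 al0 -> ->.
  move: (mink a b) C1 => C C1 E3.
  have -> : (al + be * C) ^+ 2 - 1 = be ^+ 2 * (C ^+ 2 - 1).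
    by rewrite -[X in _ - X]E3; ring.
  have -> : (al * C + be) ^+ 2 - 1 = al ^+ 2 * (C ^+ 2 - 1).
    by rewrite -[X in _ - X]E3; ring.
  rewrite (_ : _ * (al ^+ 2 * _) = (al * be * (C ^+ 2 - 1)) ^+ 2); last by ring.
  rewrite sqrtr_sqr ger0_norm; last by rewrite !mulr_ge0 // subr_ge0 exprn_ege1.
  transitivity ((al ^+ 2 + be ^+ 2 + 2 * al * be * C) * C); first by ring.
  by rewrite E3 mul1r.
have [ab|nab] := eqVneq a b.
  have d0 : hdist a b = 0 by apply/eqP; rewrite hdist_eq0 // ab.
  have h1 := hdist_ge0 a1 x1; have h2 := hdist_ge0 x1 b1.
  exists 0; first by rewrite lexx ler01.
  have /eqP : hdist a x = 0 by move: h; rewrite d0; lra.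
  by rewrite hdist_eq0 // => /eqP <-; rewrite /segpt !mul0r !addr0; case: (klein a).
have ma := mink_self a1; have mb := mink_self b1; have mx := mink_self x1.
move/hdist_additive: h => /(_ a1 b1 x1) h.
set P := (X in Num.sqrt X) in h.
have mge u v : diskD u -> diskD v -> 0 <= mink u v ^+ 2 - 1.
  by move=> u1 v1; rewrite mink_dS // subr_ge0 exprn_ege1 // lerDl mulr_ge0 // dS_ge0.
have P0 : 0 <= P by rewrite mulr_ge0 // mge.
have hP : (mink a b - mink a x * mink x b) ^+ 2 = P.
  by rewrite -h addrC addKr sqr_sqrtr.
have := gram_det (hyp0 a) (hyp1 a) (hyp2 a) (hyp0 b) (hyp1 b) (hyp2 b)
  (hyp0 x) (hyp1 x) (hyp2 x).
rewrite /= -!/(mink _ _) ma mb mx.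
rewrite (_ : _ - 1 * _ = P - (mink a b - mink a x * mink x b) ^+ 2); last first.
  by rewrite /P; ring.
rewrite hP subrr => /esym/eqP; rewrite sqrf_eq0 => /eqP.
rewrite !klein1 // !klein2 //.
have a0 := hyp0_gt0 a1; have b0 := hyp0_gt0 b1; have x0 := hyp0_gt0 x1.
set ka := klein a; set kb := klein b; set kx := klein x => dE.
have c0 : cr (vsub kx ka) (vsub kb ka) = 0.
  have n0 := mulf_neq0 (mulf_neq0 (lt0r_neq0 a0) (lt0r_neq0 b0)) (lt0r_neq0 x0).
  by apply: (mulfI n0); rewrite mulr0 -[RHS]dE /cr /vsub /=; ring.
have sk : 0 < sqn (vsub kb ka).
  rewrite lt0r sqn_ge0 andbT sqn_eq0 vsub_eq0.
  by apply: contra nab => /eqP/(klein_inj b1 a1)->.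
pose t := dt (vsub kx ka) (vsub kb ka) / sqn (vsub kb ka).
have e : kx = segpt t ka kb.
  have tE : t * sqn (vsub kb ka) = dt (vsub kx ka) (vsub kb ka).
    by rewrite /t divfK // lt0r_neq0.
  have I1 : (kx.1 - ka.1) * sqn (vsub kb ka) =
      dt (vsub kx ka) (vsub kb ka) * (kb.1 - ka.1)
      + cr (vsub kx ka) (vsub kb ka) * (kb.2 - ka.2).
    by rewrite /dt /cr /sqn /vsub /=; ring.
  have I2 : (kx.2 - ka.2) * sqn (vsub kb ka) =
      dt (vsub kx ka) (vsub kb ka) * (kb.2 - ka.2)
      - cr (vsub kx ka) (vsub kb ka) * (kb.1 - ka.1).
    by rewrite /dt /cr /sqn /vsub /=; ring.
  rewrite c0 mul0r addr0 -tE mulrAC in I1; rewrite c0 mul0r subr0 -tE mulrAC in I2.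
  have {}I1 := mulIf (lt0r_neq0 sk) I1; have {}I2 := mulIf (lt0r_neq0 sk) I2.
  rewrite /segpt -I1 -I2 [LHS]surjective_pairing.
  by move: (kx.1) (kx.2) (ka.1) (ka.2) => *; congr pair; ring.
exists t => //.
have [E1 E2 E3] := klein_segpt_mink a1 b1 x1 e.
have C1 : 1 < mink a b.
  by rewrite mink_dS // ltrDl mulr_gt0 // lt0r dS_ge0 // dS_eq0 // nab.
(* This difference is a square root, and on the chord it is a positive multiple of [t * (1 - t)];
   its sign places [x] between [a] and [b]. *)
have : 0 <= mink a b - mink a x * mink x b.
  by rewrite -h addrC addKr sqrtr_ge0.
rewrite E1 E2.
have -> : mink a b - ((1 - t) * (hyp0 x / hyp0 a) + t * (hyp0 x / hyp0 b) * mink a b)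
    * ((1 - t) * (hyp0 x / hyp0 a) * mink a b + t * (hyp0 x / hyp0 b)) =
  t * (1 - t) * ((hyp0 x / hyp0 a) * (hyp0 x / hyp0 b) * (mink a b ^+ 2 - 1)).
  by rewrite -{1}[mink a b]mul1r -{1}E3; ring.
rewrite pmulr_lge0; last first.
  have q : 0 < mink a b ^+ 2 - 1 by rewrite subr_gt0 exprn_egt1.
  exact: (mulr_gt0 (mulr_gt0 (divr_gt0 x0 a0) (divr_gt0 x0 b0)) q).
move=> tt; apply/andP; split; rewrite leNgt; apply/negP => ht; move: tt; apply/negP; rewrite -ltNge.
  by rewrite nmulr_rlt0 //; lra.
by rewrite pmulr_rlt0; lra.
Qed.

(** * Angles of hyperbolic triangles *)

(** With the squared half-sinhs of the sides of a hyperbolic triangle as arguments, this is a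
    quarter of the Gram determinant of the lifted vertices, and [4 s t (1 + s) (1 + t)] times the
    squared sine of the angle between [s] and [t]. It is symmetric in all three arguments. *)
Definition heron (R : realType) (s t u : R) : R :=
  4 * s * t * (1 + s) * (1 + t) - (s + t + 2 * s * t - u) ^+ 2.

Lemma heronCA (R : realType) (s t u : R) : heron s t u = heron s u t.
Proof. by rewrite /heron; ring. Qed.

(* The cosine of the angle between sides with squared half-sinh [s] and [t],
   opposite to a side with squared half-sinh [u]. *)
Definition hcos (R : realType) (s t u : R) : R :=
  (s + t + 2 * s * t - u) / (2 * Num.sqrt (s * (1 + s) * (t * (1 + t)))).

Lemma hangle_hcos (R : realType) (z a b : R * R) :
  diskD z -> diskD a -> diskD b ->
  hangle z a b = acos (hcos (dS z a) (dS z b) (dS a b)).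
Proof.
move=> z1 a1 b1; rewrite /hangle /hcos !cosh_hdist // !sinh_hdist //; congr acos.
have sa := dS_ge0 z1 a1; have sb := dS_ge0 z1 b1.
move: (dS z a) (dS z b) (dS a b) sa sb => s t u s0 t0.
have s1 : 0 <= s * (1 + s) by rewrite mulr_ge0 ?addr_ge0.
rewrite [Num.sqrt (s * _ * _)](sqrtrM _ s1).
set p := Num.sqrt (s * (1 + s)); set q := Num.sqrt (t * (1 + t)).
rewrite (_ : _ - _ = 2 * (s + t + 2 * s * t - u)); last by ring.
rewrite (_ : 2 * p * (2 * q) = 2 * (2 * (p * q))); last by ring.
by rewrite -mulf_div mulfV ?mul1r.
Qed.

Lemma side_angle_hcos (R : realType) (s t u : R) : 0 < s -> 0 < t ->
  side_angle (u / (s * t)) (1 + s^-1) (1 + t^-1) = acos (hcos s t u).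
Proof.
move=> s0 t0; rewrite /side_angle /hcos; congr acos.
have st : 0 < s * t by rewrite mulr_gt0.
have -> : (1 + s^-1) * (1 + t^-1) = (s * (1 + s) * (t * (1 + t))) * ((s * t)^-1) ^+ 2.
  by field; rewrite !lt0r_neq0.
rewrite sqrtrM ?mulr_ge0 ?addr_ge0 ?ltW // sqrtr_sqr ger0_norm ?invr_ge0 ?(ltW st) //.
set q := Num.sqrt _.
have q0 : q != 0 by rewrite sqrtr_eq0 -ltNge !mulr_gt0 // addr_gt0.
by field; rewrite q0 !lt0r_neq0.
Qed.

Lemma gram_heron (R : realType) (s t u : R) : 0 < s -> 0 < t ->
  gram (u / (s * t)) (1 + s^-1) (1 + t^-1) = heron s t u / (s * t) ^+ 2.
Proof. by move=> s0 t0; rewrite /gram /heron; field; rewrite !lt0r_neq0. Qed.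

Lemma side_angleZ (R : realType) (k A x y : R) : 0 < k ->
  side_angle (k * A) (k * x) (k * y) = side_angle A x y.
Proof.
move=> k0; rewrite /side_angle; congr acos.
rewrite (_ : k * x * (k * y) = k ^+ 2 * (x * y)); last by ring.
rewrite sqrtrM ?sqr_ge0 // sqrtr_sqr gtr0_norm //.
rewrite -mulrDr -mulrBr (_ : 2 * (k * _) = k * (2 * Num.sqrt (x * y))); last by ring.
by rewrite -mulf_div mulfV ?lt0r_neq0 // mul1r.
Qed.

Lemma gramZ (R : realType) (k A x y : R) :
  gram (k * A) (k * x) (k * y) = k ^+ 2 * gram A x y.
Proof. by rewrite /gram; ring. Qed.

Lemma ler_cos (R : realType) (x y : R) : 0 <= x <= pi -> 0 <= y <= pi ->
  (cos x <= cos y) = (y <= x).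
Proof. by move=> x0 y0; rewrite leNgt ltr_cos ?in_itv // -leNgt. Qed.

(** For [y = x / 2] the mean value theorem gives [sin y >= y cos y], so
    [sin x >= x (cos y)^2 = x (1 + cos x) / 2], and [cos x] is nonnegative. *)
Lemma sinx_ge_half (R : realType) (x : R) : 0 <= x <= pi / 2 -> x / 2 <= sin x.
Proof.
move=> /andP[x0 x1]; set y := x / 2.
have pi0 := @pi_gt0 R.
have y0 : 0 <= y by rewrite divr_ge0.
have xy : x = y *+ 2 by rewrite mulr2n /y -splitr.
have cx0 : 0 <= cos x by rewrite cos_ge0_pihalf // x1 andbT; lra.
have c2 : cos y ^+ 2 = (1 + cos x) / 2.
  by rewrite xy cos_mulr2n -mulr_natl; field.
have cy0 : 0 <= cos y.
  by rewrite cos_ge0_pihalf //; rewrite /y; apply/andP; split; lra.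
have sy : y * cos y <= sin y.
  have [->|yn0] := eqVneq y 0; first by rewrite mul0r sin0.
  have yp : 0 < y by rewrite lt0r yn0.
  have [c /andP[c0 c1]] := @MVT01 R sin cos 0 y yp (fun t _ => is_derive_sin t).
  rewrite sin0 !subr0 => ->; rewrite mulrC ler_wpM2r // ler_cos //.
    by rewrite /y in c1 *; apply/andP; split; lra.
  by rewrite /y in c1 *; apply/andP; split; lra.
have -> : sin x = 2 * (sin y * cos y).
  by rewrite xy sin_mulr2n -mulr_natl mulrC [cos y * _]mulrC mulrC.
apply: (@le_trans _ _ (2 * (y * cos y * cos y))); last first.
  by rewrite ler_pM2l // ler_wpM2r.
by rewrite -mulrA -expr2 c2 -/y; nra.
Qed.

Lemma hcos_sqr (R : realType) (s t u : R) : 0 < s -> 0 < t ->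
  1 - hcos s t u ^+ 2 = heron s t u / (4 * s * t * (1 + s) * (1 + t)).
Proof.
move=> s0 t0; rewrite /hcos expr_div_n exprMn sqr_sqrtr; last first.
  by rewrite !mulr_ge0 ?addr_ge0 // ltW.
rewrite /heron; field; rewrite !lt0r_neq0 //; exact: addr_gt0.
Qed.

Lemma heron_gt0 (R : realType) (s t u e : R) : 0 < e ->
  0 < s -> 0 < t -> 0 < u -> 0 <= heron s t u ->
  e <= acos (hcos s t u) -> e <= acos (hcos s u t) -> e <= acos (hcos t u s) ->
  0 < heron s t u.
Proof.
move=> e0 s0 t0 u0 h0 a1 a2 a3; rewrite lt0r h0 andbT; apply/eqP => h.
have H (x y z : R) : 0 < x -> 0 < y -> heron x y z = 0 -> e <= acos (hcos x y z) ->
    x + y + 2 * x * y - z < 0.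
  move=> x0 y0 hz ae.
  have := hcos_sqr z x0 y0; rewrite hz mul0r => /eqP; rewrite subr_eq0 eq_sym sqrf_eq1.
  case/orP => /eqP c; first by move: ae; rewrite c acos1; lra.
  rewrite ltNge; apply/negP => p.
  have : 0 <= hcos x y z by rewrite divr_ge0 // mulr_ge0 // sqrtr_ge0.
  by rewrite c; lra.
have h1 := H _ _ _ s0 t0 h a1.
have h2 := H _ _ _ s0 u0 (eq_trans (esym (heronCA s t u)) h) a2.
have st : 0 < s * t by rewrite mulr_gt0.
have su : 0 < s * u by rewrite mulr_gt0.
by move: h1 h2; rewrite -!mulrA; lra.
Qed.

(** In terms of cosines, the angles at the two ends of the side [s] add up to less than pi. If one
    numerator is negative, its sign decides between [t < u] and [u < t], and the difference of
    squares [D] shows that the positive term dominates. *)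
Lemma hcos_add_gt0 (R : realType) (s t u : R) :
  0 < s -> 0 < t -> 0 < u -> 0 < heron s t u -> 0 < hcos s t u + hcos s u t.
Proof.
move=> s0 t0 u0 h0.
have pos (x : R) : 0 < x -> 0 < x * (1 + x) by move=> x0; rewrite mulr_gt0 // addr_gt0.
rewrite /hcos [Num.sqrt (_ * (t * _))](sqrtrM _ (ltW (pos s s0))).
rewrite [Num.sqrt (_ * (u * _))](sqrtrM _ (ltW (pos s s0))).
set q := Num.sqrt (s * (1 + s)); set p := Num.sqrt (t * (1 + t)).
set m := Num.sqrt (u * (1 + u)).
have q0 : 0 < q by rewrite sqrtr_gt0 pos.
have p0 : 0 < p by rewrite sqrtr_gt0 pos.
have m0 : 0 < m by rewrite sqrtr_gt0 pos.
have p2 : p ^+ 2 = t * (1 + t) by rewrite sqr_sqrtr // ltW // pos.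
have m2 : m ^+ 2 = u * (1 + u) by rewrite sqr_sqrtr // ltW // pos.
set A := s + t + _ - u; set B := s + u + _ - t.
rewrite (_ : _ + _ = (A * m + B * p) / (2 * q * p * m)); last first.
  by field; rewrite !lt0r_neq0.
rewrite divr_gt0 ?mulr_gt0 //.
have AB : A + B = 2 * s * (1 + t + u) by rewrite /A /B; ring.
have AB0 : 0 < A + B by rewrite AB !mulr_gt0 // !addr_gt0.
have A2 : A ^+ 2 = 4 * s * t * (1 + s) * (1 + t) - heron s t u.
  by rewrite /A /heron; ring.
have B2 : B ^+ 2 = 4 * s * u * (1 + s) * (1 + u) - heron s t u.
  by rewrite /B /heron; ring.
have D : (A * m) ^+ 2 - (B * p) ^+ 2 = heron s t u * ((t - u) * (1 + t + u)).
  by rewrite !exprMn A2 B2 p2 m2; ring.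
rewrite ltNge; apply/negP => neg.
have st : 0 < s * t by rewrite mulr_gt0.
have su : 0 < s * u by rewrite mulr_gt0.
have [A0|A0] := ltP A 0.
  have tu : t < u by move: A0; rewrite /A -mulrA; lra.
  have Bp : 0 < B by lra.
  have Bpp : 0 < B * p by rewrite mulr_gt0.
  have : 0 <= (A * m) ^+ 2 - (B * p) ^+ 2.
    rewrite subr_sqr mulr_le0 //; lra.
  by rewrite D leNgt pmulr_rlt0 // nmulr_rlt0 ?subr_lt0 // !addr_gt0.
have [B0|B0] := ltP B 0.
  have tu : u < t by move: B0; rewrite /B -mulrA; lra.
  have Ap : 0 < A by lra.
  have App : 0 < A * m by rewrite mulr_gt0.
  have : (A * m) ^+ 2 - (B * p) ^+ 2 <= 0.
    by rewrite subr_sqr mulr_ge0_le0 //; lra.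
  by rewrite D leNgt pmulr_rgt0 // pmulr_rgt0 ?subr_gt0 // !addr_gt0.
have [A00|An0] := eqVneq A 0.
  have : 0 < B * p by rewrite mulr_gt0 //; lra.
  by move: neg; rewrite A00 mul0r add0r => /le_lt_trans h /h; rewrite ltxx.
have : 0 < A * m by rewrite mulr_gt0 // lt0r An0.
have : 0 <= B * p by rewrite mulr_ge0 // ltW.
by lra.
Qed.

(** Together with another angle of at least [e] the angle stays below pi, so it lies between [e] and
    [pi - e] and its sine is at least [sin e >= e / 2]. The 4 in [hcos_sqr] absorbs the square of
    this half. *)
Lemma heron_sin_bound (R : realType) (s t u e : R) : 0 < e ->
  0 < s -> 0 < t -> 0 < u -> 0 <= heron s t u ->
  e <= acos (hcos s t u) -> e <= acos (hcos s u t) -> e <= acos (hcos t u s) ->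
  e < pi / 2 /\ e ^+ 2 * (s * t * (1 + s) * (1 + t)) <= heron s t u.
Proof.
move=> e0 s0 t0 u0 h0 a1 a2 a3.
have h := heron_gt0 e0 s0 t0 u0 h0 a1 a2 a3.
have hb (x y z : R) : 0 < x -> 0 < y -> 0 < heron x y z -> -1 < hcos x y z < 1.
  move=> x0 y0 hh; rewrite -ltr_norml -(@ltr_pXn2r _ 2) ?nnegrE //.
  rewrite real_normK ?num_real // expr1n -subr_gt0 hcos_sqr //.
  by rewrite divr_gt0 // !mulr_gt0 // addr_gt0.
have /andP[l1 l2] := hb _ _ _ s0 t0 h.
have /andP[l3 l4] : -1 < hcos s u t < 1 by apply: hb; rewrite // -heronCA.
have sum : acos (hcos s t u) < pi - acos (hcos s u t).
  have [b1 b2 b3 b4] : [/\ 0 <= acos (hcos s t u), acos (hcos s t u) <= pi,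
     0 <= acos (hcos s u t) & acos (hcos s u t) <= pi].
    by split; rewrite ?acos_ge0 ?acos_lepi // !ltW.
  rewrite -ltr_cos ?in_itv /=; [|by rewrite b1 b2|by apply/andP; split; lra].
  rewrite addrC cosDpi cosN !acosK ?in_itv /= ?(ltW l1) ?(ltW l2) ?(ltW l3) ?(ltW l4) //.
  by have := hcos_add_gt0 s0 t0 u0 h; lra.
set th := acos (hcos s t u) in a1 sum *.
have e2 : e < pi / 2 by lra.
split=> //.
have thp : th <= pi - e by lra.
have ch : cos th = hcos s t u by rewrite acosK // in_itv /= !ltW.
have cle : cos th <= cos e by rewrite ler_cos //; apply/andP; split; lra.
have cge : - cos e <= cos th.
  rewrite -cosN -cosDpi addrC ler_cos //; apply/andP; split; lra.
have s2 : sin e ^+ 2 <= 1 - hcos s t u ^+ 2.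
  rewrite -ch sin2cos2 lerD2l lerN2 -subr_ge0 subr_sqr mulr_ge0 //; lra.
have es : e / 2 <= sin e by apply: sinx_ge_half; rewrite !ltW.
have es2 : (e / 2) ^+ 2 <= 1 - hcos s t u ^+ 2.
  by apply: le_trans s2; rewrite ler_pXn2r ?nnegrE //; lra.
move: es2; rewrite hcos_sqr // ler_pdivlMr; last by rewrite !mulr_gt0 // addr_gt0.
by apply: le_trans; rewrite le_eqVlt; apply/orP; left; apply/eqP; field.
Qed.

(** * Inverted stars in the Poincare disk *)

Definition invp (R : realType) (z w : R * R) : R * R :=
  scal (sqn (vsub w z))^-1 (vsub w z).
(* [hubc r z * z] is the image, under the inversion in [z], of the reflection of [z]
   in the circle of radius [1 / r] around the origin. *)
Definition hubc (R : realType) (r : R) (z : R * R) : R :=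
  r ^+ 2 / (1 - r ^+ 2 * sqn z).
Definition spoke (R : realType) (r : R) (z w : R * R) : R * R :=
  vsub (invp z w) (scal (hubc r z) z).

Lemma vsub_spoke (R : realType) (r : R) (x a b : R * R) :
  vsub (spoke r x a) (spoke r x b) = vsub (invp x a) (invp x b).
Proof. by rewrite /spoke /vsub /=; congr pair; ring. Qed.

Lemma sqn_scal (R : realType) (c : R) (v : R * R) :
  sqn (scal c v) = c ^+ 2 * sqn v.
Proof. by rewrite /sqn /scal /=; ring. Qed.

Lemma sqn_vsub_gt0 (R : realType) (a b : R * R) : a != b -> 0 < sqn (vsub a b).
Proof. by move=> ab; rewrite lt0r sqn_ge0 sqn_eq0 vsub_eq0 ab. Qed.

Lemma vsub_scal (R : realType) (c : R) (a b : R * R) :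
  vsub (scal c a) (scal c b) = scal c (vsub a b).
Proof. by rewrite /vsub /scal /=; congr pair; ring. Qed.

Lemma sqn_spoke (R : realType) (r : R) (z w : R * R) : r != 0 -> w != z ->
  1 - r ^+ 2 * sqn z != 0 -> 1 - r ^+ 2 * sqn w != 0 ->
  sqn (spoke r z w) =
  (hubc r z / r) ^+ 2 * (1 + (dS (scal r z) (scal r w))^-1).
Proof.
move=> r0 wz z1 w1; have := lt0r_neq0 (sqn_vsub_gt0 wz).
rewrite /spoke /hubc /dS vsub_scal !sqn_scal.
rewrite (sqn_vsubC z w).
rewrite /invp; move: z1 w1.
rewrite /sqn /vsub /scal /=; case: z wz => z1 z2; case: w => w1 w2 /= _ h1 h2 h3.
by field; rewrite r0 h1 h2 h3.
Qed.

Lemma sqn_invp_sub (R : realType) (z a b : R * R) : a != z -> b != z ->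
  sqn (vsub (invp z a) (invp z b)) =
  sqn (vsub a b) / (sqn (vsub a z) * sqn (vsub b z)).
Proof.
move=> /sqn_vsub_gt0/lt0r_neq0 + /sqn_vsub_gt0/lt0r_neq0.
case: z => z1 z2; case: a => a1 a2; case: b => b1 b2.
rewrite /invp /sqn /vsub /scal /= => h1 h2.
by field; rewrite h1 h2.
Qed.

Lemma sqn_invp_sub_dS (R : realType) (r : R) (z a b : R * R) :
  r != 0 -> a != z -> b != z ->
  1 - r ^+ 2 * sqn z != 0 -> 1 - r ^+ 2 * sqn a != 0 -> 1 - r ^+ 2 * sqn b != 0 ->
  sqn (vsub (invp z a) (invp z b)) =
  (hubc r z / r) ^+ 2 * (dS (scal r a) (scal r b) /
    (dS (scal r z) (scal r a) * dS (scal r z) (scal r b))).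
Proof.
move=> r0 az bz z1 a1 b1; rewrite sqn_invp_sub //.
have h1 := lt0r_neq0 (sqn_vsub_gt0 az); have h2 := lt0r_neq0 (sqn_vsub_gt0 bz).
rewrite /dS /hubc !vsub_scal !sqn_scal (sqn_vsubC z a) (sqn_vsubC z b).
move: (sqn (vsub _ _)) (sqn (vsub _ _)) (sqn (vsub _ _)) h1 h2 => d1 d2 d3 h1 h2.
by field; rewrite r0 z1 a1 b1 h1 h2.
Qed.

Lemma hub_angle_dS (R : realType) (r : R) (z a b : R * R) :
  0 < r -> a != z -> b != z ->
  0 < 1 - r ^+ 2 * sqn z -> 0 < 1 - r ^+ 2 * sqn a -> 0 < 1 - r ^+ 2 * sqn b ->
  hub_angle (scal (hubc r z) z) (invp z a) (invp z b) =
  side_angle (dS (scal r a) (scal r b) /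
      (dS (scal r z) (scal r a) * dS (scal r z) (scal r b)))
    (1 + (dS (scal r z) (scal r a))^-1) (1 + (dS (scal r z) (scal r b))^-1).
Proof.
move=> r0 az bz z1 a1 b1; rewrite /hub_angle -!/(spoke _ _ _).
rewrite !(@sqn_spoke _ r) ?(@sqn_invp_sub_dS _ r) ?lt0r_neq0 //.
by rewrite side_angleZ // exprn_gt0 // divr_gt0 // divr_gt0 // exprn_gt0.
Qed.

Lemma scal1 (R : realType) (v : R * R) : scal 1 v = v.
Proof. by case: v => x y; rewrite /scal /= !mul1r. Qed.

Lemma disk_gt0 (R : realType) (z : R * R) : diskD z -> 0 < 1 - 1 ^+ 2 * sqn z.
Proof. by rewrite /diskD /= expr1n mul1r subr_gt0. Qed.

Lemma dS_gt0 (R : realType) (a b : R * R) : diskD a -> diskD b -> a != b -> 0 < dS a b.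
Proof. by move=> a1 b1 ab; rewrite lt0r dS_ge0 // dS_eq0 // ab. Qed.

Lemma hangle_hub (R : realType) (z a b : R * R) :
  diskD z -> diskD a -> diskD b -> a != z -> b != z ->
  hangle z a b = hub_angle (scal (hubc 1 z) z) (invp z a) (invp z b).
Proof.
move=> z1 a1 b1 az bz; rewrite hub_angle_dS ?disk_gt0 // !scal1.
by rewrite hangle_hcos // side_angle_hcos // dS_gt0 // eq_sym.
Qed.

Lemma heron_hub (R : realType) (z a b : R * R) :
  diskD z -> diskD a -> diskD b -> a != z -> b != z ->
  4 * cr (spoke 1 z a) (spoke 1 z b) ^+ 2 =
  hubc 1 z ^+ 4 * heron (dS z a) (dS z b) (dS a b) / (dS z a * dS z b) ^+ 2.
Proof.
move=> z1 a1 b1 az bz.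
have -> : 4 * cr (spoke 1 z a) (spoke 1 z b) ^+ 2 =
    (2 * cr (spoke 1 z a) (spoke 1 z b)) ^+ 2 by ring.
rewrite -gram_hub -mulrA -gram_heron ?dS_gt0 // 1?eq_sym //.
rewrite vsub_spoke.
have h := @disk_gt0 R.
rewrite !(@sqn_spoke _ 1) ?(@sqn_invp_sub_dS _ 1) ?(lt0r_neq0 (h _ _)) //.
by rewrite gramZ !scal1 divr1 -exprM.
Qed.

Definition kmap (R : realType) (z h : R * R) : R * R :=
  ((1 - sqn z) * h.1 + 2 * dt z h * z.1, (1 - sqn z) * h.2 + 2 * dt z h * z.2).

Lemma cr_kmap (R : realType) (z h h' : R * R) :
  cr (kmap z h) (kmap z h') = (1 - sqn z) * (1 + sqn z) * cr h h'.
Proof. by rewrite /cr /kmap /dt /sqn /=; ring. Qed.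

(* [kmap z] is, up to a positive factor, the inverse of the differential of [klein]
   at [z]; the spoke towards [w] is tangent to the geodesic from [z] to [w]. *)
Lemma spoke_klein (R : realType) (z w : R * R) : diskD z -> diskD w -> w != z ->
  spoke 1 z w = scal ((1 + sqn w) / (2 * sqn (vsub w z) * (1 - sqn z)))
    (kmap z (vsub (klein w) (klein z))).
Proof.
move=> /disk_neq0 z1 /disk_neq0 w1 /sqn_vsub_gt0/lt0r_neq0.
have := lt0r_neq0 (sqn1_gt0 z); have := lt0r_neq0 (sqn1_gt0 w); move: z1 w1.
case: z => x y; case: w => u v.
rewrite /spoke /kmap /invp /hubc /klein /sqn /dt /vsub /scal /= !expr1n !mul1r.
move=> h1 h2 h3 h4 h5.
by congr pair; field; rewrite h1 h3 h4 h5.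
Qed.

(** * Generalized circles and the Delaunay condition *)

Lemma gcirc_hyp (R : realType) (P q1 q2 s : R) (x : R * R) : diskD x ->
  gcirc P q1 q2 s x = (1 - sqn x) *
    (((P + s) * hyp0 x - 2 * q1 * hyp1 x - 2 * q2 * hyp2 x + (s - P)) / 2).
Proof.
move=> /disk_neq0 x1; rewrite /gcirc /hyp0 /hyp1 /hyp2.
by field; rewrite x1.
Qed.

Lemma segpt_disk (R : realType) (a b : R * R) (t : R) : 0 <= t <= 1 ->
  sqn a < 1 -> sqn b < 1 -> sqn (segpt t a b) < 1.
Proof.
move=> /andP[t0 t1] a1 b1.
have -> : sqn (segpt t a b) =
    (1 - t) * sqn a + t * sqn b - t * (1 - t) * sqn (vsub a b).
  by rewrite /sqn /segpt /vsub /=; ring.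
have h : 0 <= t * (1 - t) * sqn (vsub a b).
  by rewrite !mulr_ge0 ?sqn_ge0 // subr_ge0.
have h1 : (1 - t) * sqn a <= 1 - t by rewrite ler_piMr ?(ltW a1) // subr_ge0.
have h2 : t * sqn b <= t by rewrite ler_piMr ?(ltW b1).
have [t00|tn] := eqVneq t 0.
  by rewrite t00 !mul0r !subr0 addr0 mul1r.
have : t * sqn b < t by rewrite gtr_pMr // lt0r tn.
by lra.
Qed.

(* In the hyperboloid model the equation of a generalized circle is affine; its
   constant term [(s - P) / 2] decides the sign between two zeros. *)
Lemma gcirc_neg_on_geodesic (R : realType) (P q1 q2 s : R) (a b : R * R) :
  diskD a -> diskD b -> a != b ->
  gcirc P q1 q2 s a = 0 -> gcirc P q1 q2 s b = 0 -> s < P ->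
  exists m, hseg a b m /\ gcirc P q1 q2 s m < 0.
Proof.
move=> a1 b1 ab ga gb sP.
have h01 : 0 <= (2^-1 : R) <= 1 by apply/andP; split; lra.
have [m1 em] := unkleinP (segpt_disk h01 (klein_disk a1) (klein_disk b1)).
set m := unklein _ in m1 em; exists m; split.
  by apply/hsegP => //; split => //; exists 2^-1.
have [_ _ E] := klein_segpt_mink a1 b1 m1 em.
have [e0 e1 e2] := klein_segpt_hyp a1 b1 m1 em.
move: E e0 e1 e2; have := divr_gt0 (hyp0_gt0 m1) (hyp0_gt0 a1).
have := divr_gt0 (hyp0_gt0 m1) (hyp0_gt0 b1).
move: (hyp0 m / hyp0 a) (hyp0 m / hyp0 b) => A B B0 A0.
have : 0 < (1 - 2^-1) * A by rewrite mulr_gt0 //; lra.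
have : 0 < 2^-1 * B by rewrite mulr_gt0 //; lra.
move: (_ * A) (_ * B) => al be be0 al0 E e0 e1 e2.
have C1 : 1 < mink a b.
  by rewrite mink_dS // ltrDl mulr_gt0 // dS_gt0.
have x0 (x : R * R) : diskD x -> 1 - sqn x != 0 := @disk_neq0 R x.
move: ga gb; rewrite !gcirc_hyp // => /eqP; rewrite mulf_eq0 (negbTE (x0 _ a1)) /= => /eqP ga.
move=> /eqP; rewrite mulf_eq0 (negbTE (x0 _ b1)) /= => /eqP gb.
rewrite pmulr_rlt0; last by move: m1; rewrite /diskD /= subr_gt0.
rewrite e0 e1 e2.
set L := (X in X < 0).
(* The affine equation vanishes at both ends, so only its constant term survives, weighted by
   [1 - al - be]. The weight is positive since the lift of [m] is normalized and [mink a b > 1]. *)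
have -> : L = (1 - al - be) * ((s - P) / 2).
  set Ga := (X in X = 0) in ga; set Gb := (X in X = 0) in gb.
  transitivity (L - al * Ga - be * Gb); first by rewrite ga gb !mulr0 !subr0.
  by rewrite /L /Ga /Gb; field.
rewrite pmulr_rlt0; first by lra.
have : (al + be) ^+ 2 < 1.
  have : 0 < al * be * (mink a b - 1) by rewrite !mulr_gt0 // subr_gt0.
  by move=> h; rewrite -E; lra.
rewrite -[X in _ < X](expr1n _ 2) ltr_pXn2r ?nnegrE //; last by rewrite addr_ge0 // ltW.
by lra.
Qed.

Lemma cr_scalr (R : realType) (c : R) (v w : R * R) : cr v (scal c w) = c * cr v w.
Proof. by rewrite /cr /scal /=; ring. Qed.

Lemma crBr (R : realType) (u v w : R * R) : cr u (vsub v w) = cr u v - cr u w.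
Proof. by rewrite /cr /vsub /=; ring. Qed.

Lemma crvv (R : realType) (v : R * R) : cr v v = 0.
Proof. by rewrite /cr; ring. Qed.

(** The coefficients describe the preimage of the line [cr e p = k] under inversion at [z]: with
    [p = invp z w] the right side is [sqn (vsub w z) * (cr e p - k)]. *)
Lemma gcirc_at (R : realType) (k : R) (e z w : R * R) :
  gcirc (- k) (- k * z.1 + e.2 / 2) (- k * z.2 - e.1 / 2) (- k * sqn z - cr e z) w
  = cr e (vsub w z) - sqn (vsub w z) * k.
Proof. by rewrite /gcirc /cr /sqn /vsub /=; field. Qed.

(** Inversion at [z] turns the circle through [z], [a], [b] into the line through the images of [a]
    and [b]. A negative cross product would put [d] on the negative side of the circle equation;
    this is the circumdisk, because [gcirc_neg_on_geodesic] finds a point of the side [z a]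
    there. *)
Lemma delaunay_convex (R : realType) (z a b d : R * R) :
  diskD z -> diskD a -> diskD b -> diskD d -> a != z -> b != z -> d != z ->
  0 < cr (spoke 1 z a) (spoke 1 z b) -> ~ in_open_circumdisk z a b d ->
  0 <= cr (vsub (invp z b) (invp z a)) (vsub (invp z d) (invp z a)).
Proof.
move=> z1 a1 b1 d1 az bz dz k0 nd; rewrite leNgt; apply/negP => neg; apply: nd.
set e := vsub (invp z b) (invp z a) in neg *.
pose kp := cr e (invp z a).
have gE (w : R * R) : gcirc (- kp) (- kp * z.1 + e.2 / 2) (- kp * z.2 - e.1 / 2)
    (- kp * sqn z - cr e z) w = cr e (vsub w z) - sqn (vsub w z) * kp.
  by rewrite gcirc_at.
have gE2 (w : R * R) : w != z -> cr e (vsub w z) - sqn (vsub w z) * kp =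
    sqn (vsub w z) * cr e (vsub (invp z w) (invp z a)).
  move=> /sqn_vsub_gt0/lt0r_neq0 wz; rewrite /kp.
  have -> : cr e (vsub w z) = sqn (vsub w z) * cr e (invp z w).
    by rewrite /invp cr_scalr mulrA mulfV ?mul1r.
  by rewrite -mulrBr crBr.
have ga : gcirc (- kp) (- kp * z.1 + e.2 / 2) (- kp * z.2 - e.1 / 2)
    (- kp * sqn z - cr e z) a = 0.
  by rewrite gE gE2 // crBr subrr mulr0.
have gz : gcirc (- kp) (- kp * z.1 + e.2 / 2) (- kp * z.2 - e.1 / 2)
    (- kp * sqn z - cr e z) z = 0.
  by rewrite gE crBr subrr /sqn /vsub /= !subrr expr0n /= addr0 mul0r subr0.
have gd : gcirc (- kp) (- kp * z.1 + e.2 / 2) (- kp * z.2 - e.1 / 2)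
    (- kp * sqn z - cr e z) d < 0.
  by rewrite gE gE2 // pmulr_rlt0 ?sqn_vsub_gt0.
(* The difference of the two sides is a positive multiple of the cross product of the spokes: the
   hub lies on the inner side of the line. *)
have sP : - kp * sqn z - cr e z < - kp.
  have n1 : 1 - sqn z != 0 := disk_neq0 z1.
  rewrite -subr_gt0 (_ : _ - _ = (1 - sqn z) * cr (spoke 1 z a) (spoke 1 z b)).
    by rewrite mulr_gt0 // subr_gt0.
  have -> : cr (spoke 1 z a) (spoke 1 z b) = - kp + hubc 1 z * cr e z.
    rewrite /spoke /kp /e; move: (invp z a) (invp z b) (hubc 1 z) => p q c.
    by rewrite /cr /vsub /scal /=; ring.
  by rewrite /hubc expr1n mul1r; move: (cr e z) => c; field.
exists (- kp), (- kp * z.1 + e.2 / 2), (- kp * z.2 - e.1 / 2), (- kp * sqn z - cr e z).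
split.
  apply: contraT; rewrite !negb_or !negbK => /and4P[/eqP h1 /eqP h2 /eqP h3 /eqP h4].
  by move: gd; rewrite /gcirc h4 h2 h3 h1 !mul0r !addr0 mulr0 subr0 ltxx.
split; first exact: gz.
split; first exact: ga.
split.
  by rewrite gE gE2 // -/e crvv mulr0.
split; last by split.
have za : z != a by rewrite eq_sym.
have [m [hm gm]] := gcirc_neg_on_geodesic z1 a1 za gz ga sP.
exists m; split => //; exists a; split => //.
apply/hsegP => //; split => //; exists 0; first by rewrite lexx ler01.
by rewrite /segpt !mul0r !addr0; case: (klein a).
Qed.

(** The hub is within [c] of the origin, little compared with the distance [1 / |w - z|] of an
    inverted neighbour [w], so each spoke is at least half that long, and the angle bound keeps the
    squared cross product above [e^2 / 64] over the product of the squared distances. Moving the hub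
    changes it by at most [c |q|]; the constant 1024 gives [c^2 |b - a|^2 <= e^2 / 256], which is
    too small to reverse the sign. *)
Lemma hub_path_pos (R : realType) (z a b : R * R) (e c : R) :
  diskD z -> diskD a -> diskD b -> a != z -> b != z -> 0 < e -> e < 2 ->
  0 < cr (spoke 1 z a) (spoke 1 z b) ->
  e ^+ 2 * (dS z a * dS z b * (1 + dS z a) * (1 + dS z b))
    <= heron (dS z a) (dS z b) (dS a b) ->
  hubc 1 z <= c ->
  c ^+ 2 * sqn (vsub a z) <= e ^+ 2 / 1024 ->
  c ^+ 2 * sqn (vsub b z) <= e ^+ 2 / 1024 ->
  0 < cr (vsub (invp z a) (scal c z)) (vsub (invp z b) (scal c z)).
Proof.
move=> z1 a1 b1 az bz e0 e2 k0 he c1c ca cb.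
have sa := sqn_vsub_gt0 az; have sb := sqn_vsub_gt0 bz.
set c1 := hubc 1 z in c1c *.
have n1 := disk_gt0 z1.
have c10 : 0 < c1 by rewrite divr_gt0 // expr1n.
have S1 := dS_gt0 z1 a1; have S2 := dS_gt0 z1 b1.
rewrite eq_sym az in S1; rewrite eq_sym bz in S2.
have {}S1 := S1 isT; have {}S2 := S2 isT.
have kk : 4 * cr (spoke 1 z a) (spoke 1 z b) ^+ 2 >=
    e ^+ 2 * (sqn (spoke 1 z a) * sqn (spoke 1 z b)).
  have h := @disk_gt0 R.
  rewrite heron_hub // !(@sqn_spoke _ 1) ?(lt0r_neq0 (h _ _)) //.
  rewrite !scal1 divr1 -/c1 (ler_pdivlMr _ _ (exprn_gt0 2 (mulr_gt0 S1 S2))).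
  rewrite (_ : _ * (dS z a * dS z b) ^+ 2 = c1 ^+ 4 *
    (e ^+ 2 * (dS z a * dS z b * (1 + dS z a) * (1 + dS z b)))).
    by rewrite ler_wpM2l // exprn_ge0 // ltW.
  by field; rewrite !lt0r_neq0.
have sz : sqn z < 1 := z1.
have low (w : R * R) : w != z -> c ^+ 2 * sqn (vsub w z) <= e ^+ 2 / 1024 ->
    (4 * sqn (vsub w z))^-1 <= sqn (spoke 1 z w).
  move=> wz cw; have sw := sqn_vsub_gt0 wz.
  have ip : sqn (invp z w) = (sqn (vsub w z))^-1.
    by rewrite /invp sqn_scal; field; rewrite lt0r_neq0.
  have h1 : sqn (invp z w) / 2 - sqn (scal c1 z) <= sqn (spoke 1 z w).
    rewrite -subr_ge0.
    have -> : sqn (spoke 1 z w) - (sqn (invp z w) / 2 - sqn (scal c1 z)) =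
       2 * sqn (vsub (scal 2^-1 (invp z w)) (scal c1 z)).
      rewrite /spoke -/c1; move: (invp z w) => p; rewrite /sqn /vsub /scal /=; by field.
    by rewrite mulr_ge0 // sqn_ge0.
  have h2 : sqn (scal c1 z) <= c ^+ 2.
    rewrite sqn_scal; apply: (@le_trans _ _ (c1 ^+ 2)).
      by rewrite ler_piMr ?(ltW sz) // sqr_ge0.
    by rewrite ler_pXn2r ?nnegrE //; lra.
  have h3 : c ^+ 2 <= (4 * sqn (vsub w z))^-1.
    rewrite -[leRHS]mul1r ler_pdivlMr ?mulr_gt0 //.
    have : e ^+ 2 <= 4 by rewrite expr2; nra.
    by lra.
  apply: le_trans h1; rewrite ip.
  have h4 : (4 * sqn (vsub w z))^-1 = (sqn (vsub w z))^-1 / 4.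
    by rewrite invfM mulrC.
  by rewrite h4 in h3 *; lra.
have la := low a az ca; have lb := low b bz cb.
have k2 : e ^+ 2 / (64 * (sqn (vsub a z) * sqn (vsub b z))) <=
    cr (spoke 1 z a) (spoke 1 z b) ^+ 2.
  have : (4 * sqn (vsub a z))^-1 * (4 * sqn (vsub b z))^-1 <=
      sqn (spoke 1 z a) * sqn (spoke 1 z b).
    by apply: ler_pM => //; rewrite invr_ge0 mulr_ge0 ?sqn_ge0.
  move=> /(ler_wpM2l (sqr_ge0 e)) hh; have {}hh := le_trans hh kk.
  have E : e ^+ 2 * ((4 * sqn (vsub a z))^-1 * (4 * sqn (vsub b z))^-1) =
      4 * (e ^+ 2 / (64 * (sqn (vsub a z) * sqn (vsub b z)))).
    by field; rewrite !lt0r_neq0.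
  by rewrite E ler_pM2l in hh.
pose q := vsub (invp z b) (invp z a).
have -> : cr (vsub (invp z a) (scal c z)) (vsub (invp z b) (scal c z)) =
    cr (spoke 1 z a) (spoke 1 z b) - (c - c1) * cr z q.
  by rewrite /spoke -/c1 /q /cr /vsub /scal /=; ring.
rewrite subr_gt0; apply: ltr_normlW.
rewrite -[ltRHS](gtr0_norm k0) -(@ltr_pXn2r _ 2) ?nnegrE // !real_normK ?num_real //.
apply: lt_le_trans k2.
have qE : sqn q = sqn (vsub b a) / (sqn (vsub b z) * sqn (vsub a z)).
  by rewrite /q sqn_invp_sub.
have h5 : ((c - c1) * cr z q) ^+ 2 <= c ^+ 2 * sqn q.
  rewrite exprMn; apply: ler_pM; rewrite ?sqr_ge0 //.
    by rewrite ler_pXn2r ?nnegrE //; lra.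
  have := lagrange2 z q; have := sqr_ge0 (dt z q) => h6 h7.
  have : sqn z * sqn q <= sqn q by rewrite ler_piMl ?sqn_ge0 // ltW.
  by lra.
apply: (le_lt_trans h5); rewrite qE.
have h8 : sqn (vsub b a) <= 2 * (sqn (vsub a z) + sqn (vsub b z)).
  rewrite -subr_ge0 (_ : _ - _ = sqn ((a.1 - z.1) + (b.1 - z.1), (a.2 - z.2) + (b.2 - z.2))).
    exact: sqn_ge0.
  by rewrite /sqn /vsub /=; ring.
have c20 : 0 <= c ^+ 2 := sqr_ge0 c.
have h9 := ler_wpM2l c20 h8.
have e20 : 0 < e ^+ 2 by rewrite exprn_gt0.
have h10 : c ^+ 2 * sqn (vsub b a) < e ^+ 2 / 64 by lra.
rewrite mulrA [_ * sqn (vsub a z)]mulrC ltr_pdivrMr ?mulr_gt0 //.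
rewrite (_ : _ / _ * _ = e ^+ 2 / 64) //.
by field; rewrite !lt0r_neq0.
Qed.

(** * Open and compact subsets of the disk *)

Lemma fst_continuous2 (R : realType) : continuous (fun z : R * R => z.1).
Proof. by move=> z; exact: cvg_fst. Qed.

Lemma snd_continuous2 (R : realType) : continuous (fun z : R * R => z.2).
Proof. by move=> z; exact: cvg_snd. Qed.

Lemma sqn_continuous (R : realType) : continuous (@sqn R).
Proof.
move=> z; rewrite /sqn; apply: cvgD; rewrite expr2.
  under [X in X @ _]eq_fun do rewrite expr2.
  by apply: cvgM; exact: fst_continuous2.
under [X in X @ _]eq_fun do rewrite expr2.
by apply: cvgM; exact: snd_continuous2.
Qed.

Lemma open_along_klein_line (R : realType) (O : set (R * R)) (k h : R * R) :
  open O -> sqn k < 1 -> O (unklein k) ->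
  exists2 l, 0 < l & sqn (k.1 + l * h.1, k.2 + l * h.2) < 1 /\
    O (unklein (k.1 + l * h.1, k.2 + l * h.2)).
Proof.
move=> oO k1 Ok.
pose p (l : R) : R * R := (k.1 + l * h.1, k.2 + l * h.2).
have p0 : p 0 = k by rewrite /p !mul0r !addr0; case: (k).
have cp : p l @[l --> (0 : R)] --> p 0.
  have c (a b : R) : a + l * b @[l --> (0 : R)] --> a + 0 * b.
    by apply: cvgD; [exact: cvg_cst|apply: cvgM; [exact: cvg_id|exact: cvg_cst]].
  exact: (cvg_pair (c k.1 h.1) (c k.2 h.2)).
have cs : sqn (p l) @[l --> (0 : R)] --> sqn k.
  rewrite -p0; exact: (cvg_comp _ _ cp (@sqn_continuous R (p 0))).
have q0 : 0 < 1 + Num.sqrt (1 - sqn k).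
  by rewrite ltr_pwDl // sqrtr_ge0.
have cq : (1 + Num.sqrt (1 - sqn (p l)))^-1 @[l --> (0 : R)] -->
    (1 + Num.sqrt (1 - sqn k))^-1.
  apply: cvgV; first exact: lt0r_neq0.
  apply: cvgD; first exact: cvg_cst.
  have c1 : 1 - sqn (p l) @[l --> (0 : R)] --> 1 - sqn k.
    by apply: cvgB => //; exact: cvg_cst.
  exact: (cvg_comp _ _ c1 (@sqrt_continuous R _)).
have cu : unklein (p l) @[l --> (0 : R)] --> unklein k.
  have c1 : (p l).1 @[l --> (0 : R)] --> k.1.
    rewrite -[in X in _ --> X]p0.
    exact: (cvg_comp _ _ cp (@fst_continuous2 R (p 0))).
  have c2 : (p l).2 @[l --> (0 : R)] --> k.2.
    rewrite -[in X in _ --> X]p0.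
    exact: (cvg_comp _ _ cp (@snd_continuous2 R (p 0))).
  exact: (cvg_pair (cvgM cq c1) (cvgM cq c2)).
have n1 : \forall l \near (0 : R), O (unklein (p l)).
  by apply: cu; exact: open_nbhs_nbhs.
have n2 : \forall l \near (0 : R), sqn (p l) < 1.
  by apply: (cvgr_lt _ cs).
have /nbhs_ballP[e /= e0 H] : \forall l \near (0 : R), O (unklein (p l)) /\ sqn (p l) < 1.
  by near=> l; split; near: l.
have e2 : 0 < e / 2 by rewrite divr_gt0.
exists (e / 2) => //.
have [] := H (e / 2); last by split.
by rewrite /ball /= sub0r normrN gtr0_norm // gtr_pMr // invf_lt1 // ltr1n.
Unshelve. all: by end_near. Qed.

Lemma compact_disk (R : realType) (r : R) : compact [set z : R * R | sqn z <= r].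
Proof.
apply: (@subclosed_compact _ _ (`[- (1 + r), 1 + r]%classic `*` `[- (1 + r), 1 + r]%classic)).
- rewrite (_ : [set z | _] = @sqn R @^-1` [set x | x <= r]) //.
  apply: closed_comp; last exact: closed_le.
  by move=> z _; exact: sqn_continuous.
- by apply: compact_setX; exact: segment_compact.
- move=> z /= zr.
  have H (x : R) : x ^+ 2 <= r -> - (1 + r) <= x <= 1 + r.
    by move=> xr; apply/andP; split; nra.
  rewrite !in_itv /=; split; apply: H; apply: le_trans zr; rewrite /sqn.
    by rewrite lerDl sqr_ge0.
  by rewrite lerDr sqr_ge0.
Qed.

Lemma compact_finite_cover (T : topologicalType) (V : eqType) (K : set T)
    (O : V -> set T) : compact K -> (forall v, open (O v)) ->
  (forall z, K z -> exists v, O v z) ->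
  exists s : seq V, forall z, K z -> exists2 v, v \in s & O v z.
Proof.
move=> /compact_near_coveringP cK oO cov.
(* In this filter a property is large if it holds for all lists containing some fixed list;
   near-covering along it yields one list that works for every point of [K]. *)
pose F : set_system (seq V) :=
  [set P | exists s0 : seq V, forall s : seq V, {subset s0 <= s} -> P s].
have FF : Filter F.
  split; first by exists [::].
    move=> P Q [s hs] [t ht]; exists (s ++ t) => u su.
    by split; [apply: hs|apply: ht] => x xs; apply: su; rewrite mem_cat xs ?orbT.
  by move=> P Q PQ [s hs]; exists s => u /hs/PQ.
have [|s hs] := cK (seq V) F (fun s z => exists2 v, v \in s & O v z) FF.
- move=> z Kz; have [v Ov] := cov z Kz.
  exists (O v, [set s : seq V | v \in s]); first split => /=.
  + exact: open_nbhs_nbhs.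
  + by exists [:: v] => s; apply; rewrite mem_head.
  + by move=> [z' s] /= [Ov' vs]; exists v.
- by exists s => z; apply: (hs s).
Qed.

(** * Geodesic triangulations of the hyperbolic plane *)

Definition tript (R : realType) (s t : R) (a b c : R * R) : R * R :=
  (a.1 + s * (b.1 - a.1) + t * (c.1 - a.1), a.2 + s * (b.2 - a.2) + t * (c.2 - a.2)).

Lemma htri_klein (R : realType) (a b c x : R * R) :
  diskD a -> diskD b -> diskD c -> htri a b c x ->
  exists s t, [/\ 0 <= s, 0 <= t, s + t <= 1 &
    klein x = tript s t (klein a) (klein b) (klein c)].
Proof.
move=> a1 b1 c1 [y [/(hsegP _ b1 c1)[y1 [t /andP[t0 t1] ey]]]].
move=> /(hsegP _ a1 y1)[x1 [u /andP[u0 u1] ex]].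
exists (u * (1 - t)), (u * t); split.
- by rewrite mulr_ge0 // subr_ge0.
- by rewrite mulr_ge0.
- by rewrite -mulrDr subrK mulr1.
- rewrite ex ey; move: (klein a) (klein b) (klein c) => ka kb kc.
  by rewrite /segpt /tript /=; congr pair; ring.
Qed.

Lemma htri_of_klein (R : realType) (a b c : R * R) (s t : R) :
  diskD a -> diskD b -> diskD c -> 0 <= s -> 0 <= t -> s + t <= 1 ->
  exists x, htri a b c x /\ klein x = tript s t (klein a) (klein b) (klein c).
Proof.
move=> a1 b1 c1 s0 t0 st.
have [v /andP[v0 v1] [vs vt]] : exists2 v, 0 <= v <= 1 &
    s = (s + t) * (1 - v) /\ t = (s + t) * v.
  have [e|e] := eqVneq (s + t) 0.
    by exists 0; [rewrite lexx ler01|split; lra].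
  have stp : 0 < s + t by rewrite lt0r e addr_ge0.
  exists (t / (s + t)); first by rewrite divr_ge0 ?(ltW stp) //= ler_pdivrMr // mul1r lerDr.
  by split; field.
have v01 : 0 <= v <= 1 by apply/andP.
have st01 : 0 <= s + t <= 1 by apply/andP; split => //; exact: addr_ge0.
have [y1 ey] := unkleinP (segpt_disk v01 (klein_disk b1) (klein_disk c1)).
have [x1 ex] := unkleinP (segpt_disk st01 (klein_disk a1) (klein_disk y1)).
exists (unklein (segpt (s + t) (klein a) (klein (unklein (segpt v (klein b) (klein c)))))).
split.
  exists (unklein (segpt v (klein b) (klein c))); split.
    by apply/hsegP => //; split => //; exists v.
  by apply/hsegP => //; split => //; exists (s + t).
rewrite ex ey; move: (klein a) (klein b) (klein c) => ka kb kc.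
have -> : tript s t ka kb kc = tript ((s + t) * (1 - v)) ((s + t) * v) ka kb kc.
  by rewrite -vs -vt.
by rewrite /segpt /tript /=; congr pair; ring.
Qed.

Lemma face_pt_i (R : realType) (V : eqType) (i j k : V) (st : R * R) :
  face_pt i j k st i = st.1.
Proof. by rewrite /face_pt eqxx. Qed.

Lemma face_pt_out (R : realType) (V : eqType) (i j k v : V) (st : R * R) :
  v != i -> v != j -> v != k -> face_pt i j k st v = 0.
Proof. by rewrite /face_pt => /negbTE-> /negbTE-> /negbTE->. Qed.

Lemma face_pt_pos (R : realType) (V : eqType) (i j k v : V) (st : R * R) :
  0 < face_pt i j k st v -> [|| v == i, v == j | v == k].
Proof.
apply: contraPT; rewrite !negb_or => /and3P[vi vj vk].
by rewrite face_pt_out // ltxx.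
Qed.

Lemma complex_faces (V : eqType) (F : V -> V -> V -> Prop) : is_complex F ->
  forall i j k, F i j k ->
  [/\ i != j, j != k & i != k] /\
  [/\ F i k j, F j i k, F j k i, F k i j & F k j i].
Proof.
move=> [d s r _] i j k f; split; first exact: d.
have jki := r _ _ _ f; have kij := r _ _ _ jki.
have jik := s _ _ _ f; have ikj := r _ _ _ jik; have kji := r _ _ _ ikj.
by split.
Qed.

Lemma face_pt_vtx (R : realType) (V : eqType) (i j k : V) :
  face_pt i j k (1, 0) = vtx R i.
Proof.
apply/funext => v; rewrite /face_pt /vtx /= subrr subr0.
by case: (v == i) => //; case: (v == j) => //; case: (v == k).
Qed.

Section GeodesicTriangulation.
Variables (R : realType) (V : eqType) (F : V -> V -> V -> Prop).
Variable phi : (V -> R) -> R * R.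
Hypotheses (cF : is_complex F) (gphi : geodesic_map F phi) (hphi : homeo_onto_H2 F phi).

Definition vpt (v : V) : R * R := phi (vtx R v).
Definition kpt (v : V) : R * R := klein (vpt v).

Lemma realization_face (i j k : V) (st : R * R) : F i j k -> simplex2 st ->
  realization F (face_pt i j k st).
Proof. by move=> f s; exists i, j, k; split => //; exists st. Qed.

Lemma simplex_vtx : simplex2 ((1, 0) : R * R).
Proof. by split; rewrite /= ?ler01 // addr0. Qed.

Lemma realization_vtx (v : V) : realization F (vtx R v).
Proof.
have [_ _ _ /(_ v)[j [k f]]] := cF.
by rewrite -(face_pt_vtx _ _ j k); apply: realization_face f simplex_vtx.
Qed.

Lemma phi_disk (x : V -> R) : realization F x -> diskD (phi x).
Proof. by move=> rx; have [<- _ _ _] := hphi; exists x. Qed.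

Lemma vpt_disk (v : V) : diskD (vpt v).
Proof. exact: phi_disk (realization_vtx v). Qed.

Lemma phi_inj (x y : V -> R) : realization F x -> realization F y ->
  klein (phi x) = klein (phi y) -> x = y.
Proof.
move=> rx ry /(klein_inj (phi_disk rx) (phi_disk ry)).
by have [_ inj _ _] := hphi; exact: inj.
Qed.

Lemma vpt_inj (u v : V) : vpt u = vpt v -> u = v.
Proof.
move=> e; have : vtx R u = vtx R v.
  by apply: phi_inj; [exact: realization_vtx..|congr klein].
move=> /(congr1 (fun f => f u)); rewrite /vtx eqxx.
by case: eqP => // _ /eqP; rewrite oner_eq0.
Qed.

Lemma face_klein (i j k : V) (st : R * R) : F i j k -> simplex2 st ->
  exists s t, [/\ 0 <= s, 0 <= t, s + t <= 1 &
    klein (phi (face_pt i j k st)) = tript s t (kpt i) (kpt j) (kpt k)].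
Proof.
move=> f s; apply: htri_klein; try exact: vpt_disk.
have [_ g] := gphi; rewrite -/(vpt _) /vpt -g //.
by exists st.
Qed.

Lemma face_of_klein (i j k : V) (s t : R) : F i j k ->
  0 <= s -> 0 <= t -> s + t <= 1 ->
  exists2 st, simplex2 st &
    klein (phi (face_pt i j k st)) = tript s t (kpt i) (kpt j) (kpt k).
Proof.
move=> f s0 t0 st.
have [x [hx ex]] := htri_of_klein (vpt_disk i) (vpt_disk j) (vpt_disk k) s0 t0 st.
have [_ g] := gphi; move: hx; rewrite /vpt -g // => -[u su eu].
by exists u => //; rewrite -ex -eu.
Qed.

Lemma edge_klein (i j k : V) (t : R) : F i j k -> 0 <= t <= 1 ->
  exists u, klein (phi (edge_pt i j t)) = segpt u (kpt i) (kpt j).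
Proof.
move=> f t01; have [g _] := gphi.
have : hseg (vpt i) (vpt j) (phi (edge_pt i j t)).
  by rewrite /vpt -g; [exists t|exists k].
by move=> /(hsegP _ (vpt_disk i) (vpt_disk j))[_ [u _ eu]]; exists u.
Qed.

Definition kdir (i j : V) : R * R := vsub (kpt j) (kpt i).

(* Radially scaled into the triangles, a common direction of two open cones is a
   common point of two faces; in barycentric coordinates its support lies in both
   faces, and is neither a vertex nor an edge at the apex. *)
Lemma cones_disjoint (i j k j' k' : V) (h : R * R) :
  F i j k -> F i j' k' ->
  0 < cr (kdir i j) (kdir i k) -> 0 < cr (kdir i j') (kdir i k') ->
  0 < cr (kdir i j) h -> 0 < cr h (kdir i k) ->
  0 < cr (kdir i j') h -> 0 < cr h (kdir i k') -> j = j' /\ k = k'.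
Proof.
move=> f f' c0 c0' h1 h2 h3 h4.
pose D := cr (kdir i j) (kdir i k); pose D' := cr (kdir i j') (kdir i k').
(* The inverse of 1 plus all the coefficients of [h] in the two frames: for this common [l] the
   point at [l h] has admissible barycentric coordinates in both triangles. *)
pose l := (1 + cr h (kdir i k) / D + cr (kdir i j) h / D
            + cr h (kdir i k') / D' + cr (kdir i j') h / D')^-1.
have p1 : 0 < cr h (kdir i k) / D by rewrite divr_gt0.
have p2 : 0 < cr (kdir i j) h / D by rewrite divr_gt0.
have p3 : 0 < cr h (kdir i k') / D' by rewrite divr_gt0.
have p4 : 0 < cr (kdir i j') h / D' by rewrite divr_gt0.
have l0 : 0 < l by rewrite invr_gt0; lra.
have lE : l * (1 + cr h (kdir i k) / D + cr (kdir i j) h / D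
            + cr h (kdir i k') / D' + cr (kdir i j') h / D') = 1.
  by rewrite mulVf // lt0r_neq0 //; lra.
have q1 := mulr_gt0 l0 p1; have q2 := mulr_gt0 l0 p2.
have q3 := mulr_gt0 l0 p3; have q4 := mulr_gt0 l0 p4.
have [st sst est] := @face_of_klein i j k (l * (cr h (kdir i k) / D))
  (l * (cr (kdir i j) h / D)) f (ltW q1) (ltW q2) ltac:(lra).
have [st' sst' est'] := @face_of_klein i j' k' (l * (cr h (kdir i k') / D'))
  (l * (cr (kdir i j') h / D')) f' (ltW q3) (ltW q4) ltac:(lra).
have cone a b : 0 < cr (kdir i a) (kdir i b) ->
    tript (l * (cr h (kdir i b) / cr (kdir i a) (kdir i b)))
      (l * (cr (kdir i a) h / cr (kdir i a) (kdir i b))) (kpt i) (kpt a) (kpt b)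
    = ((kpt i).1 + l * h.1, (kpt i).2 + l * h.2).
  move=> /lt0r_neq0; rewrite /tript /kdir; move: (kpt i) (kpt a) (kpt b) => x y z.
  by rewrite /cr /vsub /= => n0; congr pair; field.
have e : face_pt i j k st = face_pt i j' k' st'.
  apply: phi_inj; [exact: realization_face f sst|exact: realization_face f' sst'|].
  by rewrite est est' !cone.
have [[ij jk ik] _] := complex_faces cF f.
have [[ij' jk' ik'] [ikj' _ _ _ _]] := complex_faces cF f'.
have [s1 [s2 s3]] := sst.
have notedge a b t : F i a b -> 0 <= t <= 1 -> face_pt i j k st = edge_pt i a t ->
    cr (kdir i a) h = 0.
  move=> fa t01 ea; have [u eu] := edge_klein fa t01.
  move: est; rewrite ea eu cone //; rewrite /segpt /kdir.
  move: (kpt i) (kpt a) => x y [e1 e2].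
  apply: (mulfI (lt0r_neq0 l0)); rewrite mulr0 /cr /vsub /=.
  have {}e1 : l * h.1 = u * (y.1 - x.1) by lra.
  have {}e2 : l * h.2 = u * (y.2 - x.2) by lra.
  have -> : l * ((y.1 - x.1) * h.2 - (y.2 - x.2) * h.1) =
      (y.1 - x.1) * (l * h.2) - (y.2 - x.2) * (l * h.1) by ring.
  by rewrite e1 e2; ring.
have j0 : face_pt i j k st j != 0.
  rewrite /face_pt [j == i]eq_sym (negbTE ij) eqxx; apply/eqP => st2.
  have : cr (kdir i k) h = 0.
    have [_ [fikj _ _ _ _]] := complex_faces cF f.
    apply: (notedge _ j st.1 fikj); first by apply/andP; split => //; lra.
    apply/funext => v; rewrite /face_pt /edge_pt st2 subr0.
    have [//|vi] := eqVneq v i; have [->|vj] := eqVneq v j; last by [].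
    by rewrite (negbTE jk).
  have -> : cr (kdir i k) h = - cr h (kdir i k) by rewrite /cr; ring.
  by lra.
have k0 : face_pt i j k st k != 0.
  rewrite /face_pt [k == i]eq_sym (negbTE ik) [k == j]eq_sym (negbTE jk) eqxx.
  apply/eqP => st2.
  have : cr (kdir i j) h = 0.
    apply: (notedge _ k st.1 f); first by apply/andP; split => //; lra.
    apply/funext => v; rewrite /face_pt /edge_pt.
    have [//|vi] := eqVneq v i; have [//|vj] := eqVneq v j; first by lra.
    by rewrite st2; case: ifP.
  by lra.
have inf v : face_pt i j k st v != 0 -> v != i -> v \in [:: j'; k'].
  move=> vn vi; rewrite !inE; apply: contraT; rewrite negb_or => /andP[vj vk].
  by move: vn; rewrite e face_pt_out ?eqxx.
have ji : j != i by rewrite eq_sym.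
have ki : k != i by rewrite eq_sym.
have jin := inf j j0 ji.
have kin := inf k k0 ki.
move: jin kin; rewrite !inE => /orP[/eqP ej|/eqP ej] /orP[/eqP ek|/eqP ek].
- by rewrite ej ek eqxx in jk.
- by [].
(* With [j] and [k] exchanged the two faces would have opposite orientations. *)
- have : cr (kdir i j) (kdir i k) = - cr (kdir i j') (kdir i k').
    by rewrite ej ek /cr; ring.
  by move=> E; exfalso; lra.
- by rewrite ej ek eqxx in jk.
Qed.

End GeodesicTriangulation.

(** * Open stars and the local structure of the triangulation *)

Lemma tript_swap (R : realType) (s t : R) (a b c : R * R) :
  tript s t a b c = tript t s a c b.
Proof. by rewrite /tript; congr pair; ring. Qed.

Lemma tript_rot (R : realType) (s t : R) (a b c : R * R) :
  tript s t a b c = tript (1 - s - t) t b a c.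
Proof. by rewrite /tript; congr pair; ring. Qed.

Lemma face_pt_continuous (R : realType) (V : eqType) (i j k v : V) :
  continuous (fun st : R * R => face_pt i j k st v).
Proof.
rewrite /face_pt; case: (v == i); first exact: fst_continuous2.
case: (v == j); first exact: snd_continuous2.
case: (v == k); last by move=> z; exact: cvg_cst.
move=> z; apply: cvgB; last exact: snd_continuous2.
by apply: cvgB; [exact: cvg_cst|exact: fst_continuous2].
Qed.

Lemma crC (R : realType) (v w : R * R) : cr v w = - cr w v.
Proof. by rewrite /cr; ring. Qed.

Lemma cr_tript (R : realType) (l s t : R) (x a b h : R * R) :
  (x.1 + l * h.1, x.2 + l * h.2) = tript s t x a b ->
  l * cr (vsub a x) h = t * cr (vsub a x) (vsub b x) /\
  l * cr h (vsub b x) = s * cr (vsub a x) (vsub b x).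
Proof.
rewrite /tript /cr /vsub /= => -[e1 e2].
have {}e1 : l * h.1 = s * (a.1 - x.1) + t * (b.1 - x.1) by lra.
have {}e2 : l * h.2 = s * (a.2 - x.2) + t * (b.2 - x.2) by lra.
split.
  transitivity ((a.1 - x.1) * (l * h.2) - (a.2 - x.2) * (l * h.1)); first by ring.
  by rewrite e1 e2; ring.
transitivity ((l * h.1) * (b.2 - x.2) - (l * h.2) * (b.1 - x.1)); first by ring.
by rewrite e1 e2; ring.
Qed.

Lemma cr_segpt_tript (R : realType) (u l s t : R) (x a b b' : R * R) :
  ((segpt u x a).1 + l * (scal (-1) (vsub b x)).1,
   (segpt u x a).2 + l * (scal (-1) (vsub b x)).2) = tript s t x a b' ->
  - (l * cr (vsub a x) (vsub b x)) = t * cr (vsub a x) (vsub b' x).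
Proof.
rewrite /segpt /scal /cr /vsub /tript /= => -[e1 e2].
have {}e1 : u * (a.1 - x.1) - l * (b.1 - x.1) = s * (a.1 - x.1) + t * (b'.1 - x.1) by lra.
have {}e2 : u * (a.2 - x.2) - l * (b.2 - x.2) = s * (a.2 - x.2) + t * (b'.2 - x.2) by lra.
transitivity ((a.1 - x.1) * (u * (a.2 - x.2) - l * (b.2 - x.2)) -
  (a.2 - x.2) * (u * (a.1 - x.1) - l * (b.1 - x.1))); first by ring.
by rewrite e1 e2; ring.
Qed.

Section Stars.
Variables (R : realType) (V : eqType) (F : V -> V -> V -> Prop).
Variable phi : (V -> R) -> R * R.
Hypotheses (cF : is_complex F) (gphi : geodesic_map F phi) (hphi : homeo_onto_H2 F phi).

(** The intersection of the open stars of the vertices in [S]; for two vertices of an edge it is the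
    open star of that edge. *)
Definition star (S : seq V) : set (V -> R) :=
  [set x | realization F x /\ forall v, v \in S -> 0 < x v].

Lemma star_open (S : seq V) : open (phi @` star S).
Proof.
have [_ _ _ op] := hphi; apply: op; split; first by move=> x [].
move=> i j k f; exists [set st | forall v, v \in S -> 0 < face_pt i j k st v].
split.
  elim: S => [|v S IH].
    rewrite (_ : [set st | _] = setT); first exact: openT.
    by apply/seteqP; split => // st _ v.
  rewrite (_ : [set st | _] = [set st | 0 < face_pt i j k st v] `&`
     [set st | forall v, v \in S -> 0 < face_pt i j k st v]).
    apply: openI => //.
    rewrite (_ : [set st | _] = (fun st : R * R => face_pt i j k st v) @^-1` [set x | 0 < x]) //.
    apply: open_comp; last exact: open_gt.
    by move=> z _; exact: face_pt_continuous.
  apply/seteqP; split => st /=.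
    by move=> H; split=> [|w wS]; apply: H; rewrite inE ?eqxx // wS orbT.
  by move=> [H1 H2] w; rewrite inE => /orP[/eqP->|/H2].
apply/seteqP; split => st /=; first by move=> [s [_ H]]; split.
move=> [H s]; split => //; split => //; exact: realization_face.
Qed.

Lemma star_step (S : seq V) (x : V -> R) (h : R * R) : star S x ->
  exists2 l, 0 < l & exists2 y, star S y &
    klein (phi y) = ((klein (phi x)).1 + l * h.1, (klein (phi x)).2 + l * h.2).
Proof.
move=> sx; have x1 := phi_disk hphi sx.1.
have [u1 eu] := unkleinP (klein_disk x1).
have ux := klein_inj u1 x1 eu.
have [|l l0 [p1 [y sy ey]]] :=
  @open_along_klein_line R _ (klein (phi x)) h (@star_open S) (klein_disk x1).
  by rewrite ux; exists x.
exists l => //; exists y => //; rewrite ey.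
by have [] := unkleinP p1.
Qed.

Lemma star_face (i : V) (x : V -> R) : realization F x -> 0 < x i ->
  exists j k s t, [/\ F i j k, 0 <= s, 0 <= t &
    klein (phi x) = tript s t (kpt phi i) (kpt phi j) (kpt phi k)].
Proof.
move=> [a [b [c [f [st [sst ->]]]]]] /face_pt_pos.
have [_ [f1 f2 f3 f4 f5]] := complex_faces cF f.
have [s [t [s0 t0 st1 ->]]] := face_klein cF gphi hphi f sst.
case/or3P => /eqP ->.
- by exists b, c, s, t.
- exists a, c, (1 - s - t), t; split => //; first by lra.
  by rewrite -tript_rot.
- exists a, b, (1 - t - s), s; split => //; first by lra.
  by rewrite -tript_rot tript_swap.
Qed.

Lemma star_edge (i j : V) (x : V -> R) : realization F x -> i != j ->
  0 < x i -> 0 < x j ->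
  exists k s t, [/\ F i j k, 0 <= t &
    klein (phi x) = tript s t (kpt phi i) (kpt phi j) (kpt phi k)].
Proof.
move=> [a [b [c [f [st [sst ->]]]]]] ij /face_pt_pos ia /face_pt_pos ja.
have [_ [f1 f2 f3 f4 f5]] := complex_faces cF f.
have [s [t [s0 t0 st1 ->]]] := face_klein cF gphi hphi f sst.
case/or3P: ia ij => /eqP -> ij; case/or3P: ja ij => /eqP ->; rewrite ?eqxx // => _.
- by exists c, s, t.
- by exists b, t, s; rewrite tript_swap.
- by exists c, (1 - s - t), t; rewrite -tript_rot.
- exists a, t, (1 - s - t); split => //; first by lra.
  by rewrite [RHS]tript_swap -tript_rot.
- by exists b, (1 - t - s), s; rewrite -tript_rot tript_swap.
- exists a, s, (1 - t - s); split => //; first by lra.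
  by rewrite [RHS]tript_swap -tript_rot tript_swap.
Qed.

Hypothesis nd : forall i j k, F i j k -> cr (kdir phi i j) (kdir phi i k) != 0.

(** Since the image of the star of [i] is open, a short step from [i] in the direction [h] stays in
    it and lands in a face at [i]; the last two vertices are exchanged if that face is negatively
    oriented. *)
Lemma cones_cover (i : V) (h : R * R) : exists j k,
  [/\ F i j k, 0 < cr (kdir phi i j) (kdir phi i k),
      0 <= cr (kdir phi i j) h & 0 <= cr h (kdir phi i k)].
Proof.
have sx : star [:: i] (vtx R i).
  split; first exact: realization_vtx.
  by move=> v; rewrite inE => /eqP->; rewrite /vtx eqxx ltr01.
have [l l0 [y [ry yi] ey]] := star_step h sx.
have [j [k [s [t [f s0 t0]]]]] := star_face ry (yi i (mem_head _ _)).
rewrite ey -/(vpt phi i) -/(kpt phi i).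
move=> e; have [E1 E2] := cr_tript e.
have [c0|c0] := ltP 0 (cr (kdir phi i j) (kdir phi i k)).
  exists j, k; split => //.
    by rewrite -(pmulr_rge0 _ l0) E1 mulr_ge0 // ltW.
  by rewrite -(pmulr_rge0 _ l0) E2 mulr_ge0 // ltW.
have [_ [f1 _ _ _ _]] := complex_faces cF f.
exists k, j; split => //.
- by rewrite crC oppr_gt0 lt_neqAle c0 nd.
- by rewrite crC oppr_ge0 -(pmulr_rle0 _ l0) E2 mulr_ge0_le0.
- by rewrite crC oppr_ge0 -(pmulr_rle0 _ l0) E1 mulr_ge0_le0.
Qed.

(** An interior point of the edge is pushed away from [k]. In the open star of the edge it can only
    enter a face that contains [i] and [j], and that face lies on the other side. *)
Lemma edge_two_sides (i j k : V) : F i j k ->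
  exists2 k', F i j k' &
    cr (kdir phi i j) (kdir phi i k') * cr (kdir phi i j) (kdir phi i k) < 0.
Proof.
move=> f; have [[ij jk ik] _] := complex_faces cF f.
pose st : R * R := (2^-1, 2^-1).
have sst : simplex2 st by rewrite /simplex2 /st /=; lra.
have sx : star [:: i; j] (face_pt i j k st).
  split; first exact: realization_face.
  move=> v; rewrite !inE => /orP[]/eqP->; rewrite /face_pt /= ?eqxx.
    by rewrite invr_gt0.
  by rewrite eq_sym (negbTE ij) invr_gt0.
have eE : face_pt i j k st = edge_pt i j 2^-1.
  apply/funext => v; rewrite /face_pt /edge_pt /=; case: ifP => // _.
  by case: ifP => // _; [lra|case: ifP => // _; lra].
have h01 : 0 <= (2^-1 : R) <= 1 by apply/andP; split; lra.
have [u eu] := edge_klein cF gphi hphi f h01.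
pose h := scal (-1) (kdir phi i k).
have [l l0 [y [ry yi] ey]] := star_step h sx.
have yi0 : 0 < y i by apply: yi; rewrite inE eqxx.
have yj0 : 0 < y j by apply: yi; rewrite !inE eqxx orbT.
have [k' [s [t [f' t0]]]] := star_edge ry ij yi0 yj0.
rewrite ey eE eu => e.
have E := cr_segpt_tript e.
exists k' => //; set C := cr _ (kdir phi i k) in E *; set C' := cr _ _ in E *.
have C0 : C != 0 := nd f.
have CC : 0 < l * C ^+ 2 by rewrite mulr_gt0 // lt0r sqrf_eq0 C0 sqr_ge0.
have : t * (C' * C) < 0 by rewrite mulrA -E mulNr -mulrA -expr2 oppr_lt0.
have [->|tn] := eqVneq t 0; first by rewrite mul0r ltxx.
by rewrite pmulr_rlt0 // lt0r tn.
Qed.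

(** If both faces were on the same side, the edge direction tilted slightly towards [k] would lie in
    both open cones, against [cones_disjoint]; [small] provides the tilt. *)
Lemma edge_opposite_sides (i j k k' : V) : F i j k -> F i j k' -> k != k' ->
  cr (kdir phi i j) (kdir phi i k) * cr (kdir phi i j) (kdir phi i k') < 0.
Proof.
move=> f f' kk'; rewrite ltNge; apply/negP => pos.
have [_ [g _ _ _ _]] := complex_faces cF f; have [_ [g' _ _ _ _]] := complex_faces cF f'.
have small (p q : R) : 0 < p -> exists2 l, 0 < l & 0 < p + l * q.
  move=> p0; have d0 : 0 < p + `|q| by rewrite ltr_wpDr.
  exists (p / (p + `|q|)); first by rewrite divr_gt0.
  have -> : p + p / (p + `|q|) * q = p / (p + `|q|) * (p + `|q| + q).
    by field; rewrite lt0r_neq0.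
  rewrite mulr_gt0 ?divr_gt0 //.
  by have := ler_norm (- q); rewrite normrN; lra.
have dir_ab (p q r : R * R) (l : R) : cr p (p.1 + l * q.1, p.2 + l * q.2) = l * cr p q /\
    cr (p.1 + l * q.1, p.2 + l * q.2) r = cr p r + l * cr q r.
  by rewrite /cr /=; split; ring.
case: (ltrgtP (cr (kdir phi i j) (kdir phi i k)) 0) (nd f) => // [c0|c0] _.
  have c0' : cr (kdir phi i j) (kdir phi i k') < 0.
    by rewrite lt_neqAle nd //= -(nmulr_rge0 _ c0).
  have ck : 0 < cr (kdir phi i k) (kdir phi i j) by rewrite crC oppr_gt0.
  have ck' : 0 < cr (kdir phi i k') (kdir phi i j) by rewrite crC oppr_gt0.
  have [l l0 hl] := small _ (cr (kdir phi i k') (kdir phi i k)) ck'.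
  set a := kdir phi i j in hl *; set b := kdir phi i k in hl *.
  have [h1 h2] := dir_ab a b b l; have [_ h3] := dir_ab a b (kdir phi i k') l.
  have [] := @cones_disjoint R V F phi cF gphi hphi i k j k' j
    (a.1 + l * b.1, a.2 + l * b.2) g g' ck ck'.
  - by rewrite crC h2 crvv mulr0 addr0 -crC.
  - by rewrite crC h1 -mulrN -crC mulr_gt0.
  - by rewrite crC h3 opprD -mulrN -!crC.
  - by rewrite crC h1 -mulrN -crC mulr_gt0.
  by move=> e; rewrite e eqxx in kk'.
have c0' : 0 < cr (kdir phi i j) (kdir phi i k').
  by rewrite lt0r nd //= -(pmulr_rge0 _ c0).
have [l l0 hl] := small _ (cr (kdir phi i k) (kdir phi i k')) c0'.
set a := kdir phi i j in c0 c0' hl *; set b := kdir phi i k in c0 c0' hl *.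
have [h1 h2] := dir_ab a b b l; have [_ h3] := dir_ab a b (kdir phi i k') l.
have [] := @cones_disjoint R V F phi cF gphi hphi i j k j k'
  (a.1 + l * b.1, a.2 + l * b.2) f f' c0 c0'.
- by rewrite h1 mulr_gt0.
- by rewrite h2 crvv mulr0 addr0.
- by rewrite h1 mulr_gt0.
- by rewrite h3.
by move=> _ e; rewrite e eqxx in kk'.
Qed.

(** A compact disk is covered by finitely many open stars of vertices, and a vertex lies in no open
    star but its own. *)
Lemma finite_vertices (r : R) : r < 1 ->
  exists s : seq V, forall v, sqn (vpt phi v) <= r -> v \in s.
Proof.
move=> r1.
have [||s hs] := @compact_finite_cover _ V _ (fun v => phi @` star [:: v]) (@compact_disk R r).
- by move=> v; exact: star_open.
- move=> z zr.
  have z1 : diskD z by exact: le_lt_trans zr r1.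
  have [im _ _ _] := hphi; move: z1; rewrite -im => -[x rx <-].
  move: (rx) => [a [b [c [f [st [[s1 [s2 s3]] ex]]]]]].
  have [[ab bc ac] _] := complex_faces cF f.
  suff [v xv] : exists v, 0 < x v.
    by exists v, x => //; split => // w; rewrite inE => /eqP->.
  have [p1|n1] := ltP 0 st.1; first by exists a; rewrite ex face_pt_i.
  have [p2|n2] := ltP 0 st.2.
    by exists b; rewrite ex /face_pt eq_sym (negbTE ab) eqxx.
  exists c; rewrite ex /face_pt eq_sym (negbTE ac) [c == b]eq_sym (negbTE bc) eqxx.
  by lra.
exists s => v vr; have [w ws [x [rx xw] e]] := hs _ vr.
have {}e : x = vtx R v.
  by apply: (phi_inj hphi) => //; [exact: realization_vtx|congr klein].
have := xw w (mem_head _ _); rewrite e /vtx; case: eqP => [<- //|_].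
by rewrite ltxx.
Qed.

End Stars.

(** * Links of vertices *)

Lemma kmap_surj (R : realType) (z d : R * R) : diskD z -> exists h, kmap z h = d.
Proof.
move=> z1; have n1 := disk_neq0 z1; have n2 := lt0r_neq0 (sqn1_gt0 z).
exists (((1 + sqn z) * d.1 - 2 * dt z d * z.1) / ((1 - sqn z) * (1 + sqn z)),
        ((1 + sqn z) * d.2 - 2 * dt z d * z.2) / ((1 - sqn z) * (1 + sqn z))).
case: d => d1 d2; case: z z1 n1 n2 => x y _.
rewrite /kmap /dt /sqn /= => n1 n2.
by congr pair; field; rewrite n1 n2.
Qed.

Lemma cr_scall (R : realType) (c : R) (v w : R * R) : cr (scal c v) w = c * cr v w.
Proof. by rewrite /cr /scal /=; ring. Qed.

Lemma spoke_cr_dir (R : realType) (z w : R * R) : diskD z -> diskD w -> w != z ->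
  exists2 c, 0 < c & forall h,
    cr (spoke 1 z w) (kmap z h) = c * cr (vsub (klein w) (klein z)) h.
Proof.
move=> z1 w1 wz; have sw := sqn_vsub_gt0 wz.
have n1 : 0 < 1 - sqn z by rewrite subr_gt0.
exists ((1 + sqn w) / (2 * sqn (vsub w z) * (1 - sqn z)) * ((1 - sqn z) * (1 + sqn z))).
  by rewrite mulr_gt0 ?divr_gt0 ?mulr_gt0 // sqn1_gt0.
by move=> h; rewrite spoke_klein // cr_scall cr_kmap mulrA.
Qed.

Lemma spoke_cr (R : realType) (z w w' : R * R) :
  diskD z -> diskD w -> diskD w' -> w != z -> w' != z ->
  exists2 c, 0 < c & cr (spoke 1 z w) (spoke 1 z w') =
    c * cr (vsub (klein w) (klein z)) (vsub (klein w') (klein z)).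
Proof.
move=> z1 w1 w1' wz wz'; have sw := sqn_vsub_gt0 wz'.
have n1 : 0 < 1 - sqn z by rewrite subr_gt0.
have [c c0 e] := spoke_cr_dir z1 w1 wz.
exists ((1 + sqn w') / (2 * sqn (vsub w' z) * (1 - sqn z)) * c).
  by rewrite mulr_gt0 // ?divr_gt0 ?mulr_gt0 // sqn1_gt0.
by rewrite [spoke 1 z w']spoke_klein // cr_scalr e mulrA.
Qed.

Lemma vangleC (R : realType) (v w : R * R) : vangle v w = vangle w v.
Proof.
rewrite /vangle [sqn v * _]mulrC (_ : dt v w = dt w v) //.
by rewrite /dt; ring.
Qed.

Lemma bounded_uniq_finite (V : eqType) (P : V -> Prop) (n : nat) :
  (forall s : seq V, uniq s -> (forall v, v \in s -> P v) -> (size s <= n)%N) ->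
  exists2 s : seq V, uniq s & forall v, v \in s <-> P v.
Proof.
elim: n => [|n IH] bnd.
  exists [::] => // v; split => // Pv.
  suff : (size [:: v] <= 0)%N by [].
  by apply: bnd => // u; rewrite inE => /eqP->.
have [[s [us [Ps sn]]]|none] := pselect (exists s : seq V,
    uniq s /\ (forall v, v \in s -> P v) /\ size s = n.+1).
  exists s => // v; split; first exact: Ps.
  move=> Pv; apply: contraT => vs.
  suff : (size (v :: s) <= n.+1)%N by rewrite /= sn ltnn.
  apply: bnd; first by rewrite /= vs.
  by move=> u; rewrite inE => /orP[/eqP->|/Ps].
apply: IH => s us Ps; rewrite leqNgt; apply/negP => ns; apply: none.
by exists s; split => //; split => //; apply/eqP; rewrite eqn_leq ns bnd.
Qed.

(* [lk] lists the neighbours of [i] and [nx] turns once around them. *)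
Definition link_cycle (V : eqType) (F : V -> V -> V -> Prop) (i : V)
    (lk : seq V) (nx : V -> V) : Prop :=
  [/\ uniq lk, perm_eq (map nx lk) lk, {in lk, forall j, F i j (nx j)},
     (forall j k, F i j k -> (j \in lk /\ k = nx j) \/ (k \in lk /\ j = nx k)) &
     {in lk, forall j, nx (nx j) != j}].

Section Link.
Variables (R : realType) (V : eqType) (F : V -> V -> V -> Prop).
Variables (phi : (V -> R) -> R * R) (eps : R).
Hypotheses (cF : is_complex F) (gphi : geodesic_map F phi) (hphi : homeo_onto_H2 F phi).
Hypotheses (eps0 : 0 < eps) (aphi : angles_ge F phi eps).

Let z := vpt phi.
Let z1 : forall v, diskD (z v) := vpt_disk cF hphi.

Definition edS (i j : V) : R := dS (vpt phi i) (vpt phi j).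
Definition espoke (i j : V) : R * R := spoke 1 (vpt phi i) (vpt phi j).
Definition eangle (i j k : V) : R :=
  hub_angle (scal (hubc 1 (vpt phi i)) (vpt phi i))
    (invp (vpt phi i) (vpt phi j)) (invp (vpt phi i) (vpt phi k)).

Lemma vpt_neq (i j : V) : i != j -> vpt phi i != vpt phi j.
Proof. by apply: contra_neq => /(vpt_inj cF hphi). Qed.

Lemma edS_gt0 (i j : V) : i != j -> 0 < edS i j.
Proof. by move=> ij; apply: dS_gt0 => //; exact: vpt_neq. Qed.

Lemma eangleE (i j k : V) : i != j -> i != k ->
  eangle i j k = hangle (vpt phi i) (vpt phi j) (vpt phi k).
Proof. by move=> ij ik; rewrite hangle_hub //; apply: vpt_neq; rewrite eq_sym. Qed.

Lemma eangle_hcos (i j k : V) : i != j -> i != k ->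
  eangle i j k = acos (hcos (edS i j) (edS i k) (edS j k)).
Proof. by move=> ij ik; rewrite eangleE // hangle_hcos. Qed.

Lemma face_heron (i j k : V) : F i j k ->
  [/\ eps < pi / 2,
     eps ^+ 2 * (edS i j * edS i k * (1 + edS i j) * (1 + edS i k))
       <= heron (edS i j) (edS i k) (edS j k) &
     0 < heron (edS i j) (edS i k) (edS j k)].
Proof.
move=> f; have [[ij jk ik] [f1 f2 f3 f4 f5]] := complex_faces cF f.
have s0 := edS_gt0 ij; have t0 := edS_gt0 ik; have u0 := edS_gt0 jk.
have ji : vpt phi j != vpt phi i by rewrite vpt_neq // eq_sym.
have ki : vpt phi k != vpt phi i by rewrite vpt_neq // eq_sym.
have h0 : 0 <= heron (edS i j) (edS i k) (edS j k).
  have h := heron_hub (z1 i) (z1 j) (z1 k) ji ki.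
  have c0 : 0 < hubc 1 (z i).
    by rewrite divr_gt0 ?exprn_gt0 // disk_gt0.
  have : 0 <= hubc 1 (z i) ^+ 4 * heron (edS i j) (edS i k) (edS j k)
       / (edS i j * edS i k) ^+ 2.
    by rewrite -h mulr_ge0 // sqr_ge0.
  rewrite pmulr_lge0 ?invr_gt0 ?exprn_gt0 ?(mulr_gt0 s0 t0) //.
  by rewrite pmulr_rge0 // exprn_gt0.
have a1 : eps <= acos (hcos (edS i j) (edS i k) (edS j k)).
  by rewrite -eangle_hcos // eangleE //; exact: aphi.
have a2 : eps <= acos (hcos (edS i j) (edS j k) (edS i k)).
  rewrite /edS (dSC (vpt phi i) (vpt phi j)) -eangle_hcos // 1?eq_sym // eangleE // 1?eq_sym //.
  exact: aphi.
have a3 : eps <= acos (hcos (edS i k) (edS j k) (edS i j)).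
  rewrite /edS (dSC (vpt phi i) (vpt phi k)) (dSC (vpt phi j) (vpt phi k)).
  rewrite -eangle_hcos // 1?eq_sym // eangleE // 1?eq_sym //.
  exact: aphi.
have [e1 e2] := heron_sin_bound eps0 s0 t0 u0 h0 a1 a2 a3.
by split => //; exact: heron_gt0 eps0 s0 t0 u0 h0 a1 a2 a3.
Qed.

Lemma espoke_cr_neq0 (i j k : V) : F i j k -> cr (espoke i j) (espoke i k) != 0.
Proof.
move=> f; have [[ij jk ik] _] := complex_faces cF f.
have [_ _ h] := face_heron f.
have ji : vpt phi j != vpt phi i by rewrite vpt_neq // eq_sym.
have ki : vpt phi k != vpt phi i by rewrite vpt_neq // eq_sym.
have e := heron_hub (z1 i) (z1 j) (z1 k) ji ki.
have c0 : 0 < hubc 1 (z i) by rewrite divr_gt0 ?exprn_gt0 // disk_gt0.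
apply/eqP => k0; move: e; rewrite -/(espoke i j) -/(espoke i k) k0 expr0n /= mulr0.
move=> /esym/eqP; rewrite gt_eqF //.
apply: divr_gt0; first by apply: mulr_gt0 => //; exact: exprn_gt0.
by apply: exprn_gt0; apply: mulr_gt0; exact: edS_gt0.
Qed.

Lemma espoke_cr (i j k : V) : i != j -> i != k -> exists2 c, 0 < c &
  cr (espoke i j) (espoke i k) = c * cr (kdir phi i j) (kdir phi i k).
Proof.
by move=> ij ik; apply: spoke_cr => //; rewrite vpt_neq // eq_sym.
Qed.

Lemma espoke_cr_dir (i j : V) : i != j -> exists2 c, 0 < c & forall h,
  cr (espoke i j) (kmap (vpt phi i) h) = c * cr (kdir phi i j) h.
Proof. by move=> ij; apply: spoke_cr_dir => //; rewrite vpt_neq // eq_sym. Qed.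

Lemma kdir_nd (i j k : V) : F i j k -> cr (kdir phi i j) (kdir phi i k) != 0.
Proof.
move=> f; have [[ij jk ik] _] := complex_faces cF f.
have := espoke_cr_neq0 f; have [c c0 ->] := espoke_cr ij ik.
by rewrite mulf_eq0 negb_or => /andP[].
Qed.

Lemma espoke_opposite (i j k k' : V) : F i j k -> F i j k' -> k != k' ->
  cr (espoke i j) (espoke i k) * cr (espoke i j) (espoke i k') < 0.
Proof.
move=> f f' kk'; have [[ij jk ik] _] := complex_faces cF f.
have [[_ _ ik'] _] := complex_faces cF f'.
have [c c0 ->] := espoke_cr ij ik; have [c' c0' ->] := espoke_cr ij ik'.
rewrite mulrACA pmulr_rlt0 ?mulr_gt0 //.
exact: edge_opposite_sides cF gphi hphi kdir_nd _ _ _ _ f f' kk'.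
Qed.

Lemma eangle_vangle (i j k : V) : eangle i j k = vangle (espoke i j) (espoke i k).
Proof. exact: hub_angleE. Qed.

Lemma eangle_sum_le (i : V) (s : seq V) (nx : V -> V) : uniq s ->
  {in s, forall j, F i j (nx j) /\ 0 < cr (espoke i j) (espoke i (nx j))} ->
  \sum_(j <- s) eangle i j (nx j) <= 2 * pi.
Proof.
move=> us h; under eq_bigr do rewrite eangle_vangle.
apply: hub_angle_sum_le => // [j js|j j' js js' d]; first by case: (h j js).
have [f c0] := h j js; have [f' c0'] := h j' js'.
have [[ij _ ik] _] := complex_faces cF f; have [[ij' _ ik'] _] := complex_faces cF f'.
have [w <-] := kmap_surj d (z1 i).
move: c0 c0'.
have [c cp ->] := espoke_cr ij ik; have [c' cp' ->] := espoke_cr ij' ik'.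
have [a ap ea] := espoke_cr_dir ij; have [a' ap' ea'] := espoke_cr_dir ij'.
have [b bp eb] := espoke_cr_dir ik; have [b' bp' eb'] := espoke_cr_dir ik'.
rewrite ![cr (kmap _ _) _]crC ea ea' eb eb' -!mulrN -!crC !pmulr_rgt0 // => q1 q2 q3 q4 q5 q6.
by have [] := @cones_disjoint R V F phi cF gphi hphi i j (nx j) j' (nx j') w f f' q1 q2 q3 q4 q5 q6.
Qed.

(** [nx j] is the apex of the face on the positive side of the edge from [i] to [j]: it exists by
    [edge_two_sides] and is unique by [edge_opposite_sides]. Uniqueness on the negative side makes
    [nx] injective, hence a permutation of the finite link. *)
Lemma exists_link_cycle (i : V) : exists lk nx, link_cycle F i lk nx /\
  {in lk, forall j, 0 < cr (espoke i j) (espoke i (nx j))}.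
Proof.
have /choice[nx nxP] : forall j, exists k, (exists k', F i j k') ->
    F i j k /\ 0 < cr (espoke i j) (espoke i k).
  move=> j; have [[k0 f]|none] := pselect (exists k', F i j k'); last by exists j.
  have [c0|c0] := ltP 0 (cr (espoke i j) (espoke i k0)); first by exists k0.
  have [k' f' neg] := edge_two_sides cF gphi hphi kdir_nd f.
  exists k' => _; split => //.
  have [[ij jk ik] _] := complex_faces cF f; have [[_ _ ik'] _] := complex_faces cF f'.
  have := espoke_cr_neq0 f; move: c0.
  have [c cp ->] := espoke_cr ij ik; have [c' cp' ->] := espoke_cr ij ik'.
  rewrite pmulr_rgt0 // pmulr_rle0 // mulf_eq0 negb_or => n0 /andP[_ nn].
  by rewrite -(nmulr_llt0 _ (_ : cr (kdir phi i j) (kdir phi i k0) < 0)) // lt_neqAle nn.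
(* The degree is finite because angles of at least [eps] in disjoint cones add up to at most
   [2 pi]. *)
pose n := Num.bound (2 * pi / eps).
have [lk ulk lkP] : exists2 s : seq V, uniq s & forall v, v \in s <-> exists k, F i v k.
  apply: (@bounded_uniq_finite _ _ n) => s us Ps.
  have sum := eangle_sum_le us (fun j js => nxP j (Ps j js)).
  rewrite -(ler_nat R); apply: (@le_trans _ _ (2 * pi / eps)); last first.
    apply: ltW; apply: archi_boundP.
    by rewrite divr_ge0 ?mulr_ge0 ?pi_ge0 // ltW.
  rewrite ler_pdivlMr //; apply: le_trans sum.
  rewrite (_ : (size s)%:R * eps = \sum_(j <- s) eps); last first.
    by rewrite big_const_seq count_predT iter_addr_0 mulr_natl.
  rewrite big_seq [leRHS]big_seq; apply: ler_sum => j js.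
  have [f _] := nxP j (Ps j js); have [[ij _ ik] _] := complex_faces cF f.
  by rewrite eangleE //; exact: aphi.
have nx2 j : j \in lk -> F i j (nx j) /\ 0 < cr (espoke i j) (espoke i (nx j)).
  by move=> /lkP; exact: nxP.
have lk1 j k : F i j k -> j \in lk by move=> f; apply/lkP; exists k.
have rot j k : F i j k -> F i k j by move=> f; have [_ []] := complex_faces cF f.
have nxlk j : j \in lk -> nx j \in lk.
  by move=> /nx2[f _]; apply: lk1 (rot _ _ f).
have uniq_pos j k k' : F i j k -> F i j k' -> 0 < cr (espoke i j) (espoke i k) ->
    0 < cr (espoke i j) (espoke i k') -> k = k'.
  move=> f f' p p'; apply: contraTeq (mulr_gt0 p p') => kk'.
  by rewrite -leNgt ltW // espoke_opposite.
have uniq_neg j k k' : F i j k -> F i j k' -> cr (espoke i j) (espoke i k) < 0 ->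
    cr (espoke i j) (espoke i k') < 0 -> k = k'.
  move=> f f' p p'; have pp : 0 < cr (espoke i j) (espoke i k) * cr (espoke i j) (espoke i k').
    by rewrite nmulr_rgt0.
  apply: contraTeq pp => kk'.
  by rewrite -leNgt ltW // espoke_opposite.
have injnx : {in lk &, injective nx}.
  move=> j j' /nx2[f p] /nx2[f' p'] e.
  apply: (uniq_neg (nx j)); [exact: rot|by rewrite e; exact: rot|..].
    by rewrite crC oppr_lt0.
  by rewrite e crC oppr_lt0.
exists lk, nx; split; last by move=> j /nx2[].
split => //.
- have um : uniq (map nx lk) by rewrite map_inj_in_uniq.
  apply: uniq_perm => //.
  have sub : {subset map nx lk <= lk} by move=> k /mapP[j jlk ->]; exact: nxlk.
  by have [] := uniq_min_size um sub (_ : (size lk <= size (map nx lk))%N); rewrite ?size_map.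
- by move=> j /nx2[].
- move=> j k f; have jlk := lk1 _ _ f; have klk := lk1 _ _ (rot _ _ f).
  have [fj pj] := nx2 j jlk; have [fk pk] := nx2 k klk.
  case: (ltrgtP (cr (espoke i j) (espoke i k)) 0) (espoke_cr_neq0 f) => // [neg|pos] _.
    right; split => //; apply: (uniq_pos k) => //; first exact: rot.
    by rewrite crC oppr_gt0.
  by left; split => //; exact: (uniq_pos j).
- move=> j jlk; have [f p] := nx2 j jlk; have [f' p'] := nx2 _ (nxlk j jlk).
  apply/eqP => e; move: p'; rewrite e crC oppr_gt0 => p'.
  by have := lt_trans p p'; rewrite ltxx.
Qed.

(** The cycle may have been built from another map, so the sign of each face is unknown here; every
    sector is oriented by its own sign before the covering argument. *)
Lemma eangle_sum_ge (i : V) (lk : seq V) (nx : V -> V) : link_cycle F i lk nx ->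
  2 * pi <= \sum_(j <- lk) eangle i j (nx j).
Proof.
move=> [ulk pn fnx all _].
pose pos j := 0 < cr (espoke i j) (espoke i (nx j)).
pose v j := if pos j then espoke i j else espoke i (nx j).
pose w j := if pos j then espoke i (nx j) else espoke i j.
have -> : \sum_(j <- lk) eangle i j (nx j) = \sum_(j <- lk) vangle (v j) (w j).
  apply: eq_bigr => j _; rewrite eangle_vangle /v /w; case: (pos j) => //.
  by rewrite vangleC.
apply: hub_angle_sum_ge => [j jlk|d].
  rewrite /v /w; case: ifP => // /negbT; rewrite /pos -leNgt => h.
  by rewrite crC oppr_gt0 lt_neqAle h (espoke_cr_neq0 (fnx j jlk)).
have [h <-] := kmap_surj d (z1 i).
have [j [k [f c0 h1 h2]]] := cones_cover cF gphi hphi kdir_nd i h.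
have [[ij _ ik] _] := complex_faces cF f.
have [c cp ec] := espoke_cr ij ik.
have [a ap ea] := espoke_cr_dir ij; have [b bp eb] := espoke_cr_dir ik.
have p1 : 0 < cr (espoke i j) (espoke i k) by rewrite ec mulr_gt0.
have p2 : 0 <= cr (espoke i j) (kmap (vpt phi i) h) by rewrite ea mulr_ge0 // ltW.
have p3 : 0 <= cr (kmap (vpt phi i) h) (espoke i k).
  by rewrite crC eb -mulrN -crC mulr_ge0 // ltW.
have [[jlk ek]|[klk ej]] := all j k f.
  by exists j => //; rewrite /v /w /pos -ek p1.
have nk : (0 < cr (espoke i k) (espoke i j)) = false.
  by rewrite crC oppr_gt0 ltNge (ltW p1).
by exists k => //; rewrite /v /w /pos -ej nk.
Qed.

End Link.

(** * The maximum principle *)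

Lemma seq_argmax (R : realType) (T : eqType) (f : T -> R) (s : seq T) (x : T) :
  x \in s -> exists2 m, m \in s & forall y, y \in s -> f y <= f m.
Proof.
elim: s x => // a s IH x _.
case: s IH => [|b s] IH.
  by exists a; rewrite ?mem_head // => y; rewrite inE => /eqP->.
have [m ms hm] := IH b (mem_head _ _).
have [am|ma] := leP (f a) (f m).
  exists m; first by rewrite inE ms orbT.
  by move=> y; rewrite inE => /orP[/eqP->|/hm].
exists a; first by rewrite mem_head.
move=> y; rewrite inE => /orP[/eqP-> //|/hm h].
exact: le_trans h (ltW ma).
Qed.

(** A sine law: the lower bound from the angle between [s] and [t] is compared with the trivial
    bound on the sine at the vertex between [s] and [u]. The 8 is [4 (1 + u)] at [u = 1]. *)
Lemma heron_sides (R : realType) (e s t u : R) : 0 < s -> 0 < t -> 0 < u -> u <= 1 ->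
  e ^+ 2 * (s * t * (1 + s) * (1 + t)) <= heron s t u -> e ^+ 2 * t <= 8 * u.
Proof.
move=> s0 t0 u0 u1 h.
have hu : heron s t u <= 4 * s * u * (1 + s) * (1 + u).
  by rewrite heronCA /heron gerBl sqr_ge0.
have {}h := le_trans h hu.
have ss : 0 < s * (1 + s) by rewrite mulr_gt0 // addr_gt0.
have : (s * (1 + s)) * (e ^+ 2 * (t * (1 + t))) <= (s * (1 + s)) * (4 * (u * (1 + u))).
  by move: h; lra.
rewrite ler_pM2l // => {}h.
have h1 : e ^+ 2 * t <= e ^+ 2 * (t * (1 + t)).
  by rewrite ler_wpM2l ?sqr_ge0 // mulrDr mulr1 lerDl mulr_ge0 ?(ltW t0).
have h2 : u * u <= u by rewrite ger_pMl.
by lra.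
Qed.

(** The height [1 - |z|^2] is 2-Lipschitz on the disk, so heights [x], [y] satisfy
    [(y - x)^2 <= 4 S x y <= x y], which fails for [y > 4 x]. *)
Lemma height_ratio (R : realType) (a b : R * R) : diskD a -> diskD b ->
  dS a b <= 1 / 4 -> 1 - sqn b <= 4 * (1 - sqn a).
Proof.
move=> a1 b1 S1.
have x0 : 0 < 1 - sqn a by rewrite subr_gt0.
have y0 : 0 < 1 - sqn b by rewrite subr_gt0.
have wE : sqn (vsub a b) = dS a b * ((1 - sqn a) * (1 - sqn b)).
  by rewrite /dS divfK // lt0r_neq0 // mulr_gt0.
have h1 : (sqn a - sqn b) ^+ 2 <= 4 * sqn (vsub a b).
  have := lagrange2 (a.1 + b.1, a.2 + b.2) (vsub a b).
  have -> : dt (a.1 + b.1, a.2 + b.2) (vsub a b) = sqn a - sqn b.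
    by rewrite /dt /sqn /vsub /=; ring.
  have h2 : sqn (a.1 + b.1, a.2 + b.2) <= 4.
    have : 0 <= sqn (vsub a b) := sqn_ge0 _.
    have : sqn (a.1 + b.1, a.2 + b.2) + sqn (vsub a b) = 2 * sqn a + 2 * sqn b.
      by rewrite /sqn /vsub /=; ring.
    by move: x0 y0; lra.
  have := sqr_ge0 (cr (a.1 + b.1, a.2 + b.2) (vsub a b)).
  have := ler_wpM2r (sqn_ge0 (vsub a b)) h2.
  by lra.
rewrite leNgt; apply/negP => h.
move: h1; rewrite wE; apply/negP; rewrite -ltNge.
rewrite (_ : sqn a - sqn b = (1 - sqn b) - (1 - sqn a)); last by ring.
move: (1 - sqn a) (1 - sqn b) x0 y0 h (dS a b) S1 => x y x0 y0 h S S1.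
have h3 : S * (x * y) <= 1 / 4 * (x * y) by rewrite ler_wpM2r // ltW // mulr_gt0.
have h4 : 4 * x * y < y * y by rewrite ltr_pM2r.
have h5 : 9 / 16 * (y * y) < (y - x) ^+ 2.
  have -> : 9 / 16 * (y * y) = (3 / 4 * y) ^+ 2 by field.
  by rewrite ltr_pXn2r // ?nnegrE; lra.
by have := mulr_gt0 y0 y0; lra.
Qed.

(** The fourth inequality on [E] says that the dilated factor at [a] exceeds 1. It replaces the
    height [1 - |a|^2] by [E X / r] in [|b - a|^2 <= 4 S (1 - |a|^2)^2], so the small quantity
    [E^2 S] controls the edge relative to [X]. The step to [b] then uses up only a fraction of
    [X]. *)
Lemma spoke_length_bound (R : realType) (a b : R * R) (r e E : R) :
  diskD a -> diskD b -> 0 < e -> e <= 2 -> 0 < E -> 1 < r ->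
  r ^+ 2 * sqn a < 1 -> dS a b <= 1 / 4 ->
  r * (1 - sqn a) < E * (1 - r ^+ 2 * sqn a) ->
  E ^+ 2 * dS a b <= e ^+ 2 / 2 ^+ 20 ->
  r ^+ 2 * sqn (vsub b a) <= e ^+ 2 / 2 ^+ 18 * (1 - r ^+ 2 * sqn a) ^+ 2 /\
  r ^+ 2 * sqn b < 1.
Proof.
move=> a1 b1 e0 e2 E0 r1 ra S1 hE hS.
set X := 1 - r ^+ 2 * sqn a in hE *.
have X0 : 0 < X by rewrite subr_gt0.
have x0 : 0 < 1 - sqn a by rewrite subr_gt0.
have y0 : 0 < 1 - sqn b by rewrite subr_gt0.
have r0 : 0 < r by lra.
have wE : sqn (vsub b a) = dS a b * ((1 - sqn a) * (1 - sqn b)).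
  by rewrite sqn_vsubC /dS divfK // lt0r_neq0 // mulr_gt0.
have hr := height_ratio a1 b1 S1.
have S0 := dS_ge0 a1 b1.
have h1 : sqn (vsub b a) <= 4 * dS a b * (1 - sqn a) ^+ 2.
  rewrite wE (_ : 4 * dS a b * (1 - sqn a) ^+ 2 =
    dS a b * ((1 - sqn a) * (4 * (1 - sqn a)))); last by ring.
  by rewrite ler_wpM2l // ler_wpM2l // ltW.
have h2 : r ^+ 2 * (1 - sqn a) ^+ 2 <= E ^+ 2 * X ^+ 2.
  by rewrite -!exprMn ler_pXn2r ?nnegrE ?mulr_ge0 // ltW.
have hw : r ^+ 2 * sqn (vsub b a) <= e ^+ 2 / 2 ^+ 18 * X ^+ 2.
  apply: (@le_trans _ _ (r ^+ 2 * (4 * dS a b * (1 - sqn a) ^+ 2))).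
    by rewrite ler_wpM2l ?sqr_ge0.
  apply: (@le_trans _ _ (4 * dS a b * (E ^+ 2 * X ^+ 2))).
    by rewrite mulrCA ler_wpM2l // mulr_ge0.
  have -> : e ^+ 2 / 2 ^+ 18 * X ^+ 2 = 4 * (e ^+ 2 / 2 ^+ 20) * X ^+ 2 by field.
  have -> : 4 * dS a b * (E ^+ 2 * X ^+ 2) = 4 * (E ^+ 2 * dS a b) * X ^+ 2 by ring.
  by rewrite ler_wpM2r ?sqr_ge0 // ler_pM2l.
split=> //.
have X1 : X <= 1 by rewrite /X gerBl mulr_ge0 ?sqr_ge0 // sqn_ge0.
have e4 : e ^+ 2 <= 4 by rewrite (_ : 4 = 2 ^+ 2 :> R); [rewrite ler_pXn2r ?nnegrE // ltW|ring].
have hw2 : r ^+ 2 * sqn (vsub b a) <= (X / 16) ^+ 2.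
  apply: le_trans hw _; rewrite (_ : (X / 16) ^+ 2 = 1 / 2 ^+ 8 * X ^+ 2); last by field.
  by rewrite ler_wpM2r ?sqr_ge0 //; lra.
have hd : r ^+ 2 * dt a (vsub b a) <= X / 16.
  apply: ler_normlW; rewrite -[leRHS]ger0_norm; last by rewrite divr_ge0 // ltW.
  rewrite -(@ler_pXn2r _ 2) ?nnegrE // !real_normK ?num_real //.
  apply: le_trans hw2.
  have -> : (r ^+ 2 * dt a (vsub b a)) ^+ 2 = r ^+ 2 * (r ^+ 2 * dt a (vsub b a) ^+ 2).
    by ring.
  rewrite ler_wpM2l ?sqr_ge0 //.
  apply: (@le_trans _ _ (r ^+ 2 * (sqn a * sqn (vsub b a)))).
    by rewrite ler_wpM2l ?sqr_ge0 // -lagrange2 lerDl sqr_ge0.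
  by rewrite mulrA ler_piMl ?sqn_ge0 // ltW.
have X2 : (X / 16) ^+ 2 <= X / 16.
  by rewrite expr2 ger_pMl ?divr_gt0 //; lra.
have -> : sqn b = sqn a + 2 * dt a (vsub b a) + sqn (vsub b a).
  by rewrite /sqn /dt /vsub /=; ring.
have hX : r ^+ 2 * sqn a = 1 - X by rewrite /X; ring.
by lra.
Qed.

Lemma disk_scal (R : realType) (r : R) (x : R * R) :
  0 < 1 - r ^+ 2 * sqn x -> diskD (scal r x).
Proof. by rewrite subr_gt0 -sqn_scal. Qed.

Lemma scal_inj (R : realType) (r : R) (x y : R * R) : r != 0 ->
  scal r x = scal r y -> x = y.
Proof.
by case: x => a b; case: y => c d r0 [/(mulfI r0)-> /(mulfI r0)->].
Qed.

Section MaximumPrinciple.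
Variables (R : realType) (V : eqType) (F : V -> V -> V -> Prop).
Variables (phi psi : (V -> R) -> R * R) (eps : R).
Hypotheses (cF : is_complex F) (eps0 : 0 < eps).
Hypotheses (gphi : geodesic_map F phi) (hphi : homeo_onto_H2 F phi).
Hypotheses (dphi : delaunay F phi) (aphi : angles_ge F phi eps).
Hypotheses (gpsi : geodesic_map F psi) (hpsi : homeo_onto_H2 F psi).
Hypotheses (dpsi : delaunay F psi) (apsi : angles_ge F psi eps).

(** The two neighbouring faces lie on opposite sides of the edge and the claim is symmetric in them,
    so an unknown orientation of [psi] is absorbed by exchanging [k] and [k']. *)
Lemma espoke_convex (i j k k' : V) (a a' : R) : F i j k -> F i j k' -> k != k' ->
  0 < a -> a ^+ 2 = sqn (vsub (invp (vpt psi i) (vpt psi k)) (invp (vpt psi i) (vpt psi j))) ->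
  0 < a' -> a' ^+ 2 = sqn (vsub (invp (vpt psi i) (vpt psi k')) (invp (vpt psi i) (vpt psi j))) ->
  0 <= (a ^+ 2 + sqn (espoke psi i j) - sqn (espoke psi i k)) / a
     + (a' ^+ 2 + sqn (espoke psi i j) - sqn (espoke psi i k')) / a'.
Proof.
move=> f f' kk' a0 aE a'0 a'E.
wlog c0 : k k' a a' f f' kk' a0 aE a'0 a'E / 0 < cr (espoke psi i j) (espoke psi i k).
  move=> H; have [|c0] := ltP 0 (cr (espoke psi i j) (espoke psi i k)); first exact: H.
  rewrite addrC; apply: H => //; first by rewrite eq_sym.
  have := espoke_opposite cF gpsi hpsi eps0 apsi f f' kk'.
  rewrite nmulr_rlt0 // lt_neqAle c0 andbT.
  exact: espoke_cr_neq0 cF hpsi eps0 apsi _ _ _ f.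
have c0' : 0 < cr (espoke psi i k') (espoke psi i j).
  rewrite crC oppr_gt0 -(pmulr_rlt0 _ c0).
  exact: espoke_opposite cF gpsi hpsi eps0 apsi _ _ _ _ f f' kk'.
have [[ij jk ik] _] := complex_faces cF f; have [[_ _ ik'] _] := complex_faces cF f'.
have zd := vpt_disk cF hpsi.
have ne v : i != v -> vpt psi v != vpt psi i.
  by move=> iv; apply: (vpt_neq cF hpsi); rewrite eq_sym.
apply: hub_convex => //.
- rewrite /espoke !vsub_spoke; apply: delaunay_convex => //; try exact: ne.
  exact: dpsi.
- by rewrite aE /espoke vsub_spoke.
- by rewrite a'E /espoke vsub_spoke.
Qed.

Lemma local_maximum (i : V) (r : R) (U : V -> R) :
  let z := vpt phi in
  1 < r -> 0 < 1 - r ^+ 2 * sqn (z i) -> 1 < U i ->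
  (forall j k, F i j k -> [/\ 0 < 1 - r ^+ 2 * sqn (z j), 0 < U j, U j <= U i &
     hubc r (z i) ^+ 2 * sqn (vsub (z j) (z i)) <= eps ^+ 2 / 1024]) ->
  (forall j k, F i j k ->
     edS psi i j = U i * U j * dS (scal r (z i)) (scal r (z j)) /\
     edS psi j k = U j * U k * dS (scal r (z j)) (scal r (z k))) ->
  False.
Proof.
move=> z r1 ri Ui nb conf.
have [lk [nx [lc pos]]] := exists_link_cycle cF gphi hphi eps0 aphi i.
have [ulk pn fnx all nx2] := lc.
have r0 : 0 < r by lra.
have zd := vpt_disk cF hphi; have zd' := vpt_disk cF hpsi.
have ne v : i != v -> z v != z i.
  by move=> iv; apply: (vpt_neq cF hphi); rewrite eq_sym.
have ne' v : i != v -> vpt psi v != vpt psi i.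
  by move=> iv; apply: (vpt_neq cF hpsi); rewrite eq_sym.
have rot j k : F i j k -> F i k j by move=> f; have [_ []] := complex_faces cF f.
have fd j k : F i j k -> [/\ i != j, j != k & i != k].
  by move=> f; have [] := complex_faces cF f.
have nxlk j : j \in lk -> nx j \in lk by move=> jlk; rewrite -(perm_mem pn) map_f.
pose c := hubc r (z i).
have c0 : 0 < c by rewrite divr_gt0 // exprn_gt0.
pose p j := invp (z i) (z j).
pose a j := Num.sqrt (sqn (vsub (p j) (p (nx j)))).
pose x0 j := sqn (spoke r (z i) (z j)).
pose c' := hubc 1 (vpt psi i).
have c'0 : 0 < c' by rewrite divr_gt0 ?exprn_gt0 // disk_gt0.
(* The scale matching the two polygons: by conformality the squared sides for [psi] carry the factor
   [c' ^+ 2 / U i ^+ 2] where those for [phi] carry [(c / r) ^+ 2]. *)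
pose lam := (c / r) ^+ 2 * U i ^+ 2 / c' ^+ 2.
have Ui0' : 0 < U i by lra.
have lam0 : 0 < lam.
  have h1 : 0 < (c / r) ^+ 2 by rewrite exprn_gt0 // divr_gt0.
  have h2 : 0 < U i ^+ 2 by rewrite exprn_gt0.
  by rewrite divr_gt0 ?exprn_gt0 // mulr_gt0.
pose p' j := invp (vpt psi i) (vpt psi j).
pose x1 j := lam * sqn (espoke psi i j).
pose Sr j := dS (scal r (z i)) (scal r (z j)).
have cr2 : 0 < (c / r) ^+ 2 by rewrite exprn_gt0 // divr_gt0.
have crpos j (t : R) : j \in lk -> hubc 1 (z i) <= t <= c ->
    0 < cr (vsub (p j) (scal t (z i))) (vsub (p (nx j)) (scal t (z i))).
  move=> jlk /andP[t1 tc]; have f := fnx j jlk; have [ij jk ik] := fd _ _ f.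
  have [e2 he _] := face_heron cF hphi eps0 aphi f.
  have [_ _ _ bj] := nb _ _ f; have [_ _ _ bk] := nb _ _ (rot _ _ f).
  have h0 : 0 < hubc 1 (z i) by rewrite divr_gt0 ?exprn_gt0 // disk_gt0.
  have t0 : 0 <= t by exact: le_trans (ltW h0) t1.
  have tt : t ^+ 2 <= c ^+ 2 by rewrite ler_pXn2r // nnegrE // ltW.
  have bnd v : c ^+ 2 * sqn (vsub (z v) (z i)) <= eps ^+ 2 / 1024 ->
      t ^+ 2 * sqn (vsub (z v) (z i)) <= eps ^+ 2 / 1024.
    by apply: le_trans; rewrite ler_wpM2r // sqn_ge0.
  apply: (@hub_path_pos R _ _ _ eps) => //; try exact: ne; try exact: bnd.
    exact: lt_trans e2 (@pihalf_lt2 R).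
  exact: pos.
have c1c : hubc 1 (z i) <= c.
  have d1 := disk_gt0 (zd i).
  rewrite /c /hubc ler_pdivrMr // mulrAC ler_pdivlMr //.
  have r2 : 1 <= r ^+ 2 by rewrite exprn_ege1 // ltW.
  by rewrite expr1n; lra.
have a2 j : a j ^+ 2 = sqn (vsub (p j) (p (nx j))) by rewrite sqr_sqrtr // sqn_ge0.
have vnx j : j \in lk -> z j != z i /\ z (nx j) != z i.
  by move=> jlk; have [ij _ ik] := fd _ _ (fnx j jlk); split; exact: ne.
have crr j : j \in lk -> 0 < cr (spoke r (z i) (z j)) (spoke r (z i) (z (nx j))).
  by move=> jlk; apply: crpos => //; rewrite c1c lexx.
have a0 j : j \in lk -> 0 < a j.
  move=> jlk; rewrite sqrtr_gt0 sqn_vsub_gt0 //; apply/eqP => e.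
  have := crr j jlk; rewrite /spoke -/(p j) -/(p (nx j)) e crvv ltxx //.
have Sr0 j : j \in lk -> 0 < Sr j.
  move=> jlk; have f := fnx j jlk; have [rj _ _ _] := nb _ _ f.
  apply: dS_gt0; [exact: disk_scal|exact: disk_scal|].
  have [nj _] := vnx j jlk; apply: contra_neq nj => /scal_inj -> //.
  exact: lt0r_neq0.
have x0E j : j \in lk -> x0 j = (c / r) ^+ 2 * (1 + (Sr j)^-1).
  move=> jlk; have [nj _] := vnx j jlk; have [rj _ _ _] := nb _ _ (fnx j jlk).
  by rewrite /x0 sqn_spoke // lt0r_neq0.
have x0p j : j \in lk -> 0 < x0 j.
  move=> jlk; rewrite x0E //; apply: mulr_gt0; first exact: cr2.
  by rewrite addr_gt0 // invr_gt0 Sr0.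
have Up j : j \in lk -> 0 < U j /\ U j <= U i.
  by move=> jlk; have [_ ? ? _] := nb _ _ (fnx j jlk).
(* Compared with [x0E], the constant 1 becomes [U i ^+ 2] and the other term gains the factor
   [U i / U j]: [1 < U i] makes the first larger and maximality keeps the second from decreasing. *)
have x1E j : j \in lk -> x1 j = (c / r) ^+ 2 * (U i ^+ 2 + U i / U j / Sr j).
  move=> jlk; have f := fnx j jlk; have [ij _ _] := fd _ _ f.
  rewrite /x1 /espoke sqn_spoke ?oner_neq0 ?ne' // ?lt0r_neq0 ?disk_gt0 //.
  rewrite !scal1 divr1 -/c' -/(edS psi i j) (conf _ _ f).1 -/(Sr j) /lam.
  have [Uj _] := Up j jlk; have Sj := Sr0 j jlk.
  have Ui0 : U i != 0 by rewrite lt0r_neq0 //; lra.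
  by field; rewrite Ui0 !lt0r_neq0.
have x01 j : j \in lk -> x0 j < x1 j.
  move=> jlk; rewrite x0E // x1E // (ltr_pM2l cr2).
  have [Uj Uij] := Up j jlk; have Sj := Sr0 j jlk.
  apply: ltr_leD; first by rewrite exprn_egt1.
  by rewrite ler_peMl ?invr_ge0 ?(ltW Sj) // ler_pdivlMr // mul1r.
have g0 j : j \in lk -> 0 < gram (a j ^+ 2) (x0 j) (x0 (nx j)).
  move=> jlk; rewrite a2 /x0 -(vsub_spoke r) gram_hub exprn_gt0 //.
  by rewrite mulr_gt0 // crr.
have aE j : j \in lk -> a j ^+ 2 = lam * sqn (vsub (p' j) (p' (nx j))).
  move=> jlk; have f := fnx j jlk; have [ij jk ik] := fd _ _ f.
  have [rj _ _ _] := nb _ _ f; have [rk _ _ _] := nb _ _ (rot _ _ f).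
  have [nj nk] := vnx j jlk.
  rewrite a2 (@sqn_invp_sub_dS _ r) ?lt0r_neq0 //.
  rewrite (@sqn_invp_sub_dS _ 1) ?ne' ?oner_neq0 ?lt0r_neq0 ?disk_gt0 //.
  rewrite !scal1 divr1 -/c' -/c -/(Sr j) -/(Sr (nx j)).
  rewrite -/(edS psi i j) -/(edS psi i (nx j)) -/(edS psi j (nx j)).
  have [-> ->] := conf _ _ f; have [-> _] := conf _ _ (rot _ _ f).
  rewrite -/(Sr j) -/(Sr (nx j)) /lam.
  have [Uj _] := Up j jlk; have [Uk _] := Up _ (nxlk j jlk).
  have Sj := Sr0 j jlk; have Sk := Sr0 _ (nxlk j jlk).
  have Ui0 : U i != 0 by rewrite lt0r_neq0 //; lra.
  move: (dS (scal r (z j)) _) => D.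
  by field; rewrite Ui0 !lt0r_neq0.
have g1 j : j \in lk -> 0 < gram (a j ^+ 2) (x1 j) (x1 (nx j)).
  move=> jlk; rewrite aE // /x1 gramZ /espoke -(vsub_spoke 1) gram_hub.
  apply: mulr_gt0; first exact: exprn_gt0.
  rewrite lt0r sqrf_eq0 sqr_ge0 andbT mulf_neq0 //.
  exact: espoke_cr_neq0 cF hpsi eps0 apsi _ _ _ (fnx j jlk).
have cx0 j : j \in lk -> 0 <= (a j ^+ 2 + x0 (nx j) - x0 j) / a j
       + (a (nx j) ^+ 2 + x0 (nx j) - x0 (nx (nx j))) / a (nx j).
  move=> jlk; have klk := nxlk j jlk; have f := fnx j jlk; have fk := fnx _ klk.
  have [ij jk ik] := fd _ _ f; have [_ _ ik'] := fd _ _ fk.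
  rewrite addrC; apply: hub_convex; rewrite ?crr ?a0 //.
  - rewrite !vsub_spoke; apply: delaunay_convex => //; try exact: ne.
      exact: pos.
    by apply: dphi => //; [exact: rot|exact: nx2].
  - by rewrite a2 vsub_spoke sqn_vsubC.
  - by rewrite a2 vsub_spoke.
have cx1 j : j \in lk -> 0 <= (a j ^+ 2 + x1 (nx j) - x1 j) / a j
       + (a (nx j) ^+ 2 + x1 (nx j) - x1 (nx (nx j))) / a (nx j).
  move=> jlk; have klk := nxlk j jlk; have f := fnx j jlk; have fk := fnx _ klk.
  pose q := Num.sqrt lam.
  have q0 : 0 < q by rewrite sqrtr_gt0.
  have q2 : q ^+ 2 = lam by rewrite sqr_sqrtr // ltW.
  have H := @espoke_convex i (nx j) (nx (nx j)) j (a (nx j) / q) (a j / q) fk (rot _ _ f)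
    (nx2 j jlk).
  have E (v w : V) : (a v ^+ 2 + x1 (nx j) - x1 w) / a v =
      q * (((a v / q) ^+ 2 + sqn (espoke psi i (nx j)) - sqn (espoke psi i w)) / (a v / q)).
    rewrite /x1 -q2; have [->|av] := eqVneq (a v) 0.
      by rewrite mul0r !invr0 !mulr0.
    by field; rewrite av lt0r_neq0.
  rewrite !E -mulrDr addrC mulr_ge0 ?(ltW q0) //; apply: H.
  - by rewrite divr_gt0 ?a0.
  - by rewrite expr_div_n q2 aE // mulrAC mulfV ?lt0r_neq0 // mul1r sqn_vsubC.
  - by rewrite divr_gt0 ?a0.
  - by rewrite expr_div_n q2 aE // mulrAC mulfV ?lt0r_neq0 // mul1r.
have [_ _ _ /(_ i)[j0 [k0 f0]]] := cF.
have lk0 : exists j, j \in lk.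
  by have [[jlk _]|[klk _]] := all _ _ f0; [exists j0|exists k0].
have := @hub_angle_sum_decreasing R V lk nx a x0 x1 pn lk0 a0 x0p x01 g0 g1 cx0 cx1.
have -> : \sum_(j <- lk) side_angle (a j ^+ 2) (x1 j) (x1 (nx j)) =
    \sum_(j <- lk) eangle psi i j (nx j).
  rewrite big_seq [RHS]big_seq; apply: eq_bigr => j jlk.
  by rewrite aE // side_angleZ.
have -> : \sum_(j <- lk) side_angle (a j ^+ 2) (x0 j) (x0 (nx j)) =
    \sum_(j <- lk) eangle phi i j (nx j).
  transitivity (\sum_(j <- lk) hub_angle (scal c (z i)) (p j) (p (nx j))).
    by apply: eq_bigr => j _; rewrite a2.
  (* The hub slides from its dilated position to the one for [r = 1], from which the true angles of
     [phi] are seen. *)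
  apply/esym; apply: (hub_angle_sum_const pn c1c) => t tt j jlk.
  exact: crpos.
have ge := eangle_sum_ge cF gpsi hpsi eps0 apsi lc.
have le : \sum_(j <- lk) eangle phi i j (nx j) <= 2 * pi.
  apply: (eangle_sum_le cF gphi hphi ulk) => j jlk.
  by split; [exact: fnx|exact: pos].
by lra.
Qed.

End MaximumPrinciple.

(** * Choice of the dilation and bound on the conformal factor *)

Lemma exists_dilation (R : realType) (n E : R) : 0 <= n -> n < 1 -> 1 < E ->
  exists r, [/\ 1 < r, r < 2 & r * (1 - n) < E * (1 - r ^+ 2 * n)].
Proof.
move=> n0 n1 E1; have m0 : 0 < 1 - n by rewrite subr_gt0.
have d0 : 0 < 2 * (1 + 3 * E) by lra.
(* Passing from 1 to [1 + d] costs at most [d (1 + 3 E)], half of the initial gap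
   [(1 - n) (E - 1)]. *)
pose d := (1 - n) * (E - 1) / (2 * (1 + 3 * E)).
have dp : 0 < d by rewrite divr_gt0 // mulr_gt0 // subr_gt0.
have dE : d * (2 * (1 + 3 * E)) = (1 - n) * (E - 1) by rewrite /d divfK // lt0r_neq0.
have d1 : d < 1 / 4.
  rewrite /d ltr_pdivrMr //; apply: (@le_lt_trans _ _ (1 * (E - 1))).
    by rewrite ler_wpM2r; lra.
  by lra.
exists (1 + d); split; [lra|lra|].
rewrite -subr_gt0.
have -> : E * (1 - (1 + d) ^+ 2 * n) - (1 + d) * (1 - n) =
  (1 - n) * (E - 1) - d * (1 - n) - E * n * d * (2 + d) by ring.
rewrite -dE.
have Ed : 0 < E * d by rewrite mulr_gt0; lra.
have h1 : E * n * d * (2 + d) <= E * d * 3.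
  rewrite (_ : E * n * d * (2 + d) = E * d * (n * (2 + d))); last by ring.
  rewrite ler_pM2l //; have : n * (2 + d) <= 1 * (2 + d) by rewrite ler_wpM2r; lra.
  by lra.
have h2 : d * (1 - n) <= d * 1 by rewrite ler_wpM2l; lra.
by lra.
Qed.

Lemma sinh_le2 (R : realType) (x : R) : 0 <= x -> x <= 1 / 2 -> sinhR x <= 2 * x.
Proof.
move=> x0 x1; rewrite /sinhR ler_pdivrMr //.
have h1 : 1 - x <= expR (- x) := expR_ge1Dx (- x).
have h2 : expR x <= (1 - x)^-1.
  by rewrite -[x in expR x]opprK expRN lef_pV2 // posrE ?expR_gt0 //; lra.
have h3 : (1 - x)^-1 <= 1 + 2 * x.
  have p : 0 < 1 - x by lra.
  rewrite -[leLHS]mul1r ler_pdivrMr //.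
  have : 0 <= x * (1 - 2 * x) by rewrite mulr_ge0 //; lra.
  by lra.
by lra.
Qed.

Section Rigidity.
Variables (R : realType) (V : eqType) (F : V -> V -> V -> Prop).
Variables (phi psi : (V -> R) -> R * R) (eps : R).
Hypotheses (cF : is_complex F) (eps0 : 0 < eps).
Hypotheses (gphi : geodesic_map F phi) (hphi : homeo_onto_H2 F phi).
Hypotheses (dphi : delaunay F phi) (aphi : angles_ge F phi eps).
Hypotheses (gpsi : geodesic_map F psi) (hpsi : homeo_onto_H2 F psi).
Hypotheses (dpsi : delaunay F psi) (apsi : angles_ge F psi eps).
Variable E : V -> R.
Hypothesis E0 : forall v, 0 < E v.
Hypothesis conf : forall i j, edge F i j -> edS psi i j = E i * E j * edS phi i j.
Hypothesis sphi : forall i j, edge F i j -> edS phi i j <= eps ^+ 6 / 2 ^+ 26.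
Hypothesis spsi : forall i j, edge F i j -> edS psi i j <= eps ^+ 6 / 2 ^+ 26.

(** Comparing the sides [ik] and [jk] costs [8 / eps^2] in each map, so [E_i / E_j <= 64 / eps^4].
    Hence [E_i^2 S_ij = (E_i / E_j) S'_ij] is at most [64 / eps^4] times [eps^6 / 2^26], which is
    the stated bound. *)
Lemma conformal_factor_length (i j k : V) : F i j k ->
  [/\ eps < 2, edS phi i j <= 1 / 4 & E i ^+ 2 * edS phi i j <= eps ^+ 2 / 2 ^+ 20].
Proof.
move=> f; have [[ij jk ik] [f1 f2 f3 f4 f5]] := complex_faces cF f.
have [e1 _ _] := face_heron cF hphi eps0 aphi f.
have e2 : eps < 2 := lt_trans e1 (@pihalf_lt2 R).
have e6 : eps ^+ 6 <= 64.
  by rewrite (_ : 64 = 2 ^+ 6 :> R); [rewrite ler_pXn2r ?nnegrE // ltW|ring].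
have small : eps ^+ 6 / 2 ^+ 26 <= 1 / 4 by lra.
have eij : edge F i j by exists k.
have eik : edge F i k by exists j.
have ejk : edge F j k by exists i.
split=> //; first exact: le_trans (sphi eij) small.
have [sij sik sjk] : [/\ 0 < edS phi i j, 0 < edS phi i k & 0 < edS phi j k].
  by split; exact: edS_gt0 cF hphi _ _ _.
have [tij tik tjk] : [/\ 0 < edS psi i j, 0 < edS psi i k & 0 < edS psi j k].
  by split; exact: edS_gt0 cF hpsi _ _ _.
have le1 x : x <= eps ^+ 6 / 2 ^+ 26 -> x <= 1 by lra.
have h1 : eps ^+ 2 * edS phi j k <= 8 * edS phi i k.
  have [_ h _] := face_heron cF hphi eps0 aphi f2.
  apply: heron_sides h => //; last exact: le1 (sphi eik).
  by apply: (edS_gt0 cF hphi); rewrite eq_sym.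
have h2 : eps ^+ 2 * edS psi i k <= 8 * edS psi j k.
  have [_ h _] := face_heron cF hpsi eps0 apsi f.
  by apply: heron_sides h => //; exact: le1 (spsi ejk).
rewrite !conf // in h2.
have := spsi eij; rewrite conf // => h3.
move: (edS phi i j) (edS phi i k) (edS phi j k) sij sik sjk h1 h2 h3 => x y w x0 y0 w0.
have Ei := E0 i; have Ej := E0 j; have Ek := E0 k.
move: (E i) (E j) (E k) Ei Ej Ek => a b c a0 b0 c0 h1 h2 h3.
have e20 : 0 < eps ^+ 2 by rewrite exprn_gt0.
have {}h2 : eps ^+ 2 * (a * y) <= 8 * (b * w).
  by rewrite -(ler_pM2r c0); move: h2; lra.
have h4 : eps ^+ 4 * a <= 64 * b.
  rewrite -(ler_pM2r y0).
  have h5 := ler_wpM2l (ltW e20) h2.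
  have h6 := ler_wpM2l (ltW b0) h1.
  rewrite (_ : eps ^+ 4 * a * y = eps ^+ 2 * (eps ^+ 2 * (a * y))); last by ring.
  by move: h5 h6; lra.
have e40 : 0 < eps ^+ 4 by rewrite exprn_gt0.
rewrite -(ler_pM2l e40).
have h7 := ler_wpM2r (ltW (mulr_gt0 a0 x0)) h4.
rewrite (_ : eps ^+ 4 * (a ^+ 2 * x) = eps ^+ 4 * a * (a * x)); last by ring.
apply: (le_trans h7); rewrite (_ : _ * (eps ^+ 2 / _) = 64 * (eps ^+ 6 / 2 ^+ 26)).
  by rewrite (_ : 64 * b * (a * x) = 64 * (a * b * x)); [rewrite ler_pM2l|ring].
by field.
Qed.

Lemma conformal_factor_le1 (i0 : V) : E i0 <= 1.
Proof.
rewrite leNgt; apply/negP => Ei0; pose z := vpt phi.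
have zd : forall v, diskD (z v) := vpt_disk cF hphi.
have zp v : 0 < 1 - sqn (z v) by rewrite subr_gt0; exact: zd.
have [r [r1 r2 hr]] := exists_dilation (sqn_ge0 (z i0)) (zd i0) Ei0.
have r0 : 0 < r by lra.
pose X v := 1 - r ^+ 2 * sqn (z v).
pose U v := E v * X v / (r * (1 - sqn (z v))).
have U1 v : (1 < U v) = (r * (1 - sqn (z v)) < E v * X v).
  by rewrite /U ltr_pdivlMr ?mul1r // mulr_gt0.
have Upos v : 0 < X v -> 0 < U v.
  by move=> Xv; rewrite divr_gt0 // mulr_gt0.
have [s hs] : exists s : seq V, forall v, 0 < X v -> v \in s.
  have [|s hs] := @finite_vertices R V F phi cF hphi (r ^- 2).
    by rewrite invf_lt1 ?exprn_gt0 // exprn_egt1.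
  exists s => v; rewrite subr_gt0 => Xv; apply: hs.
  by rewrite -[leRHS]mul1r ler_pdivlMr ?exprn_gt0 // mulrC ltW.
have X0 : 0 < X i0.
  have : 0 < E i0 * X i0 by apply: lt_trans hr; rewrite mulr_gt0.
  by rewrite pmulr_rgt0.
(* The list [s] may contain further vertices; the filter retains exactly those that the dilation
   keeps inside the disk. *)
have i0s : i0 \in [seq v <- s | 0 < X v] by rewrite mem_filter X0 hs.
have [m ms mmax] := seq_argmax U i0s.
have Xm : 0 < X m by move: ms; rewrite mem_filter => /andP[].
have Um : 1 < U m by apply: lt_le_trans (mmax _ i0s); rewrite U1.
have near j k : F m j k -> 0 < X j /\
    hubc r (z m) ^+ 2 * sqn (vsub (z j) (z m)) <= eps ^+ 2 / 1024.
  move=> f; have [e2 S1 hS] := conformal_factor_length f.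
  have Xm1 : r ^+ 2 * sqn (z m) < 1 by rewrite -subr_gt0.
  have Um' := Um; rewrite U1 in Um'.
  have [h1 h2] := spoke_length_bound (zd m) (zd j) eps0 (ltW e2) (E0 m) r1 Xm1 S1 Um' hS.
  split; first by rewrite subr_gt0.
  have Xm2 : 0 < X m ^+ 2 by rewrite exprn_gt0.
  rewrite /hubc -/(X m) expr_div_n mulrAC ler_pdivrMr //.
  have r4 : r ^+ 2 <= 4 by rewrite (_ : 4 = 2 ^+ 2 :> R); [rewrite ler_pXn2r ?nnegrE // ltW|ring].
  have h3 := ler_wpM2l (sqr_ge0 r) h1.
  rewrite (_ : (r ^+ 2) ^+ 2 * _ = r ^+ 2 * (r ^+ 2 * sqn (vsub (z j) (z m)))); last by ring.
  apply: (le_trans h3); rewrite mulrA ler_wpM2r ?(ltW Xm2) //.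
  apply: (@le_trans _ _ (4 * (eps ^+ 2 / 2 ^+ 18))).
    by rewrite ler_wpM2r // divr_ge0 ?sqr_ge0.
  by have := sqr_ge0 eps; lra.
(* Dilation multiplies [|u - v|^2] by [r^2] and replaces each height [1 - |z|^2] by [X]; the formula
   for [U] compensates for both. *)
have cE u v : edge F u v -> 0 < X u -> 0 < X v ->
    edS psi u v = U u * U v * dS (scal r (z u)) (scal r (z v)).
  move=> e Xu Xv; rewrite conf // /edS /dS vsub_scal !sqn_scal /U -/(X u) -/(X v).
  have h1 := lt0r_neq0 (zp u); have h2 := lt0r_neq0 (zp v).
  have h3 := lt0r_neq0 Xu; have h4 := lt0r_neq0 Xv.
  rewrite -/(z u) -/(z v) in h1 h2 *.
  move: (sqn (vsub (z u) (z v))) (X u) (X v) h3 h4 => d x y h3 h4.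
  move: (1 - sqn (z u)) (1 - sqn (z v)) h1 h2 => x' y' h1 h2.
  by field; rewrite h1 h2 h3 h4 lt0r_neq0.
apply: (@local_maximum R V F phi psi eps cF eps0 gphi hphi dphi aphi gpsi hpsi dpsi apsi
  m r U) => //.
  move=> j k f; have [Xj hj] := near j k f; split => //; first exact: Upos.
  by apply: mmax; rewrite mem_filter Xj hs.
move=> j k f; have [_ [f1 f2 f3 f4 f5]] := complex_faces cF f.
have [Xj _] := near j k f; have [Xk _] := near k j f1.
by split; apply: cE => //; [exists k|exists m].
Qed.

End Rigidity.

(** For lengths [l <= 1] the half-sinh is at most [l], so the bound is the square of [eps^3 / 8192],
    where [8192 = 2^13]. *)
Lemma edS_small (R : realType) (V : eqType) (F : V -> V -> V -> Prop)
    (phi : (V -> R) -> R * R) (eps : R) (i j : V) :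
  is_complex F -> homeo_onto_H2 F phi -> 0 < eps -> eps < 2 ->
  sup_len_lt F phi (eps ^+ 3 / 8192) -> edge F i j ->
  edS phi i j <= eps ^+ 6 / 2 ^+ 26.
Proof.
move=> cF hphi e0 e2 [M [Mlt hM]] /hM le.
have zd := vpt_disk cF hphi.
rewrite /edS -sinh_half_hdist //; set l := hdist _ _.
have l0 : 0 <= l := hdist_ge0 (zd i) (zd j).
have l1 : l <= eps ^+ 3 / 8192 by apply: ltW; exact: le_lt_trans le Mlt.
have e3 : eps ^+ 3 <= 8.
  by rewrite (_ : 8 = 2 ^+ 3 :> R); [rewrite ler_pXn2r ?nnegrE // ltW|ring].
have q1 : eps ^+ 3 / 8192 <= 1 by lra.
have -> : eps ^+ 6 / 2 ^+ 26 = (eps ^+ 3 / 8192) ^+ 2 by field.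
move: (eps ^+ 3 / 8192) l1 q1 => q l1 q1.
have h : sinhR (l / 2) <= 2 * (l / 2) by apply: sinh_le2; lra.
have lq : sinhR (l / 2) <= q by lra.
have s0 : 0 <= sinhR (l / 2) by apply: sinh_ge0; rewrite divr_ge0.
by rewrite ler_pXn2r // nnegrE // (le_trans s0 lq).
Qed.

Theorem theorem1p1 (R : realType) (V : eqType) (F : V -> V -> V -> Prop)
    (eps : R) (phi psi : (V -> R) -> R * R) :
  infinite_triangulation_H2 R F -> 0 < eps ->
  geodesic_map F phi -> geodesic_map F psi ->
  delaunay F phi -> delaunay F psi ->
  homeo_onto_H2 F phi -> homeo_onto_H2 F psi ->
  disc_conformal F (elen phi) (elen psi) ->
  angles_ge F phi eps -> angles_ge F psi eps ->
  sup_len_lt F phi (eps ^+ 3 / 8192) -> sup_len_lt F psi (eps ^+ 3 / 8192) ->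
  forall i j, edge F i j -> elen phi i j = elen psi i j.
Proof.
move=> [cF _ _] e0 gphi gpsi dphi dpsi hphi hpsi [u hu] aphi apsi lphi lpsi i j eij.
have [k fk] := eij.
have [e1 _ _] := face_heron cF hphi e0 aphi fk.
have e2 : eps < 2 := lt_trans e1 (@pihalf_lt2 R).
have zd := vpt_disk cF hphi; have zd' := vpt_disk cF hpsi.
have conf a b : edge F a b -> edS psi a b = expR (u a) * expR (u b) * edS phi a b.
  move=> /hu; rewrite /elen /edS -!sinh_half_hdist // => ->.
  rewrite exprMn -expRD; congr (_ * _).
  by rewrite expr2 -expRD -splitr.
have conf' a b : edge F a b -> edS phi a b = expR (- u a) * expR (- u b) * edS psi a b.
  move=> /conf ->.
  have eV v : expR (- u v) * expR (u v) = 1 by rewrite -expRD addNr expR0.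
  transitivity (expR (- u a) * expR (u a) * (expR (- u b) * expR (u b)) * edS phi a b).
    by rewrite !eV !mul1r.
  by ring.
have sphi a b : edge F a b -> edS phi a b <= eps ^+ 6 / 2 ^+ 26.
  exact: edS_small.
have spsi a b : edge F a b -> edS psi a b <= eps ^+ 6 / 2 ^+ 26.
  exact: edS_small.
have le1 v : expR (u v) <= 1.
  exact: (conformal_factor_le1 cF e0 gphi hphi dphi aphi gpsi hpsi dpsi apsi
    (fun w => expR_gt0 (u w)) conf sphi spsi).
have ge1 v : expR (- u v) <= 1.
  exact: (conformal_factor_le1 cF e0 gpsi hpsi dpsi apsi gphi hphi dphi aphi
    (fun w => expR_gt0 (- u w)) conf' spsi sphi).
have u0 v : expR (u v) = 1.
  apply/eqP; rewrite eq_le le1 /= -[leRHS]mulr1.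
  have : expR (u v) * expR (- u v) = 1 by rewrite -expRD subrr expR0.
  by move=> {1}<-; rewrite ler_wpM2l // expR_ge0.
have := conf i j eij; rewrite !u0 !mul1r /elen !hdistE.
by rewrite /edS /vpt => ->.
Qed.
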